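(* Let $\overline{X}=(X_0,X_1)$ be a compatible (quasi-)Banach couple and let $0<\theta_0<\theta_1<1$. Let $E,E_0,E_1,F_0,F_1$ be r.i. spaces and let $a_0,a_1,b,b_0,b_1\in SV$ be such that $\|b_0\|_{\widetilde{E}_0(0,1)}<\infty$ and $\|b_1\|_{\widetilde{E}_1(1,\infty)}<\infty$. Put $$\rho(u)=u^{\theta_1-\theta_0}\frac{a_0(u)\|b_0\|_{\widetilde{E}_0(0,u)}}{a_1(u)\|b_1\|_{\widetilde{E}_1(u,\infty)}},\qquad u>0.$$ (a) If $0<\theta<1$, then $$\big(\overline{X}^{\mathcal R}_{\theta_0,b_0,E_0,a_0,F_0},\overline{X}^{\mathcal L}_{\theta_1,b_1,E_1,a_1,F_1}\big)_{\theta,b,E}=\overline{X}_{\tilde\theta,B_\theta,E},$$ where $\tilde\theta=(1-\theta)\theta_0+\theta\theta_1$ and $B_\theta(u)=\big(a_0(u)\|b_0\|_{\widetilde{E}_0(0,u)}\big)^{1-\theta}\big(a_1(u)\|b_1\|_{\widetilde{E}_1(u,\infty)}\big)^{\theta}\,b(\rho(u))$, $u>0$. (b) If $\theta=0$ and $\|b\|_{\widetilde{E}(1,\infty)}<\infty$, then $$\big(\overline{X}^{\mathcal R}_{\theta_0,b_0,E_0,a_0,F_0},\overline{X}^{\mathcal L}_{\theta_1,b_1,E_1,a_1,F_1}\big)_{0,b,E}=\overline{X}^{\mathcal R,\mathcal L}_{\theta_0,b\circ\rho,E,b_0,E_0,a_0,F_0}.$$ (c) If $\theta=1$ and $\|b\|_{\widetilde{E}(0,1)}<\infty$,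 then $$\big(\overline{X}^{\mathcal R}_{\theta_0,b_0,E_0,a_0,F_0},\overline{X}^{\mathcal L}_{\theta_1,b_1,E_1,a_1,F_1}\big)_{1,b,E}=\overline{X}^{\mathcal L,\mathcal R}_{\theta_1,b\circ\rho,E,b_1,E_1,a_1,F_1}.$$
   Context: R.i. spaces: an ''r.i. space'' $E$ is a rearrangement invariant Banach function space on $(0,\infty)$ (Lebesgue measure) with the Fatou property. $\widetilde{E}$ denotes the corresponding r.i. space with respect to the measure $dt/t$ on $(0,\infty)$: if $E=\mathcal F(L_1,L_\infty)$ for an interpolation functor $\mathcal F$, then $\widetilde{E}=\mathcal F(\widetilde L_1,L_\infty)$ with $\widetilde L_1=L_1((0,\infty),dt/t)$; concretely $\|f\|_{\widetilde E}=\|f^\star\|_E$, where $f^\star$ is the non-increasing rearrangement of $f$ with respect to $dt/t$. For an interval $I\subset(0,\infty)$, $\|f\|_{\widetilde E(I)}=\|f\chi_I\|_{\widetilde E}$. Slowly varying functions: a positive (finite) measurable function $b$ on $(0,\infty)$ belongs to $SV$ if for every $\varepsilon>0$, $t^{\varepsilon}b(t)$ is equivalent to a non-decreasing function and $t^{-\varepsilon}b(t)$ is equivalent to a non-increasing function on $(0,\infty)$ (equivalent: each bounded by a constant multiple of the other). Spaces: for a compatible (quasi-)Banach couple $\overline X=(X_0,X_1)$, $K(t,f)=\inf\{\|f_0\|_{X_0}+t\|f_1\|_{X_1}: f=f_0+f_1,\ f_i\in X_i\}$. The following spaces consist of all $f\in X_0+X_1$ for which the indicated (quasi-)norm is finite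 (the innermost norm is taken in the variable $s$, the next in $t$, the outermost in $u$, when present): - $\overline X_{\theta,b,E}$ (also written $(X_0,X_1)_{\theta,b,E}$): $\|t^{-\theta}b(t)K(t,f)\|_{\widetilde E}$, $0\le\theta\le1$; - $\overline X^{\mathcal R}_{\theta,b,E,a,F}$: $\big\|b(t)\|s^{-\theta}a(s)K(s,f)\|_{\widetilde F(t,\infty)}\big\|_{\widetilde E}$; - $\overline X^{\mathcal L}_{\theta,b,E,a,F}$: $\big\|b(t)\|s^{-\theta}a(s)K(s,f)\|_{\widetilde F(0,t)}\big\|_{\widetilde E}$; - $\overline X^{\mathcal R,\mathcal L}_{\theta,c,E,b,F,a,G}$: $\Big\|c(u)\big\|b(t)\|s^{-\theta}a(s)K(s,f)\|_{\widetilde G(t,u)}\big\|_{\widetilde F(0,u)}\Big\|_{\widetilde E}$; - $\overline X^{\mathcal L,\mathcal R}_{\theta,c,E,b,F,a,G}$: $\Big\|c(u)\big\|b(t)\|s^{-\theta}a(s)K(s,f)\|_{\widetilde G(u,t)}\big\|_{\widetilde F(u,\infty)}\Big\|_{\widetilde E}$. Equality of spaces means equality as sets with equivalent (quasi-)norms. *)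

(* Defs.v *)
From HB Require Import structures.
From mathcomp Require Import all_boot all_order all_algebra.
From mathcomp Require Import all_classical all_reals all_analysis.
From mathcomp Require Import measurable_realfun.

Set Implicit Arguments.
Unset Strict Implicit.
Unset Printing Implicit Defensive.

Import Order.TTheory GRing.Theory Num.Theory.
Import numFieldNormedType.Exports.

Local Open Scope classical_set_scope.
Local Open Scope ring_scope.

Section FunctionNorms.
Context {R : realType}.
Local Notation mu := (@lebesgue_measure R).

Definition halfline : set R := `]0, +oo[.

(* Functions on (0, oo) are represented by functions on R; their values outside
   (0, oo) are never taken into account. *)
Definition nnegmeas (f : R -> \bar R) : Prop :=
  measurable_fun halfline f /\ (forall t, halfline t -> (0 <= f t)%E).

Definition equimeasurable (f g : R -> \bar R) : Prop :=
  forall s : R, 0 <= s ->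
    mu (halfline `&` [set t | (s%:E < f t)%E]) =
    mu (halfline `&` [set t | (s%:E < g t)%E]).

(* Bennett-Sharpley axioms of a rearrangement invariant Banach function norm;
   [ri_fatou] is the Fatou property. *)
Record is_ri_norm (N : (R -> \bar R) -> \bar R) : Prop := {
  ri_ge0 : forall f, nnegmeas f -> (0 <= N f)%E;
  ri_eq0 : forall f, nnegmeas f ->
    N f = 0%E <-> {ae mu, forall t, halfline t -> f t = 0%E};
  ri_homo : forall (c : R) f, 0 <= c -> nnegmeas f ->
    N (fun t => c%:E * f t)%E = (c%:E * N f)%E;
  ri_triangle : forall f g, nnegmeas f -> nnegmeas g ->
    (N (fun t => f t + g t) <= N f + N g)%E;
  ri_mono : forall f g, nnegmeas f -> nnegmeas g ->
    {ae mu, forall t, halfline t -> (f t <= g t)%E} -> (N f <= N g)%E;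
  ri_fatou : forall (f_ : nat -> R -> \bar R) f,
    (forall n, nnegmeas (f_ n)) -> nnegmeas f ->
    {ae mu, forall t, halfline t ->
      nondecreasing_seq (f_ ^~ t) /\ f_ n t @[n --> \oo] --> f t} ->
    N (f_ n) @[n --> \oo] --> N f;
  ri_indic : forall A : set R, measurable A -> A `<=` halfline ->
    (mu A < +oo)%E -> (N (fun t => (\1_A t)%:E) < +oo)%E;
  ri_local_L1 : forall A : set R, measurable A -> A `<=` halfline ->
    (mu A < +oo)%E ->
    exists2 C : R, 0 < C & forall f, nnegmeas f ->
      (\int[mu]_(t in A) f t <= C%:E * N f)%E;
  ri_rearrangement : forall f g, nnegmeas f -> nnegmeas g ->
    equimeasurable f g -> N f = N g }.

Record ri_space := RISpace {
  ri_norm :> (R -> \bar R) -> \bar R;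
  ri_normP : is_ri_norm ri_norm }.

(* The measure dt/t of a measurable subset of (0, oo). *)
Definition dtt (A : set R) : \bar R := (\int[mu]_(t in A) (t^-1)%:E)%E.

(* The non-increasing rearrangement of f with respect to dt/t. *)
Definition rearr (f : R -> \bar R) (t : R) : \bar R :=
  ereal_inf [set s | (0 <= s)%E /\
    (dtt (halfline `&` [set x | (s < `|f x|)%E]) <= t%:E)%E].

Definition tnorm (E : ri_space) (f : R -> \bar R) : \bar R := E (rearr f).

Definition tnorm_on (E : ri_space) (I : set R) (f : R -> \bar R) : \bar R :=
  tnorm E (f \_ I).

End FunctionNorms.
Arguments ri_space : clear implicits.

Section SlowlyVarying.
Context {R : realType}.

Definition equivalent_fun (f g : R -> R) : Prop :=
  exists2 C : R, 0 < C &
    forall t, 0 < t -> f t <= C * g t /\ g t <= C * f t.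

Definition slowly_varying (b : R -> R) : Prop :=
  [/\ measurable_fun (@halfline R) b, (forall t, 0 < t -> 0 < b t) &
    forall e : R, 0 < e ->
      (exists2 g : R -> R,
         {in halfline &, {homo g : s t / s <= t}} &
         equivalent_fun (fun t => t `^ e * b t) g) /\
      (exists2 g : R -> R,
         {in halfline &, {homo g : s t / s <= t >-> t <= s}} &
         equivalent_fun (fun t => t `^ (- e) * b t) g)].

End SlowlyVarying.

(* A quasi-normed space X embedded in V is represented by its quasi-norm,
   extended by +oo outside X, so that X = [set x | N x < +oo]. *)
Section Couples.
Context {R : realType}.

Section Abstract.
Context {V : lmodType R}.
Implicit Types N X : V -> \bar R.

Definition same_space N N' : Prop :=
  [set f | (N f < +oo)%E] = [set f | (N' f < +oo)%E] /\
  exists2 C : R, 0 < C & forall f, (N f < +oo)%E ->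
    (N f <= C%:E * N' f)%E /\ (N' f <= C%:E * N f)%E.

Definition in_sum X0 X1 (f : V) : Prop :=
  exists f0 f1, [/\ (X0 f0 < +oo)%E, (X1 f1 < +oo)%E & f = f0 + f1].

Definition Kfun X0 X1 (f : V) (t : R) : \bar R :=
  ereal_inf [set k | exists f0 f1,
    [/\ (X0 f0 < +oo)%E, (X1 f1 < +oo)%E, f = f0 + f1 &
        k = (X0 f0 + t%:E * X1 f1)%E]].

Definition on_sum X0 X1 N (f : V) : \bar R :=
  if `[< in_sum X0 X1 f >] then N f else +oo%E.

Definition wK X0 X1 (theta : R) (a : R -> R) (f : V) (s : R) : \bar R :=
  ((s `^ (- theta) * a s)%:E * Kfun X0 X1 f s)%E.

Definition interp X0 X1 (theta : R) (b : R -> R) (E : ri_space R) :=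
  on_sum X0 X1 (fun f => tnorm E (wK X0 X1 theta b f)).

Definition interpR X0 X1 (theta : R) (b : R -> R) (E : ri_space R)
    (a : R -> R) (F : ri_space R) :=
  on_sum X0 X1 (fun f => tnorm E (fun t =>
    ((b t)%:E * tnorm_on F `]t, +oo[ (wK X0 X1 theta a f))%E)).

Definition interpL X0 X1 (theta : R) (b : R -> R) (E : ri_space R)
    (a : R -> R) (F : ri_space R) :=
  on_sum X0 X1 (fun f => tnorm E (fun t =>
    ((b t)%:E * tnorm_on F `]0%R, t[ (wK X0 X1 theta a f))%E)).

Definition interpRL X0 X1 (theta : R) (c : R -> R) (E : ri_space R)
    (b : R -> R) (F : ri_space R) (a : R -> R) (G : ri_space R) :=
  on_sum X0 X1 (fun f => tnorm E (fun u =>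
    ((c u)%:E * tnorm_on F `]0%R, u[ (fun t =>
      (b t)%:E * tnorm_on G `]t, u[ (wK X0 X1 theta a f)))%E)).

Definition interpLR X0 X1 (theta : R) (c : R -> R) (E : ri_space R)
    (b : R -> R) (F : ri_space R) (a : R -> R) (G : ri_space R) :=
  on_sum X0 X1 (fun f => tnorm E (fun u =>
    ((c u)%:E * tnorm_on F `]u, +oo[ (fun t =>
      (b t)%:E * tnorm_on G `]u, t[ (wK X0 X1 theta a f)))%E)).

End Abstract.

(* Scalars are real: a complex space is also a real one, and neither the sum,
   the K-functional nor the quasi-norms depend on the choice of scalars. *)
Record quasi_banach_in (V : topologicalLmodType R) (N : V -> \bar R) : Prop := {
  qb_ge0 : forall x, (0 <= N x)%E;
  qb_eq0 : forall x, N x = 0%E <-> x = 0;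
  qb_homo : forall (c : R) x, N (c *: x) = (`|c|%:E * N x)%E;
  qb_triangle : exists2 C : R, 0 < C &
    forall x y, (N (x + y)%R <= C%:E * (N x + N y))%E;
  qb_complete : forall u : nat -> V,
    (forall n, (N (u n) < +oo)%E) ->
    (forall e : R, 0 < e -> exists M, forall m n, (M <= m)%N -> (M <= n)%N ->
       (N (u m - u n)%R < e%:E)%E) ->
    exists2 l, (N l < +oo)%E & N (u n - l) @[n --> \oo] --> 0%E;
  qb_embedding : forall x, (N x < +oo)%E -> forall U, nbhs x U ->
    exists2 d : R, 0 < d & forall y, (N (y - x)%R < d%:E)%E -> U y }.

Definition compatible_couple (V : topologicalLmodType R) (X0 X1 : V -> \bar R) :
    Prop :=
  [/\ hausdorff_space V, quasi_banach_in X0 & quasi_banach_in X1].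

(* For slowly varying b the norms below are positive for u > 0, and they are
   finite as soon as the norm over (0, 1), resp. (1, oo), is; [fine] then loses
   nothing. *)
Definition Alow (a b : R -> R) (E : ri_space R) (u : R) : R :=
  a u * fine (tnorm_on E `]0%R, u[ (fun t => (b t)%:E)).

Definition Ahigh (a b : R -> R) (E : ri_space R) (u : R) : R :=
  a u * fine (tnorm_on E `]u, +oo[ (fun t => (b t)%:E)).

End Couples.

(* Main.v *)
Require Import Defs.
From HB Require Import structures.
From mathcomp Require Import all_boot all_order all_algebra.
From mathcomp Require Import all_classical all_reals all_analysis.
From mathcomp Require Import measurable_realfun.
From mathcomp Require Import ring lra zify.

(** The measure [dt/t] is invariant under dilations, so the half-line is cut into
    the blocks between [e^k] and [e^(k+1)]. Slowly varying functions,
    K-functionals and the norms over [(0,u)] and [(u,oo)] all vary by bounded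
    factors on a block, and each side of the three equalities becomes, up to
    constants, a norm [snorm] of a sequence indexed by the integers. These norms
    are countably subadditive ([snorm_series], from the Fatou property) and do not
    increase when entries are placed at other indices without repetition
    ([snorm_reindex], from rearrangement invariance); translations and reflections
    are special cases. A slowly varying function times [t^d] becomes a sequence of
    [growth d], whose norm over a half-line on which it decreases geometrically is
    carried by its first entry ([growth_tail], [growth_head]).

    The heart of the proof is a Holmstedt-type formula. Let [om0 = t^(-theta0) A0]
    and [om1 = t^(-theta1) A1], where [A0] and [A1] are the slowly varying factors
    in [rho], so that [rho = om0 / om1]. Then the K-functional of the endpoint
    spaces at [rho(u)] is equivalent to the sum [Ksum] of the truncation to [(0,u)]
    of the first endpoint norm (the head), the middle term [om0(u) K(u,f)], and
    [rho(u)] times the truncation to [(u,oo)] of the second endpoint norm (the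
    tail). For the upper bound ([Ksum_ge_norms]) split [f] near-optimally for
    [K(u,f)]: beyond [u] the first part has a flat K-functional, below [u] the
    second has a linear one, and these contribute only the middle term. For the
    lower bound ([Ksum_le_norms]) the endpoint norms dominate [om0 K] and [om1 K]
    pointwise, so that in any decomposition the head of the second part and the
    tail of the first are norms of powers of exponents [theta1 - theta0] and
    [theta0 - theta1].

    Substituting [t = rho(u)] in the outer norm costs a constant, because [rho]
    grows like a power of positive exponent: the index of the block of [rho(e^n)]
    takes each value boundedly often and comes within a bounded distance of every
    integer ([snorm_comp], [snorm_le_comp], [level_inj], [level_surj]). It remains
    to compare the three terms under the weight [W = rho^(-theta) b(rho)]. The head
    at [u] is dominated by the sum of the middle terms at [e^(-j) u], and for
    [theta > 0] the weight makes this sum geometric; the tail behaves in the same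
    way for [theta < 1] ([hardy_head], [hardy_tail]). Pointwise, the middle term is
    dominated by the head and by [rho] times the tail. So the middle term alone
    remains for [0 < theta < 1], and its weight [W om0] is that of the theorem; the
    head remains for [theta = 0] and the tail for [theta = 1].

    The statements about tails follow from those about heads by the reflection
    that sends [k] to [- k], under which powers change the sign of their
    exponent. *)

Set Implicit Arguments.
Unset Strict Implicit.
Unset Printing Implicit Defensive.

Import Order.TTheory GRing.Theory Num.Theory.
Import numFieldNormedType.Exports.

Local Open Scope classical_set_scope.
Local Open Scope ring_scope.

(** * Blocks of unit measure *)

Section Discretisation.
Context {R : realType}.
Local Notation mu := (@lebesgue_measure R).
Implicit Types (c : int -> \bar R) (k : int).

(** Base [e] is chosen because the blocks then have [dt/t]-measure exactly one,
    like the cells of the half-line under Lebesgue measure. *)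
Definition blk k : set R := [set t | 0 < t /\ Num.floor (ln t) = k].

Definition step c (t : R) : \bar R := c (Num.floor (ln t)).

Definition cell (n : nat) : set R := [set x | 0 < x /\ Num.truncn x = n].

(** The cells are indexed by [nat] and the blocks by [int]: the integer [k] is
    placed on the cell number [pickle k], and the value zero fills the cells that
    carry no integer. *)
Definition spread c (x : R) : \bar R :=
  oapp c 0%E (pickle_inv (Num.truncn x)).

Lemma blkE k : blk k = `[expR k%:~R, expR (k + 1)%:~R[%classic.
Proof.
apply/seteqP; split => t /=; rewrite in_itv/=.
  move=> [t0 <-]; have /andP[] := floor_itv (ln t).
  by rewrite -ler_expR -(@ltr_expR _ (ln t)) lnK// => -> ->.
move=> /andP[kt tk]; have t0 : 0 < t by rewrite (lt_le_trans _ kt)// expR_gt0.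
split => //; apply: floor_def.
by rewrite -ler_expR -(@ltr_expR _ (ln t)) lnK// kt tk.
Qed.

Lemma measurable_blk k : measurable (blk k).
Proof. by rewrite blkE. Qed.

Lemma dtt_blk k : dtt (blk k) = 1%E.
Proof.
rewrite /dtt blkE.
have ab : expR k%:~R < expR (k + 1)%:~R :> R by rewrite ltr_expR ltr_int ltrDl.
have pos (x : R) : expR k%:~R <= x -> 0 < x.
  by apply: lt_le_trans; exact: expR_gt0.
have cts : {within `[expR k%:~R, expR (k + 1)%:~R], continuous (@GRing.inv R)}.
  apply: continuous_in_subspaceT => x; rewrite inE/= in_itv/= => /andP[/pos x0 _].
  by apply: inv_continuous; rewrite gt_eqF.
rewrite integral_itv_bndo_bndc; last first.
  apply/measurable_EFinP.
  apply: (@measurable_funS _ _ _ _ `[expR k%:~R, expR (k + 1)%:~R]) => //.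
    by apply: subset_itvl; rewrite bnd_simp.
  exact: subspace_continuous_measurable_fun.
rewrite (@continuous_FTC2 _ _ (@ln R)) ?expRK//.
- by rewrite -EFinB rmorphD/= addrAC subrr add0r.
- split.
  + move=> x; rewrite in_itv/= => /andP[/ltW/pos x0 _].
    by apply: ex_derive; apply: is_derive1_ln.
  + by apply: cvg_at_right_filter; apply: continuous_ln; exact: expR_gt0.
  + by apply: cvg_at_left_filter; apply: continuous_ln; exact: expR_gt0.
- move=> x; rewrite in_itv/= => /andP[/ltW/pos x0 _].
  by rewrite derive1E; apply: derive_val; apply: is_derive1_ln.
Qed.

Lemma cellE n : cell n = if n is 0%N then `]0, 1[%classic
  else `[n%:R, n.+1%:R[%classic.
Proof.
case: n => [|n]; apply/seteqP; split => x /=; rewrite in_itv/=.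
- by move=> [x0 xn]; have := truncn_itv (ltW x0); rewrite xn x0 => /andP[].
- by move=> /andP[x0 x1]; split => //; apply: truncn_def; rewrite ltW.
- by move=> [x0 <-]; rewrite truncn_itv// ltW.
- move=> /andP[nx xn]; split; first by rewrite (lt_le_trans _ nx).
  by apply: truncn_def; rewrite nx.
Qed.

Lemma measurable_cell n : measurable (cell n).
Proof. by rewrite cellE; case: n. Qed.

Lemma mu_cell n : mu (cell n) = 1%E.
Proof.
rewrite cellE; case: n => [|n]; rewrite lebesgue_measure_itv/= lte_fin.
  by rewrite ltr01 oppr0 adde0.
by rewrite ltr_nat leqnn -EFinB -natrB// subSnn.
Qed.

(** Counting the cells that carry an index from [P] is the same as counting
    [P]: this is where the two enumerations, of the cells by [nat] and of the
    blocks by [int], are matched. *)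
Lemma nneseries_pickle (P : pred int) :
  (\sum_(n <oo) oapp (fun k => if P k then 1 else 0) 0 (pickle_inv n)
    = \esum_(k in [set k | P k]) (1 : \bar R))%E.
Proof.
rewrite nneseries_esumT; last by move=> n; case: pickle_inv => //= k; case: ifP.
rewrite (_ : (fun _ => _) =
    (fun n => if n \in pickle @` [set k | P k] then 1%E else 0%E)).
  by rewrite -esum_mkcond esum_image// => k l _ _ /(pcan_inj pickleK_inv).
apply/funext => n; case E : (pickle_inv n) => [k|] /=.
  have nk : pickle k = n by have := @pickle_invK int n; rewrite E.
  congr (if _ then _ else _); apply/idP/idP => [Pk|].
    by rewrite inE/=; exists k.
  by rewrite inE/= -nk => -[l Pl] /(pcan_inj pickleK_inv) <-.
rewrite ifF//; apply/negbTE/negP; rewrite inE/= => -[l _ ln].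
by move: E; rewrite -ln pickleK_inv.
Qed.

Lemma dtt_bigcup_blk (P : pred int) :
  dtt [set t | 0 < t /\ P (Num.floor (ln t))] =
  (\esum_(k in [set k | P k]) (1 : \bar R))%E.
Proof.
pose F n := oapp (fun k => if P k then blk k else set0) set0 (pickle_inv n).
have mF n : measurable (F n).
  by rewrite /F; case: pickle_inv => //= k; case: ifP => // _; exact: measurable_blk.
have FE : [set t | 0 < t /\ P (Num.floor (ln t))] = \bigcup_n F n.
  apply/seteqP; split => [t /= [t0 Pt]|t [n _]].
    exists (pickle (Num.floor (ln t))); first exact: I.
    by rewrite /F pickleK_inv /= Pt.
  by rewrite /F; case: pickle_inv => //= k; case: ifP => // Pk [t0 tk]; split; rewrite ?tk.
have posF t : (\bigcup_n F n) t -> 0 < t by rewrite -FE => -[].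
rewrite FE /dtt ge0_integral_bigcup//.
- rewrite -nneseries_pickle; apply: eq_eseriesr => n _.
  rewrite /F; case: pickle_inv => [k|] /=; last by rewrite integral_set0.
  by case: ifP => _; [exact: dtt_blk|rewrite integral_set0].
- apply/measurable_EFinP.
  apply: (@measurable_funS _ _ _ _ (`]0, +oo[%classic : set R)) => //.
    by move=> t /posF /=; rewrite in_itv/= andbT.
  apply: open_continuous_measurable_fun; first exact: interval_open.
  move=> x; rewrite inE/= in_itv/= andbT => x0.
  by apply: inv_continuous; rewrite gt_eqF.
- by move=> t /posF t0; rewrite lee_fin invr_ge0 ltW.
- move=> i j _ _ [t []]; rewrite /F.
  case Ei : (pickle_inv i) => [k|] //=; case Ej : (pickle_inv j) => [l|] //=.
  have := @pickle_invK int i; have := @pickle_invK int j; rewrite Ei Ej /= => <- <-.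
  case: ifP => // _ [_ <-]; case: ifP => // _ [_ <-] //.
Qed.

Lemma mu_bigcup_cell (P : pred int) :
  mu [set x | 0 < x /\ oapp P false (pickle_inv (Num.truncn x))] =
  (\esum_(k in [set k | P k]) (1 : \bar R))%E.
Proof.
pose F n := if oapp P false (pickle_inv n) then cell n else set0.
have mF n : measurable (F n).
  by rewrite /F; case: ifP => // _; exact: measurable_cell.
have -> : [set x : R | 0 < x /\ oapp P false (pickle_inv (Num.truncn x))] = \bigcup_n F n.
  apply/seteqP; split => [t /= [t0 Pt]|t [n _]].
    by exists (Num.truncn t) => //; rewrite /F Pt.
  by rewrite /F; case: ifP => // Pn [t0 tn]; split => //; rewrite tn.
rewrite measure_bigcup//; last first.
  move=> i j _ _ [t []]; rewrite /F.
  by case: ifP => // _ [_ <-]; case: ifP => // _ [_ <-].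
  by move=> i _; exact: mF.
rewrite -nneseries_pickle (eq_eseriesl (Q := xpredT)); last first.
  by move=> n; rewrite in_setT.
apply: eq_eseriesr => n _.
rewrite /F; case: pickle_inv => [k|] /=; last by rewrite measure0.
by case: ifP => _; [exact: mu_cell|rewrite measure0].
Qed.

End Discretisation.

(** * Rearrangement invariant norms of sequences *)

Section DiscreteNorm.
Context {R : realType}.
Local Notation mu := (@lebesgue_measure R).
Implicit Types (E : ri_space R) (f g : R -> \bar R) (c d : int -> \bar R).

Lemma halflineE : @halfline R = [set t | 0 < t].
Proof. by apply/seteqP; split => t /=; rewrite /halfline/= in_itv/= andbT. Qed.

(** An integral of a nonnegative function is a supremum over the simple functions
    below it, so that monotonicity holds for arbitrary sets. This is what frees
    the sequel from proving measurability: every function is squeezed between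
    step functions. *)
Lemma le_dtt (A B : set R) : A `<=` B -> B `<=` halfline -> (dtt A <= dtt B)%E.
Proof.
rewrite halflineE => AB B0.
have inv0 (C : set R) : C `<=` B -> forall t, C t -> (0 <= (t^-1)%:E)%E.
  by move=> CB t /CB/B0/= t0; rewrite lee_fin invr_ge0 ltW.
rewrite /dtt !ge0_integralE//; [|exact: inv0|exact: inv0].
apply: le_ereal_sup => _ [h /= hA <-]; exists h => //= t.
apply: (le_trans (hA t)); rewrite !patchE; case: ifPn => tA.
  by rewrite mem_set//; apply: AB; rewrite inE in tA.
by case: ifPn => // tB; rewrite (inv0 B)//; rewrite inE in tB.
Qed.

Lemma rearr_ge0 f t : (0 <= rearr f t)%E.
Proof. by apply: le_ereal_inf_tmp => s []. Qed.

Lemma rearr_nonincr f t u : t <= u -> (rearr f u <= rearr f t)%E.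
Proof.
move=> tu; apply: le_ereal_inf => s [s0 /= ft]; split => //.
by rewrite (le_trans ft)// lee_fin.
Qed.

Lemma nnegmeas_rearr f : nnegmeas (rearr f).
Proof.
split => [|t _]; last exact: rearr_ge0.
apply: (measurability _ (ErealGenOInfty.measurableE R)) => // _ [_ [x ->] <-].
apply: measurableI; first exact: measurable_itv.
apply: is_interval_measurable => t u /= xt xu v.
move=> /andP[_ vu]; move: xt xu; rewrite /= !in_itv/= !andbT => _ xu.
by apply: (lt_le_trans xu); exact: rearr_nonincr.
Qed.

Lemma le_rearr f g t :
  (forall u, 0 < u -> (`|f u| <= `|g u|)%E) -> (rearr f t <= rearr g t)%E.
Proof.
move=> fg; apply: le_ereal_inf => s [s0 gs]; split => //.
apply: le_trans gs; apply: le_dtt; last by move=> u [].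
by move=> u [+ /= su]; rewrite halflineE => u0; split => //=;
  exact: lt_le_trans (fg _ u0).
Qed.

Lemma le_tnorm E f g :
  (forall u, 0 < u -> (`|f u| <= `|g u|)%E) -> (tnorm E f <= tnorm E g)%E.
Proof.
move=> fg; apply: (ri_mono (ri_normP E)); [exact: nnegmeas_rearr..|].
by apply: aeW => t _; exact: le_rearr.
Qed.

Lemma tnorm_ge0 E f : (0 <= tnorm E f)%E.
Proof. by apply: (ri_ge0 (ri_normP E)); exact: nnegmeas_rearr. Qed.

(** By [tnorm_step] this is the [dt/t]-norm of [step c]; the advantage of the
    present form is that it applies the axioms of [E] to a function that depends
    linearly on [c], whereas the rearrangement of [step c] does not. *)
Definition snorm E c : \bar R := E (spread c).

Lemma measurable_spread_preimage c (Y : set (\bar R)) : measurable (halfline `&` spread c @^-1` Y).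
Proof.
have -> : halfline `&` spread c @^-1` Y =
    \bigcup_(n in [set n | Y (oapp c 0%E (pickle_inv n))]) (@cell R n).
  rewrite halflineE; apply/seteqP; split => [x [x0 Yx]|x [n /= Yn [x0 xn]]].
    by exists (Num.truncn x).
  by split => //=; rewrite /spread xn.
by apply: bigcup_measurable => n _; exact: measurable_cell.
Qed.

Lemma nnegmeas_spread c : (forall k, 0 <= c k)%E -> nnegmeas (spread c).
Proof.
move=> c0; split => [mD Y mY|t _]; first exact: measurable_spread_preimage.
by rewrite /spread; case: pickle_inv => //=.
Qed.

Lemma mu_spread_gt c (s : R) : 0 <= s ->
  mu (halfline `&` [set x | s%:E < spread c x]%E) =
  (\esum_(k in [set k | s%:E < c k]%E) (1 : \bar R))%E.
Proof.
move=> s0; rewrite -mu_bigcup_cell halflineE; congr (mu _).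
apply/seteqP; split => x /= [x0 sx]; split => //; move: sx; rewrite /spread.
  by case: pickle_inv => //=; rewrite lte_fin ltNge s0.
by case: pickle_inv.
Qed.

Lemma dtt_step_gt c (s : \bar R) : (forall k, 0 <= c k)%E ->
  dtt (halfline `&` [set x | s < `|step c x|]%E) =
  (\esum_(k in [set k | s < c k]%E) (1 : \bar R))%E.
Proof.
move=> c0; rewrite -dtt_bigcup_blk halflineE; congr dtt.
by apply/seteqP; split => x /= [x0 sx]; split => //; move: sx; rewrite /step gee0_abs.
Qed.

Lemma mu_below (M : \bar R) : (0 <= M)%E ->
  mu (halfline `&` [set t | t%:E < M]%E) = M.
Proof.
rewrite halflineE => /gee0P[->|[r r0 ->]].
  have -> : [set t | 0 < t] `&` [set t : R | t%:E < +oo]%E = `]0, +oo[%classic.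
    by apply/seteqP; split => t /=; rewrite in_itv/= andbT ltry// => -[].
  by rewrite lebesgue_measure_itv/= ltry.
have -> : [set t | 0 < t] `&` [set t : R | t%:E < r%:E]%E = `]0, r[%classic.
  by apply/seteqP; split => t /=; rewrite in_itv/= lte_fin => /andP.
rewrite lebesgue_measure_itv/= lte_fin oppr0 adde0.
by move: r0; rewrite le_eqVlt => /orP[/eqP<-|->//]; rewrite ltxx.
Qed.

Lemma exists_between_seq (s : R) c (X : seq int) :
  (forall k, k \in X -> s%:E < c k)%E ->
  exists2 r : \bar R, (s%:E < r)%E & forall k, k \in X -> (r <= c k)%E.
Proof.
elim: X => [|x X IH] sX; first by exists +oo%E; rewrite ?ltry.
have [|r sr rX] := IH; first by move=> k kX; apply: sX; rewrite inE kX orbT.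
exists (Order.min r (c x)); first by rewrite lt_min sr sX// mem_head.
move=> k; rewrite inE ge_min => /orP[/eqP->|/rX->//]; by rewrite lexx orbT.
Qed.

(** The distribution function of a step function is right continuous because
    any finite part of a superlevel set already lies above a higher level. *)
Lemma rearr_step_gt c (s t : R) : (forall k, 0 <= c k)%E -> 0 <= s -> 0 < t ->
  (s%:E < rearr (step c) t)%E =
  (t%:E < \esum_(k in [set k | s%:E < c k]) 1)%E.
Proof.
move=> c0 s0 t0; apply/idP/idP => [|tN]; last first.
  have [_ [X [finX XS] <-]] := ereal_sup_gt tN.
  rewrite fsbig_finite//= => tX.
  have [r sr rX] : exists2 r : \bar R, (s%:E < r)%E &
      forall k, X k -> (r <= c k)%E.
    have [|r sr rX] := @exists_between_seq s c (finmap.enum_fset (fset_set X)).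
      by move=> k; rewrite in_fset_set// inE => /XS.
    by exists r => // k Xk; apply: rX; rewrite in_fset_set// inE.
  apply: (lt_le_trans sr); apply: le_ereal_inf_tmp => q [q0 qt].
  rewrite leNgt; apply/negP => qr; move: qt; rewrite dtt_step_gt//.
  rewrite leNgt => /negP; apply; apply: (lt_le_trans tX).
  apply: esum_ge; exists X; last by rewrite fsbig_finite.
  by split => // k Xk /=; exact: lt_le_trans qr (rX _ Xk).
apply: contraTT; rewrite -!leNgt => Nt; apply: ereal_inf_lbound; split.
  by rewrite lee_fin.
by rewrite dtt_step_gt.
Qed.

(** Both distribution functions count the indices at which [c] exceeds the
    level. *)
Lemma tnorm_step E c : (forall k, 0 <= c k)%E -> tnorm E (step c) = snorm E c.
Proof.
move=> c0; apply: (ri_rearrangement (ri_normP E)).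
- exact: nnegmeas_rearr.
- exact: nnegmeas_spread.
- move=> s s0; rewrite mu_spread_gt// -[RHS]mu_below; last first.
    by apply: esum_ge0.
  congr (mu _); apply/seteqP; rewrite halflineE; split => t /= [t0];
    by rewrite rearr_step_gt.
Qed.

Lemma snorm_ge0 E c : (forall k, 0 <= c k)%E -> (0 <= snorm E c)%E.
Proof. by move=> c0; apply: (ri_ge0 (ri_normP E)); exact: nnegmeas_spread. Qed.

Lemma le_snorm E c d : (forall k, 0 <= c k)%E -> (forall k, c k <= d k)%E ->
  (snorm E c <= snorm E d)%E.
Proof.
move=> c0 cd; apply: (ri_mono (ri_normP E)); try apply: nnegmeas_spread => //.
  by move=> k; exact: le_trans (cd k).
by apply: aeW => t _; rewrite /spread; case: pickle_inv => //=.
Qed.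

Lemma snormZ E (a : R) c : 0 <= a -> (forall k, 0 <= c k)%E ->
  snorm E (fun k => a%:E * c k)%E = (a%:E * snorm E c)%E.
Proof.
move=> a0 c0; rewrite -(ri_homo (ri_normP E)) //; last exact: nnegmeas_spread.
congr (ri_norm E _); apply/funext => x.
by rewrite /spread; case: pickle_inv => //=; rewrite mule0.
Qed.

Lemma snormD E c d : (forall k, 0 <= c k)%E -> (forall k, 0 <= d k)%E ->
  (snorm E (fun k => c k + d k) <= snorm E c + snorm E d)%E.
Proof.
move=> c0 d0; rewrite (le_trans _ (ri_triangle (ri_normP E) _ _))//;
  [|exact: nnegmeas_spread..].
rewrite le_eqVlt; apply/orP; left; apply/eqP; congr (ri_norm E _).
apply/funext => x.
by rewrite /spread; case: pickle_inv => //=; rewrite adde0.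
Qed.

Lemma snorm0 E : snorm E (fun=> 0%E) = 0%E.
Proof.
have -> : (fun=> 0%E) = (fun _ : int => 0%:E * 0 : \bar R)%E.
  by apply/funext => k; rewrite mule0.
by rewrite snormZ// mul0e.
Qed.

Lemma snorm_sum E (u : nat -> int -> \bar R) N : (forall j k, 0 <= u j k)%E ->
  (snorm E (fun k => \sum_(j < N) u j k) <= \sum_(j < N) snorm E (u j))%E.
Proof.
move=> u0; elim: N => [|N IH].
  by under eq_fun do rewrite big_ord0; rewrite big_ord0 snorm0.
under eq_fun do rewrite big_ord_recr.
rewrite big_ord_recr/= (le_trans (snormD _ _ _))//.
  by move=> k; apply: sume_ge0 => j _.
by rewrite leeD2r.
Qed.

(** The Fatou property upgrades the triangle inequality to countable sums. *)
Lemma snorm_series E (u : nat -> int -> \bar R) : (forall j k, 0 <= u j k)%E ->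
  (snorm E (fun k => \sum_(j <oo) u j k) <= \sum_(j <oo) snorm E (u j))%E.
Proof.
move=> u0.
have sum0 N k : (0 <= \sum_(j < N) u j k)%E by apply: sume_ge0 => j _.
have nnser k : (0 <= \sum_(j <oo) u j k)%E by apply: nneseries_ge0.
have cv : snorm E (fun k => \sum_(j < n) u j k)%E @[n --> \oo] -->
    snorm E (fun k => \sum_(j <oo) u j k)%E.
  apply: (ri_fatou (ri_normP E)) => [n||]; [exact: nnegmeas_spread..|].
  apply: aeW => t _; rewrite /spread; case: pickle_inv => [k|] /=; last first.
    by split; [move=> ? ?|exact: cvg_cst].
  split.
    move=> m n mn; rewrite -(big_mkord xpredT (u ^~ k)) -(big_mkord xpredT (u ^~ k)).
    by apply: lee_sum_nneg_natr.
  have : cvgn (fun n => \sum_(0 <= j < n) u j k)%E by apply: is_cvg_nneseries.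
  by under eq_fun do rewrite big_mkord.
rewrite -(cvg_lim _ cv)//; apply: lime_le; first by apply/cvg_ex; eexists; exact: cv.
apply: nearW => n; apply: (le_trans (snorm_sum _ _ u0)).
rewrite -(big_mkord xpredT (fun j => snorm E (u j))).
by apply: nneseries_lim_ge => j _ _; exact: snorm_ge0.
Qed.

(** Rearrangement invariance: placing values at other indices, without
    repetition, does not increase the norm. *)
Lemma snorm_reindex E c (Z : pred int) (p : int -> int) : (forall k, 0 <= c k)%E ->
  {in Z &, injective p} ->
  (snorm E (fun k => if Z k then c (p k) else 0) <= snorm E c)%E.
Proof.
move=> c0 pinj.
pose Q : pred int := fun m => `[< exists2 k, Z k & p k = m >].
have -> : snorm E (fun k => if Z k then c (p k) else 0%E) =
    snorm E (fun m => if Q m then c m else 0%E).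
  apply: (ri_rearrangement (ri_normP E)).
  - by apply: nnegmeas_spread => k; case: ifP.
  - by apply: nnegmeas_spread => k; case: ifP.
  move=> s s0; rewrite !mu_spread_gt//; try by move=> k; case: ifP.
  apply/esym; apply: (reindex_esum _ _ p (fun=> 1%E)); split.
  - move=> k /=; case: ifP => [Zk sk|_]; last by rewrite lte_fin ltNge s0.
    by rewrite ifT//; apply/asboolP; exists k.
  - move=> k l; rewrite !inE/=; case: ifP => [Zk _|_]; last by rewrite lte_fin ltNge s0.
    by case: ifP => [Zl _|_]; [exact: pinj|rewrite lte_fin ltNge s0].
  - move=> m /=; case: ifP => [/asboolP[k Zk <-] sk|_]; last by rewrite lte_fin ltNge s0.
    by exists k => //=; rewrite Zk.
by apply: le_snorm => k; case: ifP.
Qed.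

(** The value is finite because the cell has finite measure, and positive because
    it is not negligible. *)
Lemma snorm_unit E k : exists2 r : R, 0 < r &
  snorm E (fun i => if i == k then 1%E else 0%E) = r%:E.
Proof.
pose c (i : int) : \bar R := if i == k then 1%E else 0%E.
have c0 i : (0 <= c i)%E by rewrite /c; case: ifP.
have cfin : (snorm E c < +oo)%E.
  have mc := @measurable_cell R (pickle k).
  have cell0 : @cell R (pickle k) `<=` halfline by rewrite halflineE => x [].
  have : (mu (cell (pickle k)) < +oo)%E by rewrite mu_cell ltry.
  move=> /(ri_indic (ri_normP E) mc cell0); apply: le_lt_trans.
  apply: (ri_mono (ri_normP E)); first exact: nnegmeas_spread.
    split; last by move=> t _; rewrite lee_fin.
    apply/measurable_EFinP; apply: measurable_funTS.
    exact: measurable_indic.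
  apply: aeW => t; rewrite halflineE /spread => t0.
  case nt : (pickle_inv (Num.truncn t)) => [i|] /=; last by rewrite lee_fin.
  rewrite /c; case: eqP => // ik; rewrite lee_fin indicE mem_set//.
  by split => //; have := @pickle_invK int (Num.truncn t); rewrite nt ik.
have cn0 : snorm E c <> 0%E.
  move=> /(ri_eq0 (ri_normP E) (nnegmeas_spread c0)) [A [mA A0 cA]].
  have : (mu (cell (pickle k)) <= mu A)%E.
    apply: le_measure; rewrite ?inE//; first exact: measurable_cell.
    move=> x [x0 xk]; apply: cA => /=; rewrite halflineE => /(_ x0).
    rewrite /spread xk pickleK_inv /= /c eqxx => -[] /eqP.
    by rewrite oner_eq0.
  by rewrite A0 mu_cell lee_fin ler10.
exists (fine (snorm E c)); last by rewrite fineK// ge0_fin_numE// snorm_ge0.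
by rewrite fine_gt0// cfin andbT lt_neqAle snorm_ge0// andbT eq_sym; apply/eqP.
Qed.


End DiscreteNorm.

(** * Sequences of power type *)

Section Growth.
Context {R : realType}.
Implicit Types (b : int -> R) (d e r : R) (m n k : int).

(** The values at [e^n] of [t^d] times a slowly varying function: the exponent
    [d] rules the growth up to a factor of arbitrarily small exponential rate. *)
Definition growth d b := (forall n, 0 < b n) /\
  forall e, 0 < e -> exists2 C : R, 0 < C & forall m n,
    b m <= C * expR (d * (m - n)%:~R + e * `|(m - n)%:~R|) * b n.

Lemma growth_expR d : growth d (fun n => expR (d * n%:~R)).
Proof.
split=> [n|e e0]; first exact: expR_gt0.
exists 1 => // m n; rewrite mul1r -expRD ler_expR rmorphB/=.
rewrite mulrBr addrAC subrK lerDl mulr_ge0// ltW//.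
Qed.

Lemma growthM d d' b b' : growth d b -> growth d' b' ->
  growth (d + d') (fun n => b n * b' n).
Proof.
move=> [b0 bg] [b'0 b'g]; split=> [n|e e0]; first exact: mulr_gt0.
have e20 : 0 < e / 2 by rewrite divr_gt0.
have [C C0 bC] := bg _ e20; have [C' C'0 b'C] := b'g _ e20.
exists (C * C') => [|m n]; first exact: mulr_gt0.
have -> : (d + d') * (m - n)%:~R + e * `|(m - n)%:~R| =
  (d * (m - n)%:~R + e / 2 * `|(m - n)%:~R|) +
  (d' * (m - n)%:~R + e / 2 * `|(m - n)%:~R|) by field.
rewrite expRD; apply: (le_trans (ler_pM _ _ (bC m n) (b'C m n))).
- exact: ltW.
- exact: ltW.
- by rewrite le_eqVlt; apply/orP; left; apply/eqP; ring.
Qed.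

Lemma growthV d b : growth d b -> growth (- d) (fun n => (b n)^-1).
Proof.
move=> [b0 bg]; split=> [n|e e0]; first by rewrite invr_gt0.
have [C C0 bC] := bg _ e0; exists C => // m n.
rewrite -[leLHS]mul1r ler_pdivrMr// mulrAC ler_pdivlMr// mul1r.
rewrite (le_trans (bC n m))// -opprB rmorphN/= normrN.
by rewrite mulrN mulNr.
Qed.

Lemma growth_powR d b r : 0 <= r -> growth d b ->
  growth (r * d) (fun n => b n `^ r).
Proof.
move=> r0 [b0 bg]; split=> [n|e e0]; first exact: powR_gt0.
have r1 : 0 < r + 1 by rewrite ltr_wpDl.
have [|C C0 bC] := bg (e / (r + 1)); first exact: divr_gt0.
exists (C `^ r) => [|m n]; first exact: powR_gt0.
have bn0 := ltW (b0 n); have bm0 := ltW (b0 m); have C0' := ltW C0.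
have := bC m n; set x := expR _ => bmn; have x0 : 0 <= x by exact: expR_ge0.
have Cx0 : 0 <= C * x by exact: mulr_ge0.
have : b m `^ r <= (C * x * b n) `^ r.
  by apply: ge0_ler_powR; rewrite ?nnegrE ?mulr_ge0.
move=> /le_trans; apply; rewrite !powRM//.
rewrite ler_wpM2r ?powR_ge0// ler_wpM2l ?powR_ge0//.
rewrite -expRM ler_expR.
have er : e / (r + 1) * r <= e.
  by rewrite mulrAC ler_pdivrMr// ler_pM2l// lerDl.
rewrite mulrDl; apply: lerD; first by rewrite mulrAC (mulrC d).
by rewrite mulrAC ler_wpM2r.
Qed.

Lemma growth_opp d b : growth d b -> growth (- d) (fun n => b (- n)).
Proof.
move=> [b0 bg]; split=> // e e0; have [C C0 bC] := bg e e0.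
exists C => // m n; have := bC (- m) (- n).
by rewrite -opprD rmorphN/= normrN mulrN mulNr.
Qed.

Lemma growth_shift d b k : growth d b ->
  exists2 C : R, 0 < C & forall n, b (n + k) <= C * b n.
Proof.
move=> [b0 bg]; have [C C0 bC] := bg _ ltr01.
exists (C * expR (d * k%:~R + 1 * `|k%:~R|)) => [|n].
  by rewrite mulr_gt0// expR_gt0.
by have := bC (n + k) n; rewrite (addrC n) addrK.
Qed.

(** For a negative exponent half of it absorbs the slowly varying factor. *)
Lemma growth_decay d b : d < 0 -> growth d b ->
  exists q : R, [/\ 0 < q, q < 1 & exists2 C : R, 0 < C &
    forall n (j : nat), b (n + j%:Z) <= C * q ^+ j * b n].
Proof.
move=> d0 [b0 bg]; exists (expR (d / 2)); split; first exact: expR_gt0.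
  by rewrite -[ltRHS]expR0 ltr_expR pmulr_llt0 ?invr_gt0.
have [|C C0 bC] := bg (- d / 2); first by rewrite divr_gt0 ?oppr_gt0.
exists C => // n j; have := bC (n + j%:Z) n; rewrite (addrC n) addrK.
move=> /le_trans; apply; rewrite ler_pM2r// ler_pM2l//.
rewrite -expRM_natl ler_expR ger0_norm ?ler0n//.
rewrite le_eqVlt; apply/orP; left; apply/eqP.
rewrite -[X in X = _]/(d * j%:R + - d / 2 * j%:R).
by field.
Qed.

Lemma growth_decay_opp d b : 0 < d -> growth d b ->
  exists q : R, [/\ 0 < q, q < 1 & exists2 C : R, 0 < C &
    forall n (j : nat), b (n - j%:Z) <= C * q ^+ j * b n].
Proof.
rewrite -oppr_lt0 => d0 /growth_opp/(growth_decay d0)[q [q0 q1 [C C0 bC]]].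
exists q; split => //; exists C => // n j.
by have := bC (- n) j; rewrite opprD !opprK.
Qed.

End Growth.

(** * Translations, reflections and geometric sums *)

Section Derived.
Context {R : realType}.
Implicit Types (E F : ri_space R) (c d : int -> \bar R).

Lemma snorm_single E : exists2 r : R, 0 < r &
  forall (a : R) n, 0 <= a ->
    snorm E (fun k => if k == n then a%:E else 0%E) = (a * r)%:E.
Proof.
have [r r0 Er] := snorm_unit E 0; exists r => // a n a0.
have u0 (m k : int) : (0 <= (if k == m then 1 else 0) :> \bar R)%E.
  by case: ifP.
have -> : (fun k => if k == n then a%:E else 0%E) =
    (fun k => a%:E * (if k == n then 1 else 0))%E.
  by apply/funext => k; case: ifP => _; rewrite ?mule1 ?mule0.
rewrite snormZ// EFinM -Er; congr (_ * _)%E.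
have shift (p q : int) :
    (snorm E (fun k => if k == p then 1 else 0) <=
     snorm E (fun k => if k == q then 1 else 0))%E.
  have := @snorm_reindex R E _ xpredT (fun k => k + (q - p)) (u0 q).
  have inj : {in xpredT &, injective (fun k => k + (q - p))}.
    by move=> k l _ _; exact: addIr.
  move=> /(_ inj).
  have -> : (fun k : int => if xpredT k then
        (if k + (q - p) == q then 1%E else 0%E : \bar R) else 0%E) =
      (fun k => if k == p then 1%E else 0%E).
    apply/funext => k /=; congr (if _ then _ else _).
    have pq : p + (q - p) = q by rewrite addrC subrK.
    by apply/eqP/eqP => [h|->//]; apply: (addIr (q - p)); rewrite h pq.
  by [].
by apply/eqP; rewrite eq_le !shift.
Qed.

Lemma snorm_shift E c (m : int) : (forall k, 0 <= c k)%E ->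
  snorm E (fun k => c (k + m)) = snorm E c.
Proof.
move=> c0.
have le c' (p : int) : (forall k, 0 <= c' k)%E ->
    (snorm E (fun k => c' (k + p)%R) <= snorm E c')%E.
  move=> c'0; have := @snorm_reindex R E c' xpredT (fun k => k + p) c'0.
  by apply => k l _ _; exact: addIr.
apply/eqP; rewrite eq_le le//=.
have := le (fun k => c (k + m)) (- m) (fun k => c0 (k + m)).
by under eq_fun do rewrite subrK.
Qed.

Lemma snorm_opp E c : (forall k, 0 <= c k)%E ->
  snorm E (fun k => c (- k)) = snorm E c.
Proof.
move=> c0.
have le c' : (forall k, 0 <= c' k)%E -> (snorm E (fun k => c' (- k)%R) <= snorm E c')%E.
  move=> c'0; have := @snorm_reindex R E c' xpredT (fun k => - k) c'0.
  by apply => k l _ _; exact: oppr_inj.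
apply/eqP; rewrite eq_le le//=.
have := le (fun k => c (- k)) (fun k => c0 (- k)).
by under eq_fun do rewrite opprK.
Qed.

Lemma le_snormZ E c d (a : R) : 0 <= a ->
  (forall k, 0 <= c k)%E -> (forall k, 0 <= d k)%E ->
  (forall k, c k <= a%:E * d k)%E -> (snorm E c <= a%:E * snorm E d)%E.
Proof. by move=> a0 c0 d0 cd; rewrite -snormZ//; exact: le_snorm. Qed.

Lemma sum_geometric_le (q : R) N : 0 <= q -> q < 1 ->
  \sum_(j < N) q ^+ j <= (1 - q)^-1.
Proof.
move=> q0 q1; have q1' : 0 < 1 - q by rewrite subr_gt0.
rewrite -[leRHS]mul1r ler_pdivlMr// mulrC -[1 - q]opprB mulNr -subrX1 opprB.
by rewrite gerBl exprn_ge0.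
Qed.

(** The form in which all the sums over blocks are estimated: translates of one
    sequence, with geometrically decreasing weights. *)
Lemma snorm_geometric E (u : nat -> int -> \bar R) (q : R) (M : \bar R) :
  0 <= q -> q < 1 -> (forall j k, 0 <= u j k)%E ->
  (forall j, snorm E (u j) <= (q ^+ j)%:E * M)%E ->
  (snorm E (fun k => \sum_(j <oo) u j k) <= ((1 - q)^-1)%:E * M)%E.
Proof.
move=> q0 q1 u0 uM; apply: (le_trans (snorm_series _ u0)).
have M0 : (0 <= M)%E.
  by have := uM 0%N; rewrite expr0 mul1e; apply: le_trans; exact: snorm_ge0.
apply: lime_le; first by apply: is_cvg_nneseries => j _ _; exact: snorm_ge0.
apply: nearW => N; rewrite big_mkord.
apply: (@le_trans _ _ (\sum_(j < N) (q ^+ j)%:E * M)%E).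
  by apply: lee_sum => j _; exact: uM.
rewrite -ge0_sume_distrl; last by move=> j _; rewrite lee_fin exprn_ge0.
by rewrite sumEFin lee_wpmul2r// lee_fin sum_geometric_le.
Qed.

(** Half of a negative exponent makes the tail sum geometric, so that the tail
    norm of a power-like sequence is carried by its first entry. *)
Lemma growth_tail F (d : R) b : d < 0 -> growth d b ->
  exists2 C : R, 0 < C & forall m,
    (snorm F (fun k => if (m <= k)%R then (b k)%:E else 0) <= (C * b m)%:E)%E.
Proof.
move=> d0 gb; have [q [q0 q1 [C C0 bC]]] := growth_decay d0 gb.
have b0 := gb.1; have [r r0 rF] := snorm_single F.
exists ((1 - q)^-1 * (C * r)) => [|m].
  by rewrite !mulr_gt0// invr_gt0 subr_gt0.
pose u (j : nat) (k : int) : \bar R :=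
  if k == m + j%:Z then (C * q ^+ j * b m)%:E else 0%E.
have a0 j : 0 <= C * q ^+ j * b m by rewrite !mulr_ge0 ?exprn_ge0// ltW.
have u0 j k : (0 <= u j k)%E by rewrite /u; case: ifP; rewrite ?lee_fin.
apply: (@le_trans _ _ (snorm F (fun k => \sum_(j <oo) u j k)%E)).
  apply: le_snorm => k; first by case: ifP => // _; rewrite lee_fin ltW.
  case: ifP => [mk|_]; last exact: nneseries_ge0.
  apply: (@le_trans _ _ (u `|k - m|%N k)); last first.
    apply: (@le_trans _ _ (\sum_(0 <= j < `|k - m|.+1) u j k)%E).
      by rewrite big_nat_recr//= leeDr// sume_ge0.
    by apply: nneseries_lim_ge.
  have kE : m + `|k - m|%N%:Z = k by rewrite gez0_abs ?subr_ge0// addrCA subrr addr0.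
  by rewrite /u kE eqxx lee_fin -[in leLHS]kE.
rewrite -!mulrA EFinM; apply: snorm_geometric => // [|j]; first exact: ltW.
rewrite /u rF// -EFinM lee_fin le_eqVlt; apply/orP; left; apply/eqP; ring.
Qed.

Lemma growth_head F (d : R) b : 0 < d -> growth d b ->
  exists2 C : R, 0 < C & forall m,
    (snorm F (fun k => if (k <= m)%R then (b k)%:E else 0) <= (C * b m)%:E)%E.
Proof.
rewrite -oppr_lt0 => d0 gb; have [C C0 bC] := growth_tail F d0 (growth_opp gb).
have b0 := gb.1.
exists C => // m; have := bC (- m); rewrite opprK -snorm_opp; last first.
  by move=> k; case: ifP => // _; rewrite lee_fin ltW.
apply: le_trans; rewrite le_eqVlt; apply/orP; left; apply/eqP; congr snorm.
by apply/funext => k; rewrite lerN2 opprK.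
Qed.

(** A finite norm forces finite entries, since a single infinite entry already
    dominates all the multiples of a unit entry. *)
Lemma snorm_lty E c n : (forall k, 0 <= c k)%E -> (snorm E c < +oo)%E ->
  (c n < +oo)%E.
Proof.
move=> c0 cE; have [r r0 rE] := snorm_single E.
rewrite ltNge leye_eq; apply/negP => /eqP cn.
have : forall a : R, 0 <= a -> ((a * r)%:E <= snorm E c)%E.
  move=> a a0; rewrite -(rE a n a0); apply: le_snorm => k; case: ifP => // /eqP ->.
  by rewrite cn leey.
have sf : snorm E c \is a fin_num by rewrite ge0_fin_numE// snorm_ge0.
set M := fine (snorm E c) => /(_ ((M + 1) / r)).
have M0 : 0 <= M by rewrite fine_ge0// snorm_ge0.
have Mr : 0 <= (M + 1) / r by rewrite divr_ge0 ?addr_ge0// ltW.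
move=> /(_ Mr); rewrite -(fineK sf) divfK ?gt_eqF// lee_fin.
by rewrite leNgt ltrDl ltr01.
Qed.

End Derived.

(** * Mixed norms and their head estimates *)

Section Mixed.
Context {R : realType}.
Implicit Types (E F : ri_space R) (b x s v w : int -> R) (P : pred int)
  (Q : rel int).

Definition restr x P (k : int) : \bar R := if P k then (x k)%:E else 0%E.

(** Discrete form of a norm in [F] of [x], over the region selected by [Q i],
    weighted by [b] and measured in [E]; all the norms of the theorem are of this
    kind, with [Q] an order condition between the outer and the inner index. *)
Definition mix E F b x Q : \bar R :=
  snorm E (fun i => (b i)%:E * snorm F (restr x (Q i)))%E.

Lemma restr_ge0 x P : (forall k, 0 <= x k) -> forall k, (0 <= restr x P k)%E.
Proof. by move=> x0 k; rewrite /restr; case: ifP => // _; rewrite lee_fin. Qed.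

Lemma restr_shift x P (m : int) :
  (fun k => restr x P (k + m)) = restr (fun k => x (k + m)) (fun k => P (k + m)).
Proof. by []. Qed.

Lemma restr_opp x P :
  (fun k => restr x P (- k)) = restr (fun k => x (- k)) (fun k => P (- k)).
Proof. by []. Qed.

Lemma mix_term_ge0 F b x Q : (forall k, 0 <= b k) -> (forall k, 0 <= x k) ->
  forall i, (0 <= (b i)%:E * snorm F (restr x (Q i)))%E.
Proof.
by move=> b0 x0 i; rewrite mule_ge0 ?lee_fin// snorm_ge0//; exact: restr_ge0.
Qed.

Lemma mix_ge0 E F b x Q : (forall k, 0 <= b k) -> (forall k, 0 <= x k) ->
  (0 <= mix E F b x Q)%E.
Proof. by move=> b0 x0; apply: snorm_ge0; exact: mix_term_ge0. Qed.

Lemma le_restr x x' P P' (C : R) : 0 <= C -> (forall k, 0 <= x k) ->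
  (forall k, 0 <= x' k) -> (forall k, P k -> P' k /\ x k <= C * x' k) ->
  forall k, (restr x P k <= C%:E * restr x' P' k)%E.
Proof.
move=> C0 x0 x'0 PP k; rewrite /restr; case: ifP => [/PP[-> xC]|_].
  by rewrite -EFinM lee_fin.
by apply: mule_ge0; rewrite ?lee_fin//; case: ifP => // _; rewrite lee_fin.
Qed.

Lemma le_mix E F b x x' Q Q' (C : R) : 0 <= C -> (forall k, 0 <= b k) ->
  (forall k, 0 <= x k) -> (forall k, 0 <= x' k) ->
  (forall i k, Q i k -> Q' i k /\ x k <= C * x' k) ->
  (mix E F b x Q <= C%:E * mix E F b x' Q')%E.
Proof.
move=> C0 b0 x0 x'0 QQ; apply: le_snormZ => //; [exact: mix_term_ge0..|].
move=> i; rewrite muleCA lee_wpmul2l ?lee_fin//.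
by apply: le_snormZ => //; [exact: restr_ge0..|apply: le_restr => // k; exact: QQ].
Qed.

Lemma mixD E F b x x1 x2 Q : (forall k, 0 <= b k) -> (forall k, 0 <= x k) ->
  (forall k, 0 <= x1 k) -> (forall k, 0 <= x2 k) ->
  (forall k, x k <= x1 k + x2 k) ->
  (mix E F b x Q <= mix E F b x1 Q + mix E F b x2 Q)%E.
Proof.
move=> b0 x0 x10 x20 xx.
rewrite (le_trans _ (snormD _ _ _))//; [|exact: mix_term_ge0..].
apply: le_snorm => i; first exact: mix_term_ge0.
rewrite -ge0_muleDr; [|by apply: snorm_ge0; exact: restr_ge0..].
rewrite lee_wpmul2l ?lee_fin// (le_trans _ (snormD _ _ _))//; [|exact: restr_ge0..].
apply: le_snorm => k; first exact: restr_ge0.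
by rewrite /restr; case: ifP => // _; rewrite ?adde0// -EFinD lee_fin.
Qed.

Lemma mix_shift E F b x Q (m : int) : (forall k, 0 <= b k) -> (forall k, 0 <= x k) ->
  mix E F b x Q = mix E F (fun k => b (k + m)) (fun k => x (k + m))
    (fun i k => Q (i + m) (k + m)).
Proof.
move=> b0 x0; rewrite {1}/mix -(snorm_shift E m); last exact: mix_term_ge0.
congr snorm; apply/funext => i; congr (_ * _)%E.
by rewrite -(snorm_shift F m) ?restr_shift//; exact: restr_ge0.
Qed.

Lemma mix_opp E F b x Q : (forall k, 0 <= b k) -> (forall k, 0 <= x k) ->
  mix E F b x Q = mix E F (fun k => b (- k)) (fun k => x (- k))
    (fun i k => Q (- i) (- k)).
Proof.
move=> b0 x0; rewrite {1}/mix -snorm_opp; last exact: mix_term_ge0.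
congr snorm; apply/funext => i; congr (_ * _)%E.
by rewrite -snorm_opp ?restr_opp//; exact: restr_ge0.
Qed.

(** The norm of [b] over the indices below [n] is required to be finite, which is
    the reason for naming its value instead of using [fine]. *)
Definition head_norm E b s :=
  forall n, snorm E (restr b (fun i => i < n)) = (s n)%:E.

Section Head.
Variables (E F : ri_space R) (b s : int -> R).
Hypotheses (gb : growth 0 b) (hs : head_norm E b s).

Let b0 k : 0 <= b k. Proof. exact/ltW/gb.1. Qed.

Lemma head_norm_gt0 n : 0 < s n.
Proof.
have [r r0 rE] := snorm_single E.
have := rE (b (n - 1)) (n - 1) (b0 _) => H.
have : ((b (n - 1) * r)%:E <= (s n)%:E)%E.
  rewrite -hs -(rE _ (n - 1))//; apply: le_snorm => k.
    by case: ifP; rewrite ?lee_fin.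
  rewrite /restr; case: eqP => [->|_]; first by rewrite gtrBl ltr01.
  by case: ifP; rewrite ?lee_fin.
by rewrite lee_fin; apply: lt_le_trans; rewrite mulr_gt0// gb.1.
Qed.

(** A translation of [b] costs a factor of small exponential rate, and the norm is
    invariant under translations. *)
Lemma growth_head_norm : growth 0 s.
Proof.
split=> [n|e e0]; first exact: head_norm_gt0.
have [C C0 bC] := gb.2 e e0; exists C => // m n; rewrite -lee_fin -hs.
rewrite -(snorm_shift E (m - n)) ?restr_shift; last exact: restr_ge0.
rewrite EFinM -hs; apply: le_snormZ; [|by apply: restr_ge0..|].
  by rewrite mulr_ge0 ?expR_ge0// ltW.
apply: le_restr => //; first by rewrite mulr_ge0 ?expR_ge0// ltW.
move=> k km; split; last by have := bC (k + (m - n)) k; rewrite (addrC k) addrK.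
by move: km; rewrite addrCA gtrDl subr_lt0.
Qed.

(** Keeping one inner entry [m] leaves the outer norm of [b] over all [i] below
    [n]. *)
Lemma mix_entry : exists2 C : R, 0 < C & forall x Q m n, (forall k, 0 <= x k) ->
  (forall i, i < n -> Q i m) -> ((x m * s n)%:E <= C%:E * mix E F b x Q)%E.
Proof.
have [r r0 rF] := snorm_single F; exists r^-1 => [|x Q m n x0 Qm].
  by rewrite invr_gt0.
rewrite -lee_pdivrMl ?invr_gt0// invrK -EFinM mulrA EFinM -hs -snormZ; last 2 first.
- by rewrite mulr_ge0// ltW.
- exact: restr_ge0.
apply: le_snorm => i.
  by rewrite mule_ge0 ?lee_fin ?mulr_ge0 ?(ltW r0)//; exact: restr_ge0.
rewrite [leLHS]muleC /restr; case: ifP => [im|_]; last by rewrite mul0e; exact: mix_term_ge0.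
rewrite lee_wpmul2l ?lee_fin// mulrC -(rF _ m)//; apply: le_snorm => k.
  by case: ifP; rewrite ?lee_fin.
case: eqP => [->|_]; first by rewrite Qm.
by case: ifP; rewrite ?lee_fin.
Qed.

(** Splitting at [n] a mixed norm whose tail is a decreasing power. The inner tail
    from [max i n] on is carried by its first entry; in the outer norm this gives
    the value at [n] times the norm of [b] for [i < n], and again a decreasing
    power, carried by its value at [n], for [n <= i]. *)
Lemma mix_split (d : R) w : d < 0 -> growth d w ->
  exists2 C : R, 0 < C & forall x x' (D K : R) n,
  (forall k, 0 <= x k) -> (forall k, 0 <= x' k) -> 0 <= D -> 0 <= K ->
  (forall k, k < n -> x' k <= D * x k) ->
  (forall k, n <= k -> x' k <= D * K * w k) ->
  (mix E F b x' (fun i k => i <= k)%R <=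
    (C * D)%:E * (mix E F b x (fun i k => (i <= k) && (k < n))%R + (w n * s n * K)%:E))%E.
Proof.
move=> d0 gw; have w0 k : 0 <= w k by exact/ltW/gw.1.
have [Cw Cw0 wC] := growth_tail F d0 gw.
have gwb : growth d (fun k => w k * b k) by rewrite -[d]addr0; exact: growthM.
have [Cb Cb0 bC] := growth_tail E d0 gwb.
have [Cs Cs0 bs] : exists2 C : R, 0 < C & forall n, b n <= C * s n.
  have [C C0 bC1] := growth_shift 1 gb; have [r r0 rE] := snorm_single E.
  exists (C / r) => [|n]; first by rewrite divr_gt0.
  have := bC1 (n - 1); rewrite subrK => /le_trans; apply.
  rewrite -mulrA ler_pM2l// mulrC ler_pdivlMr// -lee_fin -hs -(rE _ (n - 1))//.
  apply: le_snorm => k; first by case: ifP; rewrite ?lee_fin.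
  rewrite /restr; case: eqP => [->|_]; first by rewrite gtrBl ltr01.
  by case: ifP; rewrite ?lee_fin.
have s0 n : 0 <= s n by exact/ltW/head_norm_gt0.
pose C1 := Cw * (1 + Cb * Cs).
have C10 : 0 < C1 by rewrite mulr_gt0// ltr_wpDr// mulr_ge0// ltW.
exists (1 + C1) => [|x x' D K n x0 x'0 D0 K0 xx xw]; first by rewrite addr_gt0.
set hd := mix E F b x _.
have hd0 : (0 <= hd)%E by exact: mix_ge0.
pose tl (i : int) : \bar R := ((Cw * (D * K))%:E *
  (restr (fun i => w n * b i)%R (fun i => i < n)%R i +
   restr (fun k => w k * b k)%R (fun i => n <= i)%R i))%E.
have wb0 k l : 0 <= w k * b l by exact: mulr_ge0.
have tl0 i : (0 <= tl i)%E.
  apply: mule_ge0; first by rewrite lee_fin !mulr_ge0// ltW.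
  by apply: adde_ge0; apply: restr_ge0.
have tlE : (snorm E tl <= (C1 * D * (w n * s n * K))%:E)%E.
  have Cn0 : 0 <= Cw * (D * K) by rewrite !mulr_ge0// ltW.
  rewrite snormZ//; last by move=> k; apply: adde_ge0; exact: restr_ge0.
  apply: (@le_trans _ _ ((Cw * (D * K))%:E * ((w n)%:E * (s n)%:E + (Cb * (w n * b n))%:E))%E).
    rewrite lee_wpmul2l ?lee_fin// (le_trans (snormD _ _ _))//; [exact: restr_ge0..|].
    apply: leeD; last exact: bC.
    rewrite -hs -snormZ//; last exact: restr_ge0.
    apply: le_snorm => k; first exact: restr_ge0.
    by rewrite /restr; case: ifP; rewrite ?mule0// EFinM.
  rewrite -(EFinM (w n)) -EFinD -EFinM lee_fin.
  have -> : C1 * D * (w n * s n * K) = Cw * (D * K) * (w n * s n + Cb * (w n * (Cs * s n))).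
    by rewrite /C1; ring.
  by rewrite ler_wpM2l// lerD2l ler_pM2l// ler_wpM2l.
have step i : ((b i)%:E * snorm F (restr x' (fun k => i <= k)%R) <=
    D%:E * ((b i)%:E * snorm F (restr x (fun k => (i <= k) && (k < n))%R)) + tl i)%E.
  have tliE : tl i = (b i * (D * K * (Cw * w (Order.max i n))))%:E.
    by rewrite /tl /restr; case: (leP n i) => ni; rewrite ?adde0 ?add0e -EFinM;
      congr (_%:E); ring.
  have iD : (snorm F (restr x' (fun k => i <= k)%R) <=
      D%:E * snorm F (restr x (fun k => (i <= k) && (k < n))%R) +
      (D * K * (Cw * w (Order.max i n)))%:E)%E.
    have DK0 : 0 <= D * K by exact: mulr_ge0.
    apply: (@le_trans _ _ (snorm F (fun k =>
        D%:E * restr x (fun k => (i <= k) && (k < n))%R k +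
        (D * K)%:E * restr w (fun k => Order.max i n <= k)%R k)%E)).
      apply: le_snorm => k; first exact: restr_ge0.
      rewrite /restr ge_max; case: (leP i k) => ik /=; last by rewrite !mule0 adde0.
      by case: (ltP k n) => kn; rewrite ?mule0 ?adde0 ?add0e -EFinM lee_fin;
        [exact: xx|exact: xw].
    rewrite (le_trans (snormD _ _ _))//; try by move=> k;
      apply: mule_ge0; rewrite ?lee_fin//; exact: restr_ge0.
    rewrite !snormZ//; try exact: restr_ge0.
    by rewrite leeD2l// (EFinM (D * K)) lee_wpmul2l ?lee_fin//; exact: wC.
  rewrite tliE muleCA EFinM -ge0_muleDr ?lee_wpmul2l ?lee_fin//.
    by apply: mule_ge0; rewrite ?lee_fin// snorm_ge0//; exact: restr_ge0.
  by rewrite !mulr_ge0// ltW.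
apply: (@le_trans _ _ (D%:E * hd + snorm E tl)%E).
  rewrite -snormZ//; last exact: mix_term_ge0.
  have Dx0 i : (0 <= D%:E * ((b i)%:E *
      snorm F (restr x (fun k => (i <= k) && (k < n))%R)))%E.
    by rewrite mule_ge0 ?lee_fin//; apply: (mix_term_ge0 F (fun i k => (i <= k) && (k < n))%R).
  apply: le_trans (snormD _ Dx0 tl0).
  by apply: le_snorm => i; [exact: mix_term_ge0|exact: step].
have wsK : (0 <= (w n * s n * K)%:E)%E by rewrite lee_fin !mulr_ge0.
rewrite ge0_muleDr//; apply: leeD.
  by rewrite lee_wpmul2r// lee_fin ler_peMl// lerDl ltW.
apply: (le_trans tlE); rewrite -EFinM lee_fin.
have wsK' : 0 <= w n * s n * K by rewrite !mulr_ge0.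
by apply: ler_wpM2r => //; apply: ler_wpM2r => //; rewrite lerDr.
Qed.

(** The inner norm of an increasing power is carried by its top entry, whatever
    the outer index is. *)
Lemma mix_cross (d : R) v : 0 < d -> growth d v ->
  exists2 C : R, 0 < C & forall x (M : R) n,
  (forall k, 0 <= x k) -> 0 <= M -> (forall k, k < n -> x k <= M * v k) ->
  (mix E F b x (fun i k => (i <= k) && (k < n))%R <= (C * M * (v n * s n))%:E)%E.
Proof.
move=> d0 gv; have v0 k : 0 <= v k by exact/ltW/gv.1.
have [C C0 vC] := growth_head F d0 gv; exists C => // x M n x0 M0 xv.
rewrite mulrA EFinM -hs.
have CMv : 0 <= C * M * v n by rewrite !mulr_ge0// ltW.
apply: le_snormZ => //; [exact: mix_term_ge0|exact: restr_ge0|move=> i].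
rewrite {2}/restr; case: ltP => ni; last first.
  rewrite mule0 (_ : restr _ _ = fun=> 0%E) ?snorm0 ?mule0//.
  apply/funext => k; rewrite /restr ifF//; apply/negbTE/negP => /andP[ik].
  by rewrite ltNge (le_trans ni ik).
rewrite muleC lee_wpmul2r ?lee_fin// (mulrC C) -mulrA EFinM.
apply: (@le_trans _ _ (M%:E * snorm F (restr v (fun k => k <= n)%R))%E).
  apply: le_snormZ => //; [exact: restr_ge0..|apply: le_restr => // k /andP[_ kn]].
  by split; [exact: ltW|exact: xv].
by rewrite lee_wpmul2l ?lee_fin//; exact: vC.
Qed.

(** Countable subadditivity in the inner norm: the entry [x (n - 1 - j)] is seen by
    the outer indices up to [n - 1 - j], that is, with the weight [s (n - j)]. *)
Lemma mix_series : exists2 C : R, 0 < C & forall x n, (forall k, 0 <= x k) ->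
  (mix E F b x (fun i k => (i <= k) && (k < n))%R <=
    C%:E * \sum_(j <oo) (x (n - 1 - j%:Z) * s (n - j%:Z))%:E)%E.
Proof.
have [r r0 rF] := snorm_single F; exists r => // x n x0.
have s0 m : 0 <= s m by exact/ltW/head_norm_gt0.
pose u (j : nat) (k : int) : \bar R :=
  if k == n - 1 - j%:Z then (x (n - 1 - j%:Z))%:E else 0%E.
have u0 j k : (0 <= u j k)%E by rewrite /u; case: ifP => _; rewrite ?lee_fin.
pose U (j : nat) (i : int) : \bar R :=
  ((r * x (n - 1 - j%:Z))%:E * restr b (fun i => i < n - j%:Z)%R i)%E.
have U0 j i : (0 <= U j i)%E.
  by rewrite /U mule_ge0 ?lee_fin ?mulr_ge0 ?(ltW r0)//; exact: restr_ge0.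
rewrite -nneseriesZl; last by move=> j _; rewrite lee_fin mulr_ge0.
apply: (@le_trans _ _ (\sum_(j <oo) snorm E (U j))%E); last first.
  apply: lee_nneseries => [j _ _|j _]; first exact: snorm_ge0.
  rewrite /U snormZ ?mulr_ge0 ?(ltW r0)//; last exact: restr_ge0.
  by rewrite hs -!EFinM lee_fin mulrA.
apply: (le_trans _ (snorm_series _ U0)); apply: le_snorm; first exact: mix_term_ge0.
move=> i.
pose u' (j : nat) (k : int) : \bar R := if i <= n - 1 - j%:Z then u j k else 0%E.
have u'0 j k : (0 <= u' j k)%E by rewrite /u'; case: ifP.
have cutu : (snorm F (restr x (fun k => (i <= k) && (k < n))%R) <=
    \sum_(j <oo) snorm F (u' j))%E.
  apply: le_trans (snorm_series _ u'0).
  apply: le_snorm => k; first exact: restr_ge0.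
  rewrite /restr; case: ifP => [/andP[ik kn]|_]; last first.
    exact: nneseries_ge0.
  set g := fun j : nat => u' j k; have g0 j : (0 <= g j)%E by exact: u'0.
  have kE : k = n - 1 - `|(n - 1 - k)%R|%N%:Z.
    by rewrite gez0_abs ?subKr// subr_ge0 -ltzD1 subrK.
  apply: (@le_trans _ _ (g `|(n - 1 - k)%R|%N)).
    by rewrite /g /u' -kE ik /u -kE eqxx.
  apply: (@le_trans _ _ (\sum_(0 <= j < `|(n - 1 - k)%R|.+1) g j)%E).
    by rewrite big_nat_recr//= leeDr// sume_ge0.
  by apply: nneseries_lim_ge.
apply: (@le_trans _ _ ((b i)%:E * \sum_(j <oo) snorm F (u' j)))%E.
  by rewrite lee_wpmul2l ?lee_fin.
have n0 j : (0 <= snorm F (u' j))%E by apply: snorm_ge0.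
rewrite -nneseriesZl//; apply: lee_nneseries => [j _ _|j _].
  by rewrite mule_ge0 ?lee_fin.
rewrite /U /u' /restr; have -> : (i < n - j%:Z) = (i <= n - 1 - j%:Z).
  by rewrite addrAC -ltzD1 subrK.
case: ifP => _; last by rewrite snorm0 !mule0.
by rewrite rF// -!EFinM lee_fin mulrC (mulrC r).
Qed.

(** Both indices are translated by one. *)
Lemma mix_quasi_const : exists2 C : R, 0 < C & forall x (D : R) n,
  (forall k, 0 <= x k) -> 0 <= D -> (forall k, x (k + 1) <= D * x k) ->
  (mix E F b x (fun i k => (i <= k) && (k < n + 1))%R <=
   (C * D)%:E * mix E F b x (fun i k => (i <= k) && (k < n))%R)%E.
Proof.
have [C C0 bC] := growth_shift 1 gb; exists C => // x D n x0 D0 xD.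
rewrite (@mix_shift E F b x _ 1)//; apply: le_snormZ.
- by rewrite mulr_ge0// ltW.
- by apply: (mix_term_ge0 F (fun i k => (i + 1 <= k + 1) && (k + 1 < n + 1))%R) => k.
- exact: mix_term_ge0.
move=> i.
have -> : (fun k => (i + 1 <= k + 1) && (k + 1 < n + 1)) =
    (fun k => (i <= k) && (k < n)).
  by apply/funext => k; rewrite lerD2r ltrD2r.
rewrite EFinM muleACA -EFinM; apply: lee_pmul; rewrite ?lee_fin//.
  by apply: snorm_ge0; apply: restr_ge0.
by apply: le_snormZ => //; [apply: restr_ge0..|apply: le_restr].
Qed.

End Head.
End Mixed.

(** * Tail estimates, by reflection *)

Section Tail.
Context {R : realType}.
Implicit Types (x s v w : int -> R) (Q : rel int).

Definition tail_norm (E : ri_space R) (b s : int -> R) :=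
  forall n, snorm E (restr b (fun i => n < i)) = (s n)%:E.

(** Under [k |-> - k] a power of exponent [d] becomes one of exponent [- d], heads
    become tails, and the estimates of the previous part can be reused. *)
Lemma tail_norm_opp E b s : (forall k, 0 <= b k) ->
  tail_norm E b s -> head_norm E (fun k => b (- k)) (fun k => s (- k)).
Proof.
move=> b0 hs n; rewrite -hs -[RHS]snorm_opp; last exact: restr_ge0.
by congr snorm; apply/funext => k; rewrite /restr ltrN2.
Qed.

Variables (E F : ri_space R) (b s : int -> R).
Hypotheses (gb : growth 0 b) (hs : tail_norm E b s).

Let b0 k : 0 <= b k. Proof. exact/ltW/gb.1. Qed.
Let gb' : growth 0 (fun k => b (- k)).
Proof. by rewrite -[X in growth X _]oppr0; exact: growth_opp. Qed.
Let hs' : head_norm E (fun k => b (- k)) (fun k => s (- k)).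
Proof. exact: tail_norm_opp. Qed.

Let mixE x : (forall k, 0 <= x k) -> mix E F b x (fun i k => k <= i)%R =
  mix E F (fun k => b (- k)) (fun k => x (- k)) (fun i k => i <= k)%R.
Proof.
move=> x0; rewrite mix_opp//; congr mix.
by apply/funext => i; apply/funext => k; rewrite lerN2.
Qed.

Let mixcE x n : (forall k, 0 <= x k) ->
  mix E F b x (fun i k => (n < k) && (k <= i))%R =
  mix E F (fun k => b (- k)) (fun k => x (- k)) (fun i k => (i <= k) && (k < - n))%R.
Proof.
move=> x0; rewrite mix_opp//; congr mix.
by apply/funext => i; apply/funext => k; rewrite lerN2 andbC ltrNr.
Qed.

Lemma tail_norm_gt0 n : 0 < s n.
Proof. by have := head_norm_gt0 gb' hs' (- n); rewrite opprK. Qed.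

Lemma growth_tail_norm : growth 0 s.
Proof.
have /growth_opp := growth_head_norm gb' hs'; rewrite oppr0.
by under eq_fun do rewrite opprK.
Qed.

Lemma mix_tail_entry : exists2 C : R, 0 < C & forall x Q m n,
  (forall k, 0 <= x k) -> (forall i, n < i -> Q i m) ->
  ((x m * s n)%:E <= C%:E * mix E F b x Q)%E.
Proof.
have [C C0 H] := mix_entry F gb' hs'; exists C => // x Q m n x0 Qm.
have := H (fun k => x (- k)) (fun i k => Q (- i) (- k)) (- m) (- n).
rewrite !opprK -mix_opp//; apply => // i; rewrite ltrNr => ni.
exact: Qm.
Qed.

Lemma mix_tail_split (d : R) w : 0 < d -> growth d w ->
  exists2 C : R, 0 < C & forall x x' (D K : R) n,
  (forall k, 0 <= x k) -> (forall k, 0 <= x' k) -> 0 <= D -> 0 <= K ->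
  (forall k, n < k -> x' k <= D * x k) ->
  (forall k, k <= n -> x' k <= D * K * w k) ->
  (mix E F b x' (fun i k => k <= i)%R <=
    (C * D)%:E * (mix E F b x (fun i k => (n < k) && (k <= i))%R +
                  (w n * s n * K)%:E))%E.
Proof.
rewrite -oppr_lt0 => d0 /growth_opp gw.
have [C C0 H] := mix_split F gb' hs' d0 gw; exists C => // x x' D K n.
move=> x0 x'0 D0 K0 xx xw; rewrite mixE// mixcE//.
have := H (fun k => x (- k)) (fun k => x' (- k)) D K (- n).
rewrite !opprK; apply => // k kn; first by apply: xx; rewrite ltrNr.
by apply: xw; rewrite lerNl.
Qed.

Lemma mix_tail_cross (d : R) v : d < 0 -> growth d v ->
  exists2 C : R, 0 < C & forall x (M : R) n,
  (forall k, 0 <= x k) -> 0 <= M -> (forall k, n < k -> x k <= M * v k) ->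
  (mix E F b x (fun i k => (n < k) && (k <= i))%R <= (C * M * (v n * s n))%:E)%E.
Proof.
rewrite -oppr_gt0 => d0 /growth_opp gv.
have [C C0 H] := mix_cross F gb' hs' d0 gv; exists C => // x M n x0 M0 xv.
rewrite mixcE//; have := H (fun k => x (- k)) M (- n); rewrite !opprK.
by apply => // k kn; apply: xv; rewrite ltrNr.
Qed.

Lemma mix_tail_series : exists2 C : R, 0 < C & forall x n, (forall k, 0 <= x k) ->
  (mix E F b x (fun i k => (n < k) && (k <= i))%R <=
    C%:E * \sum_(j <oo) (x (n + 1 + j%:Z)%R * s (n + j%:Z)%R)%:E)%E.
Proof.
have [C C0 H] := mix_series F gb' hs'; exists C => // x n x0.
rewrite mixcE//; have := H (fun k => x (- k)) (- n) (fun k => x0 (- k)).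
move=> /le_trans; apply; rewrite le_eqVlt; apply/orP; left; apply/eqP.
congr (_ * _)%E; apply: eq_eseriesr => j _.
have -> : - (- n - 1 - j%:Z) = n + 1 + j%:Z by ring.
by have -> : - (- n - j%:Z) = n + j%:Z by ring.
Qed.

Lemma mix_tail_quasi_const : exists2 C : R, 0 < C & forall x (D : R) n,
  (forall k, 0 <= x k) -> 0 <= D -> (forall k, x (k - 1) <= D * x k) ->
  (mix E F b x (fun i k => (n - 1 < k) && (k <= i))%R <=
   (C * D)%:E * mix E F b x (fun i k => (n < k) && (k <= i))%R)%E.
Proof.
have [C C0 H] := mix_quasi_const E F gb'; exists C => // x D n x0 D0 xD.
rewrite !mixcE// opprB addrC; have := H (fun k => x (- k)) D (- n).
by apply => // k; rewrite opprD.
Qed.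

End Tail.

(** * Change of variables *)

Section Transfer.
Context {R : realType}.
Implicit Types (E : ri_space R) (c : int -> \bar R) (p : int -> int).

(** On each residue class modulo [M + 1] the map [p] is injective, so that the
    reindexed norm of that part is at most the full norm. *)
Lemma snorm_comp E c p (M : nat) : (forall k, 0 <= c k)%E ->
  (forall k l, p k = p l -> (`|k - l| <= M)%N) ->
  (snorm E (fun k => c (p k)) <= (M.+1%:R)%:E * snorm E c)%E.
Proof.
move=> c0 pM.
pose u (r : nat) (k : int) : \bar R := if (k %% M.+1)%Z == r then c (p k) else 0%E.
have u0 r k : (0 <= u r k)%E by rewrite /u; case: ifP.
have -> : (fun k => c (p k)) = (fun k => \sum_(r < M.+1) u r k)%E.
  apply/funext => k.
  have kM0 : (0 <= k %% M.+1)%Z by rewrite modz_ge0.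
  have kM : (`|k %% M.+1|%Z < M.+1)%N.
    by rewrite -ltz_nat gez0_abs// ltz_pmod.
  rewrite (bigD1 (Ordinal kM))//= {1}/u gez0_abs// eqxx big1 ?adde0// => i ik.
  rewrite /u ifF//; apply/negbTE/negP => /eqP ki; move/negP: ik; apply.
  by apply/eqP/val_inj; rewrite /= ki.
apply: (le_trans (snorm_sum _ _ u0)).
apply: (@le_trans _ _ (\sum_(r < M.+1) snorm E c)%E).
  apply: lee_sum => r _.
  apply: (@snorm_reindex R E c (fun k => (k %% M.+1)%Z == r) p) => // k l.
  move=> /eqP kr /eqP lr /pM klM; apply/eqP; rewrite -subr_eq0.
  have /eqP : (k %% M.+1)%Z = (l %% M.+1)%Z by rewrite kr lr.
  rewrite eqz_mod_dvd => /dvdzP [z ze]; rewrite ze.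
  have [->|z0] := eqVneq z 0; first by rewrite mul0r.
  by move: klM; rewrite ze abszM absz_nat leqNgt leq_pmull// absz_gt0.
under eq_bigr do rewrite -[snorm E c]mul1e.
by rewrite -ge0_sume_distrl// sumEFin sumr_const card_ord.
Qed.

(** A map that comes within [A] of every integer has a coarse right inverse [g],
    whose fibres have diameter at most [2 A]; [snorm_comp] applies to [g]. *)
Lemma snorm_le_comp E c p (A : nat) (D : R) : (forall k, 0 <= c k)%E -> 0 <= D ->
  (forall k l, (`|k - l| <= A)%N -> c k <= D%:E * c l)%E ->
  (forall m, exists n, (`|p n - m| <= A)%N) ->
  (snorm E c <= (D * (A + A).+1%:R)%:E * snorm E (fun k => c (p k)))%E.
Proof.
move=> c0 D0 cD psurj.
pose g m := projT1 (cid (psurj m)).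
have gP m : (`|p (g m) - m| <= A)%N by rewrite /g; case: cid.
rewrite EFinM -muleA.
apply: (@le_trans _ _ (D%:E * snorm E (fun k => c (p (g k))))%E).
  by apply: le_snormZ => // k; apply: cD; rewrite distnC.
rewrite lee_wpmul2l ?lee_fin//.
apply: (@snorm_comp E (fun k => c (p k)) g) => // k l gkl.
have := gP k; have := gP l; rewrite gkl => h1 h2.
have -> : k - l = (p (g l) - l) - (p (g l) - k) by ring.
by have := gP k; lia.
Qed.

(** A discrete intermediate value theorem. *)
Lemma coarse_surj p (A : nat) : (forall n, p (n + 1) <= p n + A%:Z) ->
  (forall m, exists n, p n <= m) -> (forall m, exists N, forall n, N <= n -> m < p n) ->
  forall m, exists n, (`|p n - m| <= A)%N.
Proof.
move=> pA plow phigh m; have [n0 n0m] := plow m.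
have [N NP] := phigh m.
have ex : exists j : nat, m < p (n0 + j%:Z).
  by exists `|(N - n0)%R|%N; apply: NP; lia.
have := ex_minnP ex; case=> -[|j] mj jmin; first by move: mj; rewrite addr0 ltNge n0m.
exists (n0 + j%:Z); have pj : p (n0 + j%:Z) <= m.
  by rewrite leNgt; apply/negP => /jmin; rewrite ltnn.
have := pA (n0 + j%:Z); move: mj.
have -> : n0 + j.+1%:Z = n0 + j%:Z + 1 by lia.
move: pj; move: (p (n0 + j%:Z)) (p (n0 + j%:Z + 1)) => x y; lia.
Qed.

End Transfer.

Section GrowthLog.
Context {R : realType}.

Lemma growth_ln (d e : R) b : 0 < e -> growth d b ->
  exists2 C : R, 0 <= C & forall m n,
    ln (b m) <= C + (d * (m - n)%:~R + e * `|(m - n)%:~R|) + ln (b n).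
Proof.
move=> e0 [b0 bg]; have [C C0 bC] := bg e e0.
exists `|ln C| => // m n.
apply: (@le_trans _ _ (ln C + (d * (m - n)%:~R + e * `|(m - n)%:~R|) + ln (b n))).
  rewrite -{1}[X in _ + X + _]expRK -lnM ?posrE ?expR_gt0// -lnM ?posrE ?mulr_gt0 ?expR_gt0//.
  by rewrite ler_ln ?posrE ?mulr_gt0 ?expR_gt0.
by rewrite !lerD2r ler_norm.
Qed.

(** The block that contains the value [r n]. *)
Definition level (r : int -> R) (n : int) : int := Num.floor (ln (r n)).

Variables (d : R) (r : int -> R).
Hypotheses (d0 : 0 < d) (gr : growth d r).

(** For a positive exponent, indices far apart have values in different blocks. *)
Lemma level_inj : exists M : nat, forall m n,
  level r m = level r n -> (`|m - n| <= M)%N.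
Proof.
(* an error rate of [d / 2] leaves half of the exponent *)
have [|C C0 rC] := @growth_ln d (d / 2) r _ gr; first by rewrite divr_gt0.
have bound (m n : int) : n <= m -> level r m = level r n ->
    (m - n)%:~R <= (C + 1) * (2 / d) :> R.
  move=> nm mn; have := rC n m; rewrite -[X in `|X%:~R|]opprB rmorphN/= normrN.
  rewrite ger0_norm ?ler0z ?subr_ge0// -opprB rmorphN/=.
  have /andP[h1 h2] := floor_itv (ln (r m)); have /andP[h3 h4] := floor_itv (ln (r n)).
  rewrite -/(level r m) mn in h1 h2; rewrite -/(level r n) in h3 h4.
  rewrite intrD in h2 h4.
  move=> h; rewrite mulrA ler_pdivlMr// [leLHS]mulrC; lra.
exists (Num.truncn ((C + 1) * (2 / d))) => m n mn.
rewrite -ltnS -(ltr_nat R); apply: le_lt_trans (truncnS_gt _).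
case: (leP n m) => nm.
  by rewrite natr_absz ger0_norm ?subr_ge0//; exact: bound.
rewrite -abszN opprB natr_absz ger0_norm ?subr_ge0 ?(ltW nm)//.
by apply: bound => //; exact: ltW.
Qed.

(** One step of the index moves the logarithm by a bounded amount, and the
    logarithm is unbounded in both directions. *)
Lemma level_surj : exists A : nat, forall m, exists n, (`|level r n - m| <= A)%N.
Proof.
have [|C C0 rC] := @growth_ln d (d / 2) r _ gr; first by rewrite divr_gt0.
have d20 : 0 < 2 / d by rewrite divr_gt0.
pose B := C + (d + d / 2).
have B0 : 0 <= B by rewrite !addr_ge0 ?divr_ge0 ?(ltW d0).
have up n : ln (r (n + 1)) <= B + ln (r n).
  by have := rC (n + 1) n; rewrite (addrC n) addrK normr1 !mulr1.
have arch (x : R) : exists2 N : nat, 0 <= N%:R :> R & x < N%:R.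
  by exists (Num.truncn x).+1; [exact: ler0n|exact: truncnS_gt].
have half (x y : R) : x * (2 / d) < y -> x < d / 2 * y.
  have dd : d / 2 * (2 / d) = 1 by field; rewrite gt_eqF.
  by move=> xy; rewrite -(ltr_pM2r d20) mulrAC dd mul1r.
have [N N0 BN] := arch B.
exists N.+1; apply: coarse_surj => [n|m|m].
- rewrite -ltzD1 floor_lt_int; apply: le_lt_trans (up n) _.
  have h1 := floorD1_gt (ln (r n)); rewrite -/(level r n) intrD in h1.
  rewrite !intrD -pmulrn -natr1; lra.
- have [M M0 xM] := arch ((C + ln (r 0) - m%:~R) * (2 / d)).
  exists (- M%:Z); rewrite -ltzD1 floor_lt_int; apply: le_lt_trans (rC _ 0) _.
  rewrite subr0 rmorphN/= normrN -pmulrn ger0_norm// intrD.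
  by have := half _ _ xM; lra.
- have [M M0 xM] := arch ((m%:~R + 1 + C - ln (r 0)) * (2 / d)).
  exists M%:Z => n Mn; rewrite ltNge -ltzD1 -leNgt floor_ge_int intrD.
  have nM : M%:R <= n%:~R :> R by rewrite pmulrn ler_int.
  have := rC 0 n; rewrite sub0r rmorphN/= normrN ger0_norm; last exact: le_trans nM.
  have := half _ _ (lt_le_trans xM nM); lra.
Qed.

End GrowthLog.

(** * The discrete Holmstedt formula *)

Section Holmstedt.
Context {R : realType}.
Implicit Types (E F : ri_space R) (b w s K : int -> R).

(** The quasi-norms of the two endpoint spaces, and their truncations at the level
    [n], as functions of the sequence [K] of values of the K-functional. *)
Definition Rwhole E F b w K : \bar R :=
  mix E F b (fun k => w k * K k) (fun i k => i <= k).
Definition Rhead E F b w K (n : int) : \bar R :=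
  mix E F b (fun k => w k * K k) (fun i k => (i <= k) && (k < n)).
Definition Lwhole E F b w K : \bar R :=
  mix E F b (fun k => w k * K k) (fun i k => k <= i).
Definition Ltail E F b w K (n : int) : \bar R :=
  mix E F b (fun k => w k * K k) (fun i k => (n < k) && (k <= i)).

Variables (E0 F0 E1 F1 : ri_space R) (b0 w0 s0 b1 w1 s1 : int -> R).
Variables (theta0 theta1 : R).
Hypotheses (h0 : 0 < theta0) (h01 : theta0 < theta1) (h1 : theta1 < 1).
Hypotheses (gb0 : growth 0 b0) (hs0 : head_norm E0 b0 s0).
Hypotheses (gb1 : growth 0 b1) (hs1 : tail_norm E1 b1 s1).
Hypotheses (gw0 : growth (- theta0) w0) (gw1 : growth (- theta1) w1).

Local Notation om0 n := (w0 n * s0 n).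
Local Notation om1 n := (w1 n * s1 n).
Local Notation rho n := (w0 n * s0 n / (w1 n * s1 n)).

Let b00 k : 0 <= b0 k. Proof. exact/ltW/gb0.1. Qed.
Let b10 k : 0 <= b1 k. Proof. exact/ltW/gb1.1. Qed.
Let w00 k : 0 < w0 k. Proof. exact/gw0.1. Qed.
Let w10 k : 0 < w1 k. Proof. exact/gw1.1. Qed.
Let s00 k : 0 < s0 k. Proof. exact: (head_norm_gt0 gb0 hs0). Qed.
Let s10 k : 0 < s1 k. Proof. exact: (tail_norm_gt0 gb1 hs1). Qed.
Let om00 k : 0 < w0 k * s0 k. Proof. exact: mulr_gt0. Qed.
Let om10 k : 0 < w1 k * s1 k. Proof. exact: mulr_gt0. Qed.
Let rho0 k : 0 < rho k. Proof. exact: divr_gt0. Qed.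
Let wK0 w K : (forall k, 0 < w k) -> (forall k, 0 <= K k) ->
  forall k, 0 <= w k * K k.
Proof. by move=> w_gt0 K0 k; rewrite mulr_ge0// ltW. Qed.

Lemma growth_om0 : growth (- theta0) (fun n => om0 n).
Proof.
by rewrite -[X in growth X _]addr0; apply: growthM gw0 (growth_head_norm gb0 hs0).
Qed.

Lemma growth_om1 : growth (- theta1) (fun n => om1 n).
Proof.
by rewrite -[X in growth X _]addr0; apply: growthM gw1 (growth_tail_norm gb1 hs1).
Qed.

Lemma growth_rho : growth (theta1 - theta0) (fun n => rho n).
Proof.
rewrite -[theta1]opprK [X in growth X _]addrC.
exact: growthM growth_om0 (growthV growth_om1).
Qed.

(** The expression to which the K-functional of the endpoint spaces at [rho n] is
    equivalent. *)
Definition Ksum K (n : int) : \bar R :=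
  (Rhead E0 F0 b0 w0 K n + (om0 n * K n)%:E + (rho n)%:E * Ltail E1 F1 b1 w1 K n)%E.

Lemma Rhead_ge0 K n : (forall k, 0 <= K k) -> (0 <= Rhead E0 F0 b0 w0 K n)%E.
Proof. by move=> K0; apply: mix_ge0 => //; exact: wK0. Qed.
Lemma Rwhole_ge0 K : (forall k, 0 <= K k) -> (0 <= Rwhole E0 F0 b0 w0 K)%E.
Proof. by move=> K0; apply: mix_ge0 => //; exact: wK0. Qed.
Lemma Ltail_ge0 K n : (forall k, 0 <= K k) -> (0 <= Ltail E1 F1 b1 w1 K n)%E.
Proof. by move=> K0; apply: mix_ge0 => //; exact: wK0. Qed.
Lemma Lwhole_ge0 K : (forall k, 0 <= K k) -> (0 <= Lwhole E1 F1 b1 w1 K)%E.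
Proof. by move=> K0; apply: mix_ge0 => //; exact: wK0. Qed.

Lemma Ksum_ge0 K n : (forall k, 0 <= K k) -> (0 <= Ksum K n)%E.
Proof.
move=> K0; apply: adde_ge0; first apply: adde_ge0.
- exact: Rhead_ge0.
- by rewrite lee_fin mulr_ge0// ltW.
- by rewrite mule_ge0 ?Ltail_ge0// lee_fin ltW.
Qed.

(** The hypotheses on [K0] and [K1] are those of a decomposition that is near
    optimal at level [n]: [K0] follows [K] up to [n] and is flat afterwards, [K1]
    is linear in [e^k] up to [n] and follows [K] afterwards. The flat and the
    linear parts are powers and contribute the middle term only. *)
Lemma Ksum_ge_norms : exists2 C : R, 0 < C & forall K K0 K1 (D : R) n,
  (forall k, 0 <= K k) -> (forall k, 0 <= K0 k) -> (forall k, 0 <= K1 k) -> 0 <= D ->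
  (forall k, k <= n -> K0 k <= D * K k /\ K1 k <= D * (expR (k - n)%:~R * K n)) ->
  (forall k, n <= k -> K0 k <= D * K n /\ K1 k <= D * K k) ->
  (Rwhole E0 F0 b0 w0 K0 <= (C * D)%:E * Ksum K n)%E /\
  ((rho n)%:E * Lwhole E1 F1 b1 w1 K1 <= (C * D)%:E * Ksum K n)%E.
Proof.
have [|C0 C00 H0] := mix_split F0 gb0 hs0 _ gw0; first by rewrite oppr_lt0.
(* the linear part of [K1] is put into the weight, which then has the positive
   exponent [1 - theta1] *)
pose v k := w1 k * expR (1 * k%:~R).
have gv : growth (- theta1 + 1) v by apply: growthM gw1 _; exact: growth_expR.
have [|C1 C10 H1] := mix_tail_split F1 gb1 hs1 _ gv.
  by rewrite addrC subr_gt0.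
exists (C0 + C1) => [|K K0 K1 D n Kg0 K0g0 K1g0 D0 Kn nK]; first exact: addr_gt0.
have Tg0 : (0 <= (om0 n * K n)%:E)%E by rewrite lee_fin mulr_ge0// ltW.
have Hg0 := Rhead_ge0 n Kg0; have Lg0 := Ltail_ge0 n Kg0.
have CD0 : 0 <= C0 * D by rewrite mulr_ge0// ltW.
have CD1 : 0 <= C1 * D by rewrite mulr_ge0// ltW.
have rLg0 : (0 <= (rho n)%:E * Ltail E1 F1 b1 w1 K n)%E.
  by rewrite mule_ge0// lee_fin ltW.
split.
  have := H0 (fun k => w0 k * K k) (fun k => w0 k * K0 k) D (K n) n.
  move=> /(_ (wK0 w00 Kg0) (wK0 w00 K0g0) D0 (Kg0 n)).
  move=> h; apply: le_trans (h _ _) _ => [k /ltW /Kn[+ _]|k /nK[+ _]|].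
  - by rewrite mulrCA ler_pM2l.
  - by rewrite [D * K n * _]mulrC ler_pM2l.
  apply: lee_pmul; rewrite ?lee_fin//; first exact: adde_ge0.
    by rewrite mulrDl lerDl.
  by rewrite leeDl.
have := H1 (fun k => w1 k * K k) (fun k => w1 k * K1 k) D (expR (- n%:~R) * K n) n.
move=> /(_ (wK0 w10 Kg0) (wK0 w10 K1g0) D0).
have en0 : 0 <= expR (- n%:~R) * K n by rewrite mulr_ge0// expR_ge0.
move=> /(_ en0) h.
have {}h : (Lwhole E1 F1 b1 w1 K1 <= (C1 * D)%:E *
    (Ltail E1 F1 b1 w1 K n + (om1 n * K n)%:E))%E.
  apply: le_trans (h _ _) _ => [k /ltW /nK[_]|k /Kn[_]|].
  - by rewrite mulrCA ler_pM2l.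
  - rewrite /v rmorphB/= expRD mul1r -(ler_pM2l (w10 k)) => /le_trans; apply.
    rewrite le_eqVlt; apply/orP; left; apply/eqP; ring.
  - rewrite le_eqVlt; apply/orP; left; apply/eqP; congr (_ * (_ + _%:E))%E.
    rewrite /v mul1r expRN; field; exact: lt0r_neq0 (expR_gt0 _).
apply: (@le_trans _ _ ((rho n)%:E * ((C1 * D)%:E *
    (Ltail E1 F1 b1 w1 K n + (om1 n * K n)%:E)))%E).
  by rewrite lee_wpmul2l// lee_fin ltW.
have T1g0 : (0 <= (om1 n * K n)%:E)%E by rewrite lee_fin mulr_ge0// ltW.
rewrite muleCA ge0_muleDr// -EFinM mulrA divfK ?lt0r_neq0//.
apply: lee_pmul; rewrite ?lee_fin//; first exact: adde_ge0.
  by rewrite mulrDl lerDr.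
by rewrite addeC /Ksum -addeA leeDr.
Qed.

Lemma mix_le_addition E F b w K K0 K1 (D : R) (Q : rel int) :
  (forall k, 0 <= b k) -> (forall k, 0 < w k) ->
  (forall k, 0 <= K k) -> (forall k, 0 <= K0 k) -> (forall k, 0 <= K1 k) -> 0 <= D ->
  (forall k, K k <= D * (K0 k + K1 k)) ->
  (mix E F b (fun k => (w k * K k)%R) Q <=
    D%:E * (mix E F b (fun k => (w k * K0 k)%R) Q + mix E F b (fun k => (w k * K1 k)%R) Q))%E.
Proof.
move=> bg0 wg0 Kg0 K0g0 K1g0 D0 KD.
have wKg0 := wK0 wg0.
apply: (@le_trans _ _ (D%:E * mix E F b (fun k => w k * K0 k + w k * K1 k)%R Q)%E).
  apply: le_mix => // [|k|i k Qik]; first exact: wKg0.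
    by apply: addr_ge0; exact: wKg0.
  by split => //; rewrite -mulrDr mulrCA ler_pM2l.
rewrite lee_wpmul2l ?lee_fin//; apply: mixD => // [k|k|k]; try exact: wKg0.
by apply: addr_ge0; exact: wKg0.
Qed.

(** The endpoint norms [y0] and [y1] bound [om0 * K0] and [om1 * K1] pointwise. The
    cross terms, the head of [K1] and the tail of [K0], are therefore bounded by
    powers of exponents [theta1 - theta0] and [theta0 - theta1]; as the first is
    positive and the second negative, their norms are carried by the values at
    [n]. *)
Lemma Ksum_le_norms : exists2 C : R, 0 < C & forall K K0 K1 (D y0 y1 : R) n,
  (forall k, 0 <= K k) -> (forall k, 0 <= K0 k) -> (forall k, 0 <= K1 k) -> 0 <= D ->
  (forall k, K k <= D * (K0 k + K1 k)) ->
  Rwhole E0 F0 b0 w0 K0 = y0%:E -> Lwhole E1 F1 b1 w1 K1 = y1%:E ->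
  (Ksum K n <= (C * D * (y0 + rho n * y1))%:E)%E.
Proof.
have [CR CR0 HR] := mix_entry F0 gb0 hs0.
have [CL CL0 HL] := mix_tail_entry F1 gb1 hs1.
have g01 : growth (theta1 - theta0) (fun k => w0 k / om1 k).
  rewrite -[theta1]opprK [X in growth X _]addrC.
  exact: growthM gw0 (growthV growth_om1).
have g10 : growth (theta0 - theta1) (fun k => w1 k / om0 k).
  rewrite -[theta0]opprK [X in growth X _]addrC.
  exact: growthM gw1 (growthV growth_om0).
have [|CA CA0 HA] := mix_cross F0 gb0 hs0 _ g01; first by rewrite subr_gt0.
have [|CB CB0 HB] := mix_tail_cross F1 gb1 hs1 _ g10; first by rewrite subr_lt0.
exists (1 + CA * CL + CR + CL + 1 + CB * CR).
  by rewrite !addr_gt0// mulr_gt0.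
move=> K K0 K1 D y0 y1 n Kg0 K0g0 K1g0 D0 KD Y0 Y1.
have y00 : 0 <= y0 by rewrite -lee_fin -Y0 Rwhole_ge0.
have y10 : 0 <= y1 by rewrite -lee_fin -Y1 Lwhole_ge0.
have rn0 := rho0 n.
have om0y k : om0 k * K0 k <= CR * y0.
  rewrite -lee_fin (EFinM CR) -Y0 mulrAC.
  by apply: (HR (fun k => w0 k * K0 k)); [exact: wK0|move=> i /ltW].
have om1y k : om1 k * K1 k <= CL * y1.
  rewrite -lee_fin (EFinM CL) -Y1 mulrAC.
  by apply: (HL (fun k => w1 k * K1 k)); [exact: wK0|move=> i /ltW].
have RD : (Rhead E0 F0 b0 w0 K n <=
    D%:E * (Rhead E0 F0 b0 w0 K0 n + Rhead E0 F0 b0 w0 K1 n))%E.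
  exact: mix_le_addition.
have LD : (Ltail E1 F1 b1 w1 K n <=
    D%:E * (Ltail E1 F1 b1 w1 K0 n + Ltail E1 F1 b1 w1 K1 n))%E.
  exact: mix_le_addition.
have R0 : (Rhead E0 F0 b0 w0 K0 n <= y0%:E)%E.
  rewrite -Y0 -[leRHS]mul1e; apply: le_mix => //; try exact: wK0.
  by move=> i k /andP[ik _]; rewrite mul1r.
have L1 : (Ltail E1 F1 b1 w1 K1 n <= y1%:E)%E.
  rewrite -Y1 -[leRHS]mul1e; apply: le_mix => //; try exact: wK0.
  by move=> i k /andP[_ ik]; rewrite mul1r.
have R1 : (Rhead E0 F0 b0 w0 K1 n <= (CA * CL * (rho n * y1))%:E)%E.
  have := HA (fun k => w0 k * K1 k) (CL * y1) n (wK0 w00 K1g0).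
  rewrite mulr_ge0 ?(ltW CL0)// => /(_ isT) h; apply: le_trans (h _) _ => [k _|].
    rewrite mulrCA ler_pM2l// -ler_pdivrMr// ?invr_gt0// invrK mulrC.
    exact: om1y.
  by rewrite lee_fin le_eqVlt; apply/orP; left; apply/eqP; ring.
have L0 : (Ltail E1 F1 b1 w1 K0 n <= (CB * CR * ((rho n)^-1 * y0))%:E)%E.
  have := HB (fun k => w1 k * K0 k) (CR * y0) n (wK0 w10 K0g0).
  rewrite mulr_ge0 ?(ltW CR0)// => /(_ isT) h; apply: le_trans (h _) _ => [k _|].
    rewrite mulrCA ler_pM2l// -ler_pdivrMr// ?invr_gt0// invrK mulrC.
    exact: om0y.
  by rewrite lee_fin invf_div le_eqVlt; apply/orP; left; apply/eqP; ring.
have Tn : om0 n * K n <= D * (CR * y0 + rho n * (CL * y1)).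
  apply: (le_trans (ler_wpM2l (ltW (om00 n)) (KD n))).
  rewrite mulrCA ler_wpM2l// mulrDr lerD//.
  have -> : om0 n * K1 n = rho n * (om1 n * K1 n).
    by rewrite mulrA divfK// lt0r_neq0.
  by rewrite ler_pM2l.
apply: (@le_trans _ _ (D * (y0 + CA * CL * (rho n * y1)) +
    D * (CR * y0 + rho n * (CL * y1)) +
    rho n * (D * (CB * CR * ((rho n)^-1 * y0) + y1)))%:E).
  rewrite !EFinD; apply: leeD; first apply: leeD.
  - apply: (le_trans RD); rewrite EFinM lee_wpmul2l ?lee_fin// EFinD.
    exact: leeD.
  - by rewrite lee_fin.
  - rewrite (EFinM (rho n)) lee_wpmul2l ?lee_fin ?(ltW rn0)//; apply: (le_trans LD).
    by rewrite EFinM lee_wpmul2l ?lee_fin// EFinD; exact: leeD.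
rewrite lee_fin.
have -> : rho n * (D * (CB * CR * ((rho n)^-1 * y0) + y1)) =
  D * (CB * CR * y0 + rho n * y1).
  rewrite mulrCA mulrDr; congr (_ * (_ + _)).
  by rewrite mulrCA; congr (_ * _); rewrite mulrA divff ?mul1r// lt0r_neq0.
have ry : 0 <= rho n * y1 by rewrite mulr_ge0// ltW.
have p1 : 0 <= CA * CL by rewrite mulr_ge0// ltW.
have p2 : 0 <= CB * CR by rewrite mulr_ge0// ltW.
rewrite (mulrCA (rho n)).
move: ry p1 p2 (ltW CR0) (ltW CL0) => + + + CR0' CL0'.
move: (rho n * y1) (CA * CL) (CB * CR) => r u v r0 u0 v0.
rewrite -subr_ge0.
have -> : (1 + u + CR + CL + 1 + v) * D * (y0 + r) -
    (D * (y0 + u * r) + D * (CR * y0 + CL * r) + D * (v * y0 + r)) =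
  D * (y0 * (1 + u + CL) + r * (1 + CR + v)) by ring.
by rewrite mulr_ge0// addr_ge0// mulr_ge0// !addr_ge0.
Qed.

(** A Hardy-type inequality: the translates all have the same norm. *)
Lemma snorm_hardy E (X Z : int -> \bar R) (q : R) (p : nat -> int) :
  0 <= q -> q < 1 -> (forall n, 0 <= X n)%E -> (forall n, 0 <= Z n)%E ->
  (forall n, X n <= \sum_(j <oo) ((q ^+ j)%:E * Z (n + p j)%R))%E ->
  (snorm E X <= ((1 - q)^-1)%:E * snorm E Z)%E.
Proof.
move=> q0 q1 X0 Z0 XZ; apply: (le_trans (le_snorm E X0 XZ)).
have qj j : 0 <= q ^+ j by exact: exprn_ge0.
apply: snorm_geometric => // [j k|j]; first by rewrite mule_ge0 ?lee_fin.
by rewrite snormZ// snorm_shift.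
Qed.

(** The head is at most a sum of the middle terms at lower levels; the decay of the
    weight makes that sum geometric. *)
Lemma hardy_head E W (eta : R) : eta < 0 -> growth eta W ->
  exists2 C : R, 0 < C & forall K, (forall k, 0 <= K k) ->
    (snorm E (fun n => (W n)%:E * Rhead E0 F0 b0 w0 K n) <=
     C%:E * snorm E (fun n => (W n * (om0 n * K n))%:E))%E.
Proof.
move=> eta0 gW; have Wg0 := gW.1.
have [C C0 HC] := mix_series F0 gb0 hs0.
have [Cs Cs0 sC] := growth_shift 1 (growth_head_norm gb0 hs0).
have [CW CW0 WC] := growth_shift 1 gW.
have [q [q0 q1 [D D0 WD]]] := growth_decay eta0 gW.
pose A := CW * D * C * Cs.
have A0 : 0 < A by rewrite !mulr_gt0.
exists ((1 - q)^-1 * A) => [|K Kg0]; first by rewrite mulr_gt0// invr_gt0 subr_gt0.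
have Z0 n : (0 <= (W n * (om0 n * K n))%:E)%E.
  by rewrite lee_fin !mulr_ge0// ltW.
rewrite EFinM -muleA -snormZ ?(ltW A0)//.
apply: (@snorm_hardy _ _ _ q (fun j => - 1 - j%:Z)) => // [|n|n|n].
- exact: ltW.
- by rewrite mule_ge0 ?Rhead_ge0// lee_fin ltW.
- by rewrite mule_ge0// lee_fin ltW.
have Wn0 : (0 <= (W n)%:E)%E by rewrite lee_fin ltW.
apply: (le_trans (lee_wpmul2l Wn0 (HC _ n (wK0 w00 Kg0)))).
have xs0 j : (0 <= (w0 (n - 1 - j%:Z) * K (n - 1 - j%:Z) * s0 (n - j%:Z))%:E)%E.
  by rewrite lee_fin !mulr_ge0// ltW.
rewrite muleA -EFinM -nneseriesZl//; apply: lee_nneseries => [j _ _|j _].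
  by rewrite mule_ge0// lee_fin mulr_ge0// ltW.
rewrite addrA -!EFinM lee_fin.
have hW : W n <= CW * (D * q ^+ j * W (n - 1 - j%:Z)).
  rewrite -{1}(subrK 1 n); apply: (le_trans (WC _)); rewrite ler_pM2l//.
  by rewrite -{1}(subrK j%:Z (n - 1)).
have hS : s0 (n - j%:Z) <= Cs * s0 (n - 1 - j%:Z).
  by have := sC (n - 1 - j%:Z); rewrite addrAC subrK.
set m := n - 1 - j%:Z in hW hS *.
have -> : q ^+ j * (A * (W m * (w0 m * s0 m * K m))) =
  CW * (D * q ^+ j * W m) * C * (w0 m * K m * (Cs * s0 m)) by rewrite /A; ring.
apply: ler_pM.
- by rewrite mulr_ge0// ltW.
- by rewrite !mulr_ge0// ltW.
- by rewrite ler_pM2r.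
- by rewrite ler_wpM2l// mulr_ge0// ltW.
Qed.

Lemma hardy_tail E W (eta : R) : 0 < eta -> growth eta W ->
  exists2 C : R, 0 < C & forall K, (forall k, 0 <= K k) ->
    (snorm E (fun n => (W n)%:E * Ltail E1 F1 b1 w1 K n) <=
     C%:E * snorm E (fun n => (W n * (om1 n * K n))%:E))%E.
Proof.
move=> eta0 gW; have Wg0 := gW.1.
have [C C0 HC] := mix_tail_series F1 gb1 hs1.
have [Cs Cs0 sC] := growth_shift (- 1) (growth_tail_norm gb1 hs1).
have [CW CW0 WC] := growth_shift (- 1) gW.
have [q [q0 q1 [D D0 WD]]] := growth_decay_opp eta0 gW.
pose A := CW * D * C * Cs.
have A0 : 0 < A by rewrite !mulr_gt0.
exists ((1 - q)^-1 * A) => [|K Kg0]; first by rewrite mulr_gt0// invr_gt0 subr_gt0.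
have Z0 n : (0 <= (W n * (om1 n * K n))%:E)%E.
  by rewrite lee_fin !mulr_ge0// ltW.
rewrite EFinM -muleA -snormZ ?(ltW A0)//.
apply: (@snorm_hardy _ _ _ q (fun j => 1 + j%:Z)) => // [|n|n|n].
- exact: ltW.
- by rewrite mule_ge0 ?Ltail_ge0// lee_fin ltW.
- by rewrite mule_ge0// lee_fin ltW.
have Wn0 : (0 <= (W n)%:E)%E by rewrite lee_fin ltW.
apply: (le_trans (lee_wpmul2l Wn0 (HC _ n (wK0 w10 Kg0)))).
have xs0 j : (0 <= (w1 (n + 1 + j%:Z) * K (n + 1 + j%:Z) * s1 (n + j%:Z))%:E)%E.
  by rewrite lee_fin !mulr_ge0// ltW.
rewrite muleA -EFinM -nneseriesZl//; apply: lee_nneseries => [j _ _|j _].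
  by rewrite mule_ge0// lee_fin mulr_ge0// ltW.
rewrite addrA -!EFinM lee_fin.
have hW : W n <= CW * (D * q ^+ j * W (n + 1 + j%:Z)).
  rewrite -{1}(addrK 1 n); apply: (le_trans (WC _)); rewrite ler_pM2l//.
  by rewrite -{1}(addrK j%:Z (n + 1)).
have hS : s1 (n + j%:Z) <= Cs * s1 (n + 1 + j%:Z).
  by have := sC (n + 1 + j%:Z); rewrite addrAC addrK.
set m := n + 1 + j%:Z in hW hS *.
have -> : q ^+ j * (A * (W m * (w1 m * s1 m * K m))) =
  CW * (D * q ^+ j * W m) * C * (w1 m * K m * (Cs * s1 m)) by rewrite /A; ring.
apply: ler_pM.
- by rewrite mulr_ge0// ltW.
- by rewrite !mulr_ge0// ltW.
- by rewrite ler_pM2r.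
- by rewrite ler_wpM2l// mulr_ge0// ltW.
Qed.

(** The entry next to [n] in the head already has the size of the middle term. *)
Lemma middle_le_head : exists2 C : R, 0 < C & forall K (D : R) n,
  (forall k, 0 <= K k) -> 0 <= D -> (forall k, K (k + 1) <= D * K k) ->
  ((om0 n * K n)%:E <= (C * D)%:E * Rhead E0 F0 b0 w0 K n)%E.
Proof.
have [C C0 HC] := mix_entry F0 gb0 hs0.
have [Cw Cw0 wC] := growth_shift 1 gw0.
exists (Cw * C) => [|K D n K0 D0 KD]; first exact: mulr_gt0.
have := HC (fun k => w0 k * K k) (fun i k => (i <= k) && (k < n)) (n - 1) n (wK0 w00 K0).
have nn i : i < n -> (i <= n - 1) && (n - 1 < n).
  by rewrite gtrBl ltr01 andbT -ltzD1 subrK.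
move=> /(_ nn) h.
apply: (@le_trans _ _ ((Cw * D)%:E * (w0 (n - 1) * K (n - 1) * s0 n)%:E)%E).
  rewrite -EFinM lee_fin.
  have -> : Cw * D * (w0 (n - 1) * K (n - 1) * s0 n) =
    Cw * w0 (n - 1) * s0 n * (D * K (n - 1)) by ring.
  have := wC (n - 1); have := KD (n - 1); rewrite subrK => hK hw.
  apply: ler_pM => //; first exact: ltW.
  by rewrite ler_wpM2r// ltW.
have -> : Cw * C * D = Cw * D * C by ring.
by rewrite (EFinM (Cw * D)) -muleA lee_wpmul2l// lee_fin mulr_ge0// ltW.
Qed.

Lemma middle_le_tail : exists2 C : R, 0 < C & forall K n,
  (forall k, 0 <= K k) -> (forall k, K k <= K (k + 1)) ->
  ((om1 n * K n)%:E <= C%:E * Ltail E1 F1 b1 w1 K n)%E.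
Proof.
have [C C0 HC] := mix_tail_entry F1 gb1 hs1.
have [Cw Cw0 wC] := growth_shift (- 1) gw1.
exists (Cw * C) => [|K n K0 KD]; first exact: mulr_gt0.
have := HC (fun k => w1 k * K k) (fun i k => (n < k) && (k <= i)) (n + 1) n (wK0 w10 K0).
have nn i : n < i -> (n < n + 1) && (n + 1 <= i).
  by rewrite ltrDl ltr01 lezD1.
move=> /(_ nn) h.
apply: (@le_trans _ _ (Cw%:E * (w1 (n + 1) * K (n + 1) * s1 n)%:E)%E).
  rewrite -EFinM lee_fin.
  have -> : Cw * (w1 (n + 1) * K (n + 1) * s1 n) =
    Cw * w1 (n + 1) * s1 n * K (n + 1) by ring.
  have := wC (n + 1); rewrite addrK => hw.
  apply: ler_pM => //; first exact: ltW.
  by rewrite ler_wpM2r// ltW.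
by rewrite (EFinM Cw C) -muleA lee_wpmul2l// lee_fin ltW.
Qed.

Lemma snorm_WKsum E W K : (forall n, 0 < W n) -> (forall k, 0 <= K k) ->
  (snorm E (fun n => (W n)%:E * Ksum K n) <=
   snorm E (fun n => (W n)%:E * Rhead E0 F0 b0 w0 K n) +
   snorm E (fun n => (W n * (om0 n * K n))%:E) +
   snorm E (fun n => (W n * rho n)%:E * Ltail E1 F1 b1 w1 K n))%E.
Proof.
move=> W0 K0.
have n1 n : (0 <= (W n)%:E * Rhead E0 F0 b0 w0 K n)%E.
  by rewrite mule_ge0 ?Rhead_ge0// lee_fin ltW.
have n2 n : (0 <= (W n * (om0 n * K n))%:E)%E by rewrite lee_fin !mulr_ge0// ltW.
have n3 n : (0 <= (W n * rho n)%:E * Ltail E1 F1 b1 w1 K n)%E.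
  by rewrite mule_ge0 ?Ltail_ge0// lee_fin mulr_ge0// ltW.
apply: le_trans (leeD2r _ (snormD E n1 n2)).
apply: le_trans (snormD E _ n3); last by move=> n; exact: adde_ge0.
apply: le_snorm => n; first by rewrite mule_ge0 ?Ksum_ge0// lee_fin ltW.
have Wn0 : (0 <= (W n)%:E)%E by rewrite lee_fin ltW.
rewrite /Ksum !ge0_muleDr ?Rhead_ge0//.
- by rewrite -EFinM muleA -EFinM.
- by rewrite lee_fin mulr_ge0// ltW.
- by rewrite adde_ge0 ?Rhead_ge0// lee_fin mulr_ge0// ltW.
- by rewrite mule_ge0 ?Ltail_ge0// lee_fin ltW.
Qed.

Let growth_Wrho W (theta : R) : growth (- (theta * (theta1 - theta0))) W ->
  growth ((1 - theta) * (theta1 - theta0)) (fun n => W n * rho n).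
Proof.
by move=> gW; rewrite mulrBl mul1r addrC; exact: growthM gW growth_rho.
Qed.

Let Wom W K n : W n * rho n * (om1 n * K n) = W n * (om0 n * K n).
Proof. by rewrite -mulrA; congr (_ * _); rewrite mulrA divfK// lt0r_neq0. Qed.

(** In the interior the weight decays enough to absorb the head, and [W * rho] grows
    enough to absorb the tail. At an endpoint one of the two exponents vanishes;
    the corresponding term remains, and it dominates the middle one. *)
Lemma WKsum_interior E W (theta : R) : 0 < theta -> theta < 1 ->
  growth (- (theta * (theta1 - theta0))) W ->
  exists2 C : R, 0 < C & forall K, (forall k, 0 <= K k) ->
    (snorm E (fun n => (W n)%:E * Ksum K n) <=
      C%:E * snorm E (fun n => (W n * (om0 n * K n))%:E))%E /\
    (snorm E (fun n => (W n * (om0 n * K n))%:E) <=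
      snorm E (fun n => (W n)%:E * Ksum K n))%E.
Proof.
move=> t0 t1 gW; have W0 := gW.1.
have d0 : 0 < theta1 - theta0 by rewrite subr_gt0.
have [|C C0 HC] := hardy_head E _ gW; first by rewrite oppr_lt0 mulr_gt0.
have [|D D0 HD] := hardy_tail E _ (growth_Wrho gW).
  by rewrite mulr_gt0// subr_gt0.
exists (C + 1 + D) => [|K K0]; first by rewrite !addr_gt0.
have s_ge0 : (0 <= snorm E (fun n => (W n * (om0 n * K n))%:E))%E.
  by apply: snorm_ge0 => n; rewrite lee_fin !mulr_ge0// ltW.
split.
  apply: (le_trans (snorm_WKsum E W0 K0)).
  rewrite !EFinD !ge0_muleDl ?lee_fin ?addr_ge0 ?(ltW C0) ?(ltW D0)// mul1e.
  apply: leeD; first by rewrite leeD2r//; exact: HC.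
  apply: le_trans (HD K K0) _.
  by under eq_fun do rewrite Wom.
apply: le_snorm => n; first by rewrite lee_fin !mulr_ge0// ltW.
rewrite EFinM lee_wpmul2l ?lee_fin ?(ltW (W0 n))//.
rewrite /Ksum addeAC leeDr// adde_ge0 ?Rhead_ge0//.
by rewrite mule_ge0 ?Ltail_ge0// lee_fin ltW.
Qed.

Lemma WKsum_zero E W : growth 0 W ->
  exists2 C : R, 0 < C & forall K (D : R), (forall k, 0 <= K k) -> 0 <= D ->
    (forall k, K (k + 1) <= D * K k) ->
    (snorm E (fun n => (W n)%:E * Ksum K n) <=
      (1 + C * D)%:E * snorm E (fun n => (W n)%:E * Rhead E0 F0 b0 w0 K n))%E /\
    (snorm E (fun n => (W n)%:E * Rhead E0 F0 b0 w0 K n) <=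
      snorm E (fun n => (W n)%:E * Ksum K n))%E.
Proof.
move=> gW; have W0 := gW.1.
have d0 : 0 < theta1 - theta0 by rewrite subr_gt0.
have [||C C0 HC] := @hardy_tail E (fun n => W n * rho n) ((1 - 0) * (theta1 - theta0)).
- by rewrite subr0 mul1r.
- by apply: growth_Wrho; rewrite mul0r oppr0.
have [D D0 HD] := middle_le_head.
exists (D * (1 + C)) => [|K M K0 M0 KM]; first by rewrite mulr_gt0// addr_gt0.
have nR n : (0 <= (W n)%:E * Rhead E0 F0 b0 w0 K n)%E.
  by rewrite mule_ge0 ?Rhead_ge0// lee_fin ltW.
have n2 n : (0 <= (W n * (om0 n * K n))%:E)%E by rewrite lee_fin !mulr_ge0// ltW.
have sR0 := snorm_ge0 E nR.
have mid : (snorm E (fun n => (W n * (om0 n * K n))%:E) <=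
    (D * M)%:E * snorm E (fun n => (W n)%:E * Rhead E0 F0 b0 w0 K n))%E.
  apply: le_snormZ => // [|n]; first by rewrite mulr_ge0// ltW.
  by rewrite EFinM muleCA lee_wpmul2l ?lee_fin ?(ltW (W0 n))//; exact: HD.
split.
  apply: (le_trans (snorm_WKsum E W0 K0)).
  have -> : 1 + D * (1 + C) * M = 1 + D * M + C * (D * M) by ring.
  rewrite !EFinD !ge0_muleDl ?lee_fin ?addr_ge0 ?mulr_ge0 ?(ltW C0) ?(ltW D0)// mul1e.
  apply: leeD; first by rewrite leeD2l.
  apply: (le_trans (HC K K0)); under eq_fun do rewrite Wom.
  by rewrite (EFinM C) -muleA lee_wpmul2l ?lee_fin ?(ltW C0).
apply: le_snorm => n; first exact: nR.
rewrite lee_wpmul2l ?lee_fin ?(ltW (W0 n))//.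
rewrite /Ksum -addeA leeDl// adde_ge0//; first by rewrite lee_fin mulr_ge0// ltW.
by rewrite mule_ge0 ?Ltail_ge0// lee_fin ltW.
Qed.

Lemma WKsum_one E W : growth (- (theta1 - theta0)) W ->
  exists2 C : R, 0 < C & forall K, (forall k, 0 <= K k) ->
    (forall k, K k <= K (k + 1)) ->
    (snorm E (fun n => (W n)%:E * Ksum K n) <=
      C%:E * snorm E (fun n => (W n * rho n)%:E * Ltail E1 F1 b1 w1 K n))%E /\
    (snorm E (fun n => (W n * rho n)%:E * Ltail E1 F1 b1 w1 K n) <=
      snorm E (fun n => (W n)%:E * Ksum K n))%E.
Proof.
move=> gW; have W0 := gW.1.
have [|C C0 HC] := hardy_head E _ gW; first by rewrite oppr_lt0 subr_gt0.
have [D D0 HD] := middle_le_tail.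
exists (1 + D + C * D) => [|K K0 KM]; first by rewrite !addr_gt0// mulr_gt0.
have nL n : (0 <= (W n * rho n)%:E * Ltail E1 F1 b1 w1 K n)%E.
  by rewrite mule_ge0 ?Ltail_ge0// lee_fin mulr_ge0// ltW.
have n2 n : (0 <= (W n * (om0 n * K n))%:E)%E by rewrite lee_fin !mulr_ge0// ltW.
have sL0 := snorm_ge0 E nL.
have mid : (snorm E (fun n => (W n * (om0 n * K n))%:E) <=
    D%:E * snorm E (fun n => (W n * rho n)%:E * Ltail E1 F1 b1 w1 K n))%E.
  apply: le_snormZ => // [|n]; first exact: ltW.
  rewrite -Wom EFinM muleCA lee_wpmul2l ?lee_fin ?HD//.
  by rewrite mulr_ge0// ltW.
split.
  apply: (le_trans (snorm_WKsum E W0 K0)).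
  rewrite !EFinD !ge0_muleDl ?lee_fin ?addr_ge0 ?mulr_ge0 ?(ltW C0) ?(ltW D0)// mul1e.
  rewrite addeC -addeA leeD2l// addeC leeD//.
  apply: (le_trans (HC K K0)).
  by rewrite (EFinM C) -muleA lee_wpmul2l ?lee_fin ?(ltW C0).
apply: le_snorm => n; first exact: nL.
rewrite EFinM -muleA lee_wpmul2l ?lee_fin ?(ltW (W0 n))//.
rewrite /Ksum leeDr// adde_ge0 ?Rhead_ge0// lee_fin mulr_ge0// ltW//.
Qed.

End Holmstedt.

(** * From functions to sequences *)

Section Bridge.
Context {R : realType}.
Implicit Types (E F : ri_space R) (a b x : int -> R) (f : R -> \bar R) (c : int -> \bar R).

Local Notation lg t := (Num.floor (ln t)).

Lemma lg_mono (s t : R) : 0 < s -> s <= t -> lg s <= lg t.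
Proof.
by move=> s0 st; apply: le_floor; rewrite ler_ln// posrE// (lt_le_trans s0).
Qed.

Lemma lg_lt (s t : R) : 0 < s -> 0 < t -> lg s < lg t -> s < t.
Proof.
by move=> s0 t0; rewrite !ltNge; apply: contra => ts; exact: lg_mono.
Qed.

Lemma expR_lg_le (t : R) : 0 < t -> expR (lg t)%:~R <= t.
Proof. by move=> t0; rewrite -[leRHS]lnK// ler_expR floor_le. Qed.

Lemma expR_lg_gt (t : R) : 0 < t -> t < expR 1 * expR (lg t)%:~R.
Proof.
move=> t0; rewrite -expRD -[ltLHS]lnK// ltr_expR addrC.
by have := floorD1_gt (ln t); rewrite intrD.
Qed.

Lemma tnorm_le_snorm E f c (C : R) : 0 <= C -> (forall k, 0 <= c k)%E ->
  (forall t, (0 < t)%R -> 0 <= f t /\ f t <= C%:E * c (lg t))%E ->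
  (tnorm E f <= C%:E * snorm E c)%E.
Proof.
move=> C0 c0 fc; rewrite -snormZ// -tnorm_step; last first.
  by move=> k; rewrite mule_ge0.
apply: le_tnorm => t t0; have [f0 fC] := fc t t0.
by rewrite /step !gee0_abs// mule_ge0.
Qed.

Lemma snorm_le_tnorm E f c (C : R) : 0 < C -> (forall k, 0 <= c k)%E ->
  (forall t, (0 < t)%R -> c (lg t) <= C%:E * f t)%E ->
  (snorm E c <= C%:E * tnorm E f)%E.
Proof.
move=> C0 c0 fc.
have -> : c = (fun k => C%:E * (C^-1%:E * c k))%E.
  by apply/funext => k; rewrite muleA -EFinM divff ?gt_eqF// mul1e.
have C'0 : 0 <= C^-1 by rewrite invr_ge0 ltW.
have Cc0 k : (0 <= C^-1%:E * c k)%E by rewrite mule_ge0.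
rewrite snormZ ?(ltW C0)// lee_wpmul2l ?lee_fin ?(ltW C0)// -tnorm_step//.
apply: le_tnorm => t t0; rewrite /step gee0_abs//.
apply: (@le_trans _ _ (f t)); last exact: lee_abs.
by rewrite lee_pdivrMl//; exact: fc.
Qed.

Lemma tnorm_on_le_snorm E (I : set R) f c (C : R) : 0 <= C -> (forall k, 0 <= c k)%E ->
  (forall t, (0 < t)%R -> I t -> 0 <= f t /\ f t <= C%:E * c (lg t))%E ->
  (tnorm_on E I f <= C%:E * snorm E c)%E.
Proof.
move=> C0 c0 fc; apply: tnorm_le_snorm => // t t0; rewrite patchE.
by case: ifPn => [|_]; [rewrite inE => /fc; exact|rewrite mule_ge0].
Qed.

Lemma snorm_le_tnorm_on E (I : set R) f c (C : R) : 0 < C -> (forall k, 0 <= c k)%E ->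
  (forall t, (0 < t)%R -> I t -> c (lg t) <= C%:E * f t)%E ->
  (forall t, (0 < t)%R -> ~ I t -> c (lg t) = 0)%E ->
  (snorm E c <= C%:E * tnorm_on E I f)%E.
Proof.
move=> C0 c0 fc nI; apply: snorm_le_tnorm => // t t0; rewrite patchE.
case: ifPn => [|/negP]; rewrite inE; first exact: fc.
by move=> /(nI t t0) ->; rewrite mule0.
Qed.

Definition blockwise (C : R) f x := forall t, 0 < t ->
  [/\ (0 <= f t)%E, (f t <= C%:E * (x (lg t))%:E)%E &
      ((x (lg t))%:E <= C%:E * f t)%E].

(** For [s <= t] the monotone equivalent of [t^(-e) g(t)] compares the two values,
    for [t <= s] that of [t^e g(t)]. *)
Lemma sv_quotient (g : R -> R) : slowly_varying g -> forall e, 0 < e ->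
  exists2 C : R, 0 < C & forall s t, 0 < s -> 0 < t ->
    g t <= C * expR (e * `|ln t - ln s|) * g s.
Proof.
move=> [_ g0 gsv] e e0; have [[u umono [C C0 uC]] [v vmono [D D0 vD]]] := gsv e e0.
exists (C * C + D * D) => [|s t s0 t0]; first by rewrite addr_gt0// mulr_gt0.
have ge0 := ltW (g0 s s0).
have pexp (a : R) (z : R) : 0 < z -> z `^ a = expR (a * ln z).
  by move=> z0; rewrite /powR gt_eqF.
have [st|ts] := leP s t.
  have [vt _] := vD t t0; have [_ vs] := vD s s0.
  have vst : v t <= v s by apply: vmono => //; rewrite inE /halfline/= in_itv/= andbT.
  have : t `^ (- e) * g t <= D * D * (s `^ (- e) * g s).
    apply: (le_trans vt); rewrite -mulrA ler_pM2l//; exact: le_trans vst vs.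
  rewrite ger0_norm ?subr_ge0 ?ler_ln// !pexp//.
  rewrite mulNr expRN mulrC ler_pdivrMr ?expR_gt0// => /le_trans; apply.
  have -> : D * D * (expR (- e * ln s) * g s) * expR (e * ln t) =
     D * D * expR (e * (ln t - ln s)) * g s.
    by rewrite mulrBr expRD mulNr; ring.
  by rewrite ler_wpM2r// ler_wpM2r ?expR_ge0// lerDr mulr_ge0 ?ltW.
have [ut _] := uC t t0; have [_ us] := uC s s0.
have uts : u t <= u s.
  by apply: umono; rewrite ?ltW// inE /halfline/= in_itv/= andbT.
have : t `^ e * g t <= C * C * (s `^ e * g s).
  apply: (le_trans ut); rewrite -mulrA ler_pM2l//; exact: le_trans uts us.
rewrite distrC ger0_norm ?subr_ge0 ?ler_ln ?(ltW ts)// !pexp//.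
rewrite mulrC -ler_pdivlMr ?expR_gt0// => /le_trans; apply.
have -> : C * C * (expR (e * ln s) * g s) / expR (e * ln t) =
   C * C * expR (e * (ln s - ln t)) * g s.
  by rewrite mulrBr expRD expRN; ring.
by rewrite ler_wpM2r// ler_wpM2r ?expR_ge0// lerDl mulr_ge0 ?ltW.
Qed.

Definition sample (g : R -> R) (n : int) : R := g (expR n%:~R).

Lemma growth_sample (g : R -> R) : slowly_varying g -> growth 0 (sample g).
Proof.
move=> gsv; have [_ g0 _] := gsv; split=> [n|e e0]; first exact/g0/expR_gt0.
have [C C0 gC] := sv_quotient gsv e0; exists C => // m n.
have := gC _ _ (expR_gt0 n%:~R) (expR_gt0 m%:~R).
by rewrite !expRK mul0r add0r rmorphB.
Qed.

Lemma sv_close (g : R -> R) (A : R) : slowly_varying g ->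
  exists2 C : R, 0 < C & forall s t, 0 < s -> 0 < t -> `|ln t - ln s| <= A ->
    g t <= C * g s.
Proof.
move=> gsv; have [_ g0 _] := gsv; have [C C0 gC] := sv_quotient gsv ltr01.
exists (C * expR A) => [|s t s0 t0 st]; first by rewrite mulr_gt0// expR_gt0.
apply: (le_trans (gC s t s0 t0)); rewrite ler_pM2r ?g0// ler_pM2l//.
by rewrite ler_expR mul1r.
Qed.

Lemma ln_lg (t : R) : `|ln t - ln (expR (lg t)%:~R)| <= 1.
Proof.
rewrite expRK; have /andP[h1 h2] := floor_itv (ln t); rewrite intrD in h2.
by rewrite ger0_norm; lra.
Qed.

Lemma sv_blockwise (g : R -> R) : slowly_varying g ->
  exists2 C : R, 0 < C & forall t, 0 < t ->
    g t <= C * sample g (lg t) /\ sample g (lg t) <= C * g t.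
Proof.
move=> gsv; have [C C0 gC] := sv_close 1 gsv; exists C => // t t0; split.
  by apply: gC => //; exact: ln_lg.
by apply: gC => //; rewrite distrC; exact: ln_lg.
Qed.

Section MixedBridge.
Variables (E F : ri_space R) (g : R -> R) (gsv : slowly_varying g).

Let g0 t : 0 < t -> 0 < g t. Proof. by have [_ + _] := gsv; apply. Qed.
Let gam0 k : 0 < sample g k. Proof. exact/g0/expR_gt0. Qed.
Let gam0' k : 0 <= sample g k. Proof. exact/ltW. Qed.

Lemma tnorm_on_ge0 G (I : set R) f : (0 <= tnorm_on G I f)%E.
Proof. exact: tnorm_ge0. Qed.

(** The order condition [Q] on blocks only has to contain, for the upper bound, or
    to be contained in, for the lower bound, the region of integration. The blocks
    that the region meets partially are recovered by translations below. *)
Lemma mixed_le_mix : exists2 A : R, 0 < A & forall (C : R) kap x (I : set R)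
    (J : R -> set R) (Q : rel int), 0 < C -> (forall k, 0 <= x k) ->
  blockwise C kap x ->
  (forall s t, 0 < s -> 0 < t -> I t -> J t s -> Q (lg t) (lg s)) ->
  (tnorm_on E I (fun t => (g t)%:E * tnorm_on F (J t) kap) <=
    (A * C)%:E * mix E F (sample g) x Q)%E.
Proof.
have [A A0 gA] := sv_blockwise gsv; exists A => // C kap x I J Q C0 x0 kx IJ.
apply: tnorm_on_le_snorm => [|k|t t0 It].
- by rewrite mulr_ge0// ltW.
- exact: mix_term_ge0.
split; first by rewrite mule_ge0 ?tnorm_on_ge0// lee_fin ltW// g0.
rewrite EFinM muleACA -EFinM; apply: lee_pmul.
- by rewrite lee_fin ltW// g0.
- exact: tnorm_on_ge0.
- by rewrite lee_fin; case: (gA t t0).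
apply: tnorm_on_le_snorm => [|k|s s0 Js]; [exact: ltW|exact: restr_ge0|].
by have [k0 ks _] := kx s s0; rewrite /restr IJ.
Qed.

Lemma mix_le_mixed : exists2 A : R, 0 < A & forall (C : R) kap x (I : set R)
    (J : R -> set R) (Q : rel int), 0 < C -> (forall k, 0 <= x k) ->
  blockwise C kap x ->
  (forall s t, 0 < s -> 0 < t -> I t -> Q (lg t) (lg s) -> J t s) ->
  (forall t k, 0 < t -> ~ I t -> ~~ Q (lg t) k) ->
  (mix E F (sample g) x Q <=
    (A * C)%:E * tnorm_on E I (fun t => (g t)%:E * tnorm_on F (J t) kap))%E.
Proof.
have [A A0 gA] := sv_blockwise gsv; exists A => // C kap x I J Q C0 x0 kx IJ nI.
apply: snorm_le_tnorm_on => [|k|t t0 It|t t0 nIt].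
- exact: mulr_gt0.
- exact: mix_term_ge0.
- rewrite EFinM muleACA -EFinM; apply: lee_pmul.
  + by rewrite lee_fin.
  + by apply: snorm_ge0; exact: restr_ge0.
  + by rewrite lee_fin; case: (gA t t0).
  apply: snorm_le_tnorm_on => [|k|s s0 Js|s s0 nJs] //; first exact: restr_ge0.
    have [k0 _ ks] := kx s s0; rewrite /restr; case: ifP => // _.
    by rewrite mule_ge0// lee_fin ltW.
  by rewrite /restr ifN//; apply/negP => Qts; apply: nJs; exact: IJ.
rewrite (_ : restr _ _ = fun=> 0%E) ?snorm0 ?mule0//.
by apply/funext => k; rewrite /restr ifN// nI.
Qed.

End MixedBridge.

Lemma mix_inner_shift E F b x (Q : rel int) (m : int) (D : R) :
  (forall k, 0 <= b k) -> (forall k, 0 <= x k) -> 0 <= D ->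
  (forall k, x k <= D * x (k + m)) ->
  (mix E F b x Q <= D%:E * mix E F b x (fun i k => Q i (k - m)%R))%E.
Proof.
move=> b0 x0 D0 xD; apply: le_snormZ => //; [exact: mix_term_ge0|
  by apply: (mix_term_ge0 F (fun i k => Q i (k - m)))|move=> i].
rewrite muleCA lee_wpmul2l ?lee_fin//.
rewrite -(snorm_shift F (- m)); last exact: restr_ge0.
apply: le_snormZ => // [k|k|]; [exact: restr_ge0|exact: restr_ge0|].
apply: (@le_restr _ (fun k => x (k - m)) x (fun k => Q i (k - m))) => // k Qk.
split => //.
by have := xD (k - m); rewrite subrK.
Qed.

Section NormBridge.
Variables (E F : ri_space R) (g : R -> R) (gsv : slowly_varying g).
Let gb := growth_sample gsv.
Let gam0 k : 0 <= sample g k. Proof. exact/ltW/gb.1. Qed.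

Lemma tnorm_onT G f : tnorm G f = tnorm_on G setT f.
Proof. by rewrite /tnorm_on patch_setT. Qed.

Definition quasi_const (D : R) x :=
  forall k, x (k + 1) <= D * x k /\ x k <= D * x (k + 1).

Lemma Rwhole_bridge (C D : R) : 0 < C -> 0 < D ->
  exists2 A : R, 0 < A & forall kap x, (forall k, 0 <= x k) ->
  blockwise C kap x -> quasi_const D x ->
  (tnorm E (fun t => (g t)%:E * tnorm_on F `]t, +oo[ kap) <=
    A%:E * mix E F (sample g) x (fun i k => (i <= k)%R))%E /\
  (mix E F (sample g) x (fun i k => (i <= k)%R) <=
    A%:E * tnorm E (fun t => (g t)%:E * tnorm_on F `]t, +oo[ kap))%E.
Proof.
move=> C0 D0; have [A A0 HA] := mixed_le_mix E F gsv.
have [B B0 HB] := mix_le_mixed E F gsv.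
exists (A * C + D * (B * C)) => [|kap x x0 kx qx]; first by rewrite addr_gt0// !mulr_gt0.
have AC0 : 0 <= A * C by rewrite mulr_ge0// ltW.
have DBC0 : 0 <= D * (B * C) by rewrite !mulr_ge0// ltW.
split.
  rewrite tnorm_onT; apply: le_trans (HA C _ x _ _ (fun i k => i <= k) C0 x0 kx _) _.
    move=> s t s0 t0 _ /=; rewrite in_itv/= andbT => ts.
    by apply: lg_mono => //; exact: ltW.
  by rewrite lee_wpmul2r ?mix_ge0// lee_fin lerDl.
apply: le_trans (mix_inner_shift E F (m := 1) _ gam0 x0 (ltW D0) _) _.
  by move=> k; case: (qx k).
rewrite tnorm_onT.
apply: (@le_trans _ _ (D%:E * ((B * C)%:E * tnorm_on E setT
    (fun t => (g t)%:E * tnorm_on F `]t, +oo[ kap)))%E).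
  rewrite lee_wpmul2l ?lee_fin ?(ltW D0)//; apply: HB => //.
    move=> s t s0 t0 _ ts /=; rewrite in_itv/= andbT; apply: lg_lt => //.
    by move: ts; lia.
  by move=> t k _ nT; case: nT.
by rewrite muleA -EFinM lee_wpmul2r ?tnorm_on_ge0// lee_fin lerDr.
Qed.

Lemma Lwhole_bridge (C D : R) : 0 < C -> 0 < D ->
  exists2 A : R, 0 < A & forall kap x, (forall k, 0 <= x k) ->
  blockwise C kap x -> quasi_const D x ->
  (tnorm E (fun t => (g t)%:E * tnorm_on F `]0%R, t[ kap) <=
    A%:E * mix E F (sample g) x (fun i k => (k <= i)%R))%E /\
  (mix E F (sample g) x (fun i k => (k <= i)%R) <=
    A%:E * tnorm E (fun t => (g t)%:E * tnorm_on F `]0%R, t[ kap))%E.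
Proof.
move=> C0 D0; have [A A0 HA] := mixed_le_mix E F gsv.
have [B B0 HB] := mix_le_mixed E F gsv.
exists (A * C + D * (B * C)) => [|kap x x0 kx qx]; first by rewrite addr_gt0// !mulr_gt0.
have AC0 : 0 <= A * C by rewrite mulr_ge0// ltW.
have DBC0 : 0 <= D * (B * C) by rewrite !mulr_ge0// ltW.
split.
  rewrite tnorm_onT; apply: le_trans (HA C _ x _ _ (fun i k => k <= i) C0 x0 kx _) _.
    move=> s t s0 t0 _ /=; rewrite in_itv/= s0/= => st.
    by apply: lg_mono => //; exact: ltW.
  by rewrite lee_wpmul2r ?mix_ge0// lee_fin lerDl.
apply: le_trans (mix_inner_shift E F (m := - 1) _ gam0 x0 (ltW D0) _) _.
  by move=> k; have := (qx (k - 1)).1; rewrite subrK.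
rewrite tnorm_onT.
apply: (@le_trans _ _ (D%:E * ((B * C)%:E * tnorm_on E setT
    (fun t => (g t)%:E * tnorm_on F `]0%R, t[ kap)))%E).
  rewrite lee_wpmul2l ?lee_fin ?(ltW D0)//; apply: HB => //.
    move=> s t s0 t0 _ ts /=; rewrite in_itv/= s0/=; apply: lg_lt => //.
    by move: ts; lia.
  by move=> t k _ nT; case: nT.
by rewrite muleA -EFinM lee_wpmul2r ?tnorm_on_ge0// lee_fin lerDr.
Qed.

(** The strict condition [i < k < n], which is all that the region contains, is
    reached from [i <= k < n] by lowering [n] by one and then shifting the inner
    index by one. *)
Lemma Rhead_bridge (C D : R) : 0 < C -> 0 < D ->
  exists2 A : R, 0 < A & forall kap x u, (forall k, 0 <= x k) ->
  blockwise C kap x -> quasi_const D x -> 0 < u ->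
  (tnorm_on E `]0%R, u[ (fun t => (g t)%:E * tnorm_on F `]t, u[ kap) <=
    A%:E * mix E F (sample g) x (fun i k => (i <= k) && (k < lg u))%R)%E /\
  (mix E F (sample g) x (fun i k => (i <= k) && (k < lg u))%R <=
    A%:E * tnorm_on E `]0%R, u[ (fun t => (g t)%:E * tnorm_on F `]t, u[ kap))%E.
Proof.
move=> C0 D0; have [A A0 HA] := mixed_le_mix E F gsv.
have [B B0 HB] := mix_le_mixed E F gsv.
have [M M0 HM] := mix_quasi_const E F gb.
exists (A * C * (M * D) + M * D * (D * (B * C))) => [|kap x u x0 kx qx u0].
  by rewrite addr_gt0// !mulr_gt0.
have AC0 : 0 <= A * C by rewrite mulr_ge0// ltW.
have MD0 : 0 <= M * D by rewrite mulr_ge0// ltW.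
have DBC0 : 0 <= D * (B * C) by rewrite !mulr_ge0// ltW.
have HMx n := HM x D n x0 (ltW D0) (fun k => (qx k).1).
split.
  apply: le_trans (HA C _ x _ _ (fun i k => (i <= k) && (k < lg u + 1)) C0 x0 kx _) _.
    move=> s t s0 t0 _ /=; rewrite in_itv/= => /andP[ts su].
    by rewrite ltzD1 !lg_mono//; exact: ltW.
  apply: le_trans (lee_wpmul2l _ (HMx (lg u))) _; first by rewrite lee_fin.
  by rewrite muleA -EFinM lee_wpmul2r ?mix_ge0// lee_fin lerDl mulr_ge0.
have := HMx (lg u - 1); rewrite subrK => /le_trans; apply.
apply: (@le_trans _ _ ((M * D)%:E * (D%:E * ((B * C)%:E * tnorm_on E `]0%R, u[
    (fun t => (g t)%:E * tnorm_on F `]t, u[ kap))))%E).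
  rewrite lee_wpmul2l ?lee_fin//.
  apply: le_trans (mix_inner_shift E F (m := 1) _ gam0 x0 (ltW D0) _) _.
    by move=> k; case: (qx k).
  rewrite lee_wpmul2l ?lee_fin ?(ltW D0)//; apply: HB => //.
    move=> s t s0 t0 _ ts /=; rewrite in_itv/=; apply/andP.
    by split; apply: lg_lt => //; move: ts; move: (lg s) (lg t) (lg u) => p q r; clear; lia.
  move=> t k t0 /=; rewrite in_itv/= t0/= => /negP; rewrite -leNgt => ut.
  by move: (lg_mono u0 ut); move: (lg t) (lg u) => p q; clear; lia.
by rewrite !muleA -!EFinM lee_wpmul2r ?tnorm_on_ge0// lee_fin -mulrA lerDr mulr_ge0.
Qed.

Lemma Ltail_bridge (C D : R) : 0 < C -> 0 < D ->
  exists2 A : R, 0 < A & forall kap x u, (forall k, 0 <= x k) ->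
  blockwise C kap x -> quasi_const D x -> 0 < u ->
  (tnorm_on E `]u, +oo[ (fun t => (g t)%:E * tnorm_on F `]u, t[ kap) <=
    A%:E * mix E F (sample g) x (fun i k => (lg u < k) && (k <= i))%R)%E /\
  (mix E F (sample g) x (fun i k => (lg u < k) && (k <= i))%R <=
    A%:E * tnorm_on E `]u, +oo[ (fun t => (g t)%:E * tnorm_on F `]u, t[ kap))%E.
Proof.
move=> C0 D0; have [A A0 HA] := mixed_le_mix E F gsv.
have [B B0 HB] := mix_le_mixed E F gsv.
have [M M0 HM] := mix_tail_quasi_const E F gb.
exists (A * C * (M * D) + M * D * (D * (B * C))) => [|kap x u x0 kx qx u0].
  by rewrite addr_gt0// !mulr_gt0.
have AC0 : 0 <= A * C by rewrite mulr_ge0// ltW.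
have MD0 : 0 <= M * D by rewrite mulr_ge0// ltW.
have DBC0 : 0 <= D * (B * C) by rewrite !mulr_ge0// ltW.
have qx' k : x (k - 1) <= D * x k by have := (qx (k - 1)).2; rewrite subrK.
have HMx n := HM x D n x0 (ltW D0) qx'.
split.
  apply: le_trans (HA C _ x _ _ (fun i k => (lg u - 1 < k) && (k <= i)) C0 x0 kx _) _.
    move=> s t s0 t0 _ /=; rewrite in_itv/= => /andP[us st].
    by rewrite ltrBlDr ltzD1 !lg_mono//; exact: ltW.
  apply: le_trans (lee_wpmul2l _ (HMx (lg u))) _; first by rewrite lee_fin.
  by rewrite muleA -EFinM lee_wpmul2r ?mix_ge0// lee_fin lerDl mulr_ge0.
have := HMx (lg u + 1); rewrite addrK => /le_trans; apply.
apply: (@le_trans _ _ ((M * D)%:E * (D%:E * ((B * C)%:E * tnorm_on E `]u, +oo[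
    (fun t => (g t)%:E * tnorm_on F `]u, t[ kap))))%E).
  rewrite lee_wpmul2l ?lee_fin//.
  apply: le_trans (mix_inner_shift E F (m := - 1) _ gam0 x0 (ltW D0) _) _.
    by move=> k; have := (qx (k - 1)).1; rewrite subrK.
  rewrite lee_wpmul2l ?lee_fin ?(ltW D0)//; apply: HB => //.
    move=> s t s0 t0 _ ts /=; rewrite in_itv/=; apply/andP.
    by split; apply: lg_lt => //; move: ts; move: (lg s) (lg t) (lg u) => p q r; clear; lia.
  move=> t k t0 /=; rewrite in_itv/= andbT => /negP; rewrite -leNgt => tu.
  by move: (lg_mono t0 tu); move: (lg t) (lg u) => p q; clear; lia.
by rewrite !muleA -!EFinM lee_wpmul2r ?tnorm_on_ge0// lee_fin -mulrA lerDr mulr_ge0.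
Qed.

End NormBridge.

End Bridge.

(** * Weights and the function rho *)

Section RealBlocks.
Context {R : realType}.
Implicit Types (E F : ri_space R) (g h rho : R -> R) (v w r s : int -> R).

Local Notation lg t := (Num.floor (ln t)).

Definition sampled h v := exists2 C : R, 0 < C & forall t, 0 < t ->
  [/\ 0 < h t, h t <= C * v (lg t) & v (lg t) <= C * h t].

Lemma sampled_sv g : slowly_varying g -> sampled g (sample g).
Proof.
move=> gsv; have [_ g0 _] := gsv; have [C C0 gC] := sv_blockwise gsv.
by exists C => // t t0; have [? ?] := gC t t0; rewrite g0.
Qed.

Lemma sampledM h h' v v' : sampled h v -> sampled h' v' ->
  sampled (fun t => h t * h' t) (fun n => v n * v' n).
Proof.
move=> [C C0 hC] [D D0 hD]; exists (C * D) => [|t t0]; first exact: mulr_gt0.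
have [h1 h2 h3] := hC t t0; have [k1 k2 k3] := hD t t0.
have v0 : 0 <= v (lg t) by rewrite -(pmulr_rge0 _ C0) (le_trans (ltW h1)).
have v'0 : 0 <= v' (lg t) by rewrite -(pmulr_rge0 _ D0) (le_trans (ltW k1)).
by split; [exact: mulr_gt0|rewrite mulrACA ler_pM// ltW..].
Qed.

Lemma sampledV h v : sampled h v -> sampled (fun t => (h t)^-1) (fun n => (v n)^-1).
Proof.
move=> [C C0 hC]; exists C => // t t0; have [h1 h2 h3] := hC t t0.
have v0 : 0 < v (lg t) by rewrite -(pmulr_rgt0 _ C0) (lt_le_trans h1).
by split; rewrite ?invr_gt0// ler_pdivlMr// mulrC ler_pdivrMr// mulrC.
Qed.

Lemma sampled_powR h v (a : R) : 0 <= a -> sampled h v ->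
  sampled (fun t => h t `^ a) (fun n => v n `^ a).
Proof.
move=> a0 [C C0 hC]; exists (C `^ a) => [|t t0]; first exact: powR_gt0.
have [h1 h2 h3] := hC t t0.
have v0 : 0 <= v (lg t) by rewrite -(pmulr_rge0 _ C0) (le_trans (ltW h1)).
split; first exact: powR_gt0.
  rewrite -powRM ?(ltW C0)//; apply: ge0_ler_powR => //.
    by rewrite nnegrE ltW.
  by rewrite nnegrE mulr_ge0// ltW.
rewrite -powRM ?(ltW C0) ?(ltW h1)//; apply: ge0_ler_powR => //.
by rewrite nnegrE mulr_ge0// ltW.
Qed.

Lemma powR_expR_ln (t a : R) : 0 < t -> t `^ a = expR (a * ln t).
Proof. by move=> t0; rewrite /powR gt_eqF. Qed.

Lemma sampled_power (a : R) : sampled (fun t => t `^ a) (fun n => expR (a * n%:~R)).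
Proof.
exists (expR `|a|) => [|t t0]; first exact: expR_gt0.
have := ln_lg t; rewrite expRK powR_expR_ln// => d1.
have ad : `|a * (ln t - (lg t)%:~R)| <= `|a|.
  by rewrite normrM -[leRHS]mulr1 ler_wpM2l.
move: ad; rewrite ler_norml mulrBr => /andP[ad1 ad2].
split; first exact: expR_gt0.
  by rewrite -expRD ler_expR; lra.
by rewrite -expRD ler_expR; lra.
Qed.

(** The values [rho t] and [r (lg t)] have logarithms at a bounded distance, and a
    slowly varying function does not distinguish them. *)
Lemma sampled_comp g rho r : slowly_varying g -> sampled rho r ->
  sampled (g \o rho) (fun n => sample g (level r n)).
Proof.
move=> gsv [C C0 rC]; have [_ g0 _] := gsv.
have [D D0 gD] := sv_close (ln C + 1) gsv; exists D => // t t0.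
have [r1 r2 r3] := rC t t0.
have v0 : 0 < r (lg t) by rewrite -(pmulr_rgt0 _ C0) (lt_le_trans r1).
have d1 : ln (rho t) <= ln C + ln (r (lg t)).
  by rewrite -lnM ?posrE// ler_ln ?posrE// mulr_gt0.
have d2 : ln (r (lg t)) <= ln C + ln (rho t).
  by rewrite -lnM ?posrE// ler_ln ?posrE// mulr_gt0.
have := ln_lg (r (lg t)); rewrite expRK ler_norml => /andP[d3 d4].
have d5 : `|ln (rho t) - ln (expR (level r (lg t))%:~R)| <= ln C + 1.
  by rewrite expRK /level ler_norml; apply/andP; split; lra.
split; first exact: g0.
  by apply: gD => //; exact: expR_gt0.
by apply: gD; rewrite ?expR_gt0// distrC.
Qed.

(** The level is Lipschitz up to a constant, so that a small exponential rate in
    the level is a small rate in the index. *)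
Lemma growth_comp g r (d : R) : slowly_varying g -> growth d r ->
  growth 0 (fun n => sample g (level r n)).
Proof.
move=> gsv gr; have [_ g0 _] := gsv.
split=> [n|e e0]; first exact/g0/expR_gt0.
have [K K0 rK] := growth_ln ltr01 gr.
pose A := `|d| + 1.
have A0 : 0 < A by rewrite ltr_wpDl.
have [|C C0 gC] := sv_quotient gsv (e := e / A); first exact: divr_gt0.
exists (C * expR (e / A * (K + 1))) => [|m n]; first by rewrite mulr_gt0// expR_gt0.
have half (p q : int) : (level r p)%:~R - (level r q)%:~R <= K + 1 + A * `|(p - q)%:~R| :> R.
  have /andP[h1 h2] := floor_itv (ln (r p)); have /andP[h3 h4] := floor_itv (ln (r q)).
  rewrite -/(level r p) in h1 h2; rewrite -/(level r q) in h3 h4.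
  rewrite !intrD in h2 h4.
  have h5 := rK p q.
  have h6 : d * (p - q)%:~R <= `|d| * `|(p - q)%:~R|.
    by rewrite -normrM ler_norm.
  rewrite /A mulrDl; lra.
have lev : `|(level r m)%:~R - (level r n)%:~R| <= K + 1 + A * `|(m - n)%:~R| :> R.
  rewrite ler_norml lerNl opprB half andbT.
  by have := half n m; rewrite -[n - m]opprB rmorphN/= normrN.
apply: (le_trans (gC _ _ (expR_gt0 (level r n)%:~R) (expR_gt0 (level r m)%:~R))).
apply: ler_wpM2r; first exact/ltW/g0/expR_gt0.
rewrite !expRK -mulrA ler_pM2l// -expRD ler_expR.
rewrite mul0r add0r; apply: (@le_trans _ _ (e / A * (K + 1 + A * `|(m - n)%:~R|))).
  by rewrite ler_wpM2l// ltW// divr_gt0.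
by rewrite mulrDr lerD2l mulrA divfK// gt_eqF.
Qed.

Section Alow.
Variables (E : ri_space R) (a b : R -> R).
Hypotheses (asv : slowly_varying a) (bsv : slowly_varying b).

Let b0 k : 0 <= sample b k. Proof. exact/ltW/(growth_sample bsv).1. Qed.

Lemma head_norm_exists :
  (tnorm_on E `]0%R, 1%R[ (fun t => (b t)%:E) < +oo)%E ->
  exists s, head_norm E (sample b) s.
Proof.
move=> fin; have [C C0 bC] := sv_blockwise bsv.
have fin0 : (snorm E (restr (sample b) (fun i => i < 0)%R) < +oo)%E.
  apply: (@le_lt_trans _ _ (C%:E * tnorm_on E `]0%R, 1%R[ (fun t => (b t)%:E))%E).
    apply: snorm_le_tnorm_on => // [k|t t0 _|t t0 nt]; first exact: restr_ge0.
      rewrite -EFinM /restr; case: ifP => _; first by rewrite lee_fin; case: (bC t t0).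
      by rewrite lee_fin mulr_ge0 ?ltW//; have [_ + _] := bsv; apply.
    rewrite /restr ifN// -leNgt floor_ge_int/= ln_ge0// leNgt; apply/negP => t1.
    by apply: nt; rewrite /= in_itv/= t0.
  by rewrite lte_mul_pinfty// lee_fin ltW.
exists (fun n => fine (snorm E (restr (sample b) (fun i => i < n)%R))) => n.
rewrite fineK// ge0_fin_numE; last by apply: snorm_ge0; exact: restr_ge0.
have [D D0 bD] := growth_shift n (growth_sample bsv).
apply: (@le_lt_trans _ _ (D%:E * snorm E (restr (sample b) (fun i => i < 0)%R))%E).
  rewrite -(snorm_shift E n) ?restr_shift; last exact: restr_ge0.
  apply: le_snormZ; [exact: ltW|by apply: restr_ge0..|].
  by apply: le_restr => //; [exact: ltW|move=> k; rewrite gtrDr].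
by rewrite lte_mul_pinfty// lee_fin ltW.
Qed.

Lemma sampled_Alow s : head_norm E (sample b) s ->
  sampled (Alow a b E) (fun n => sample a n * s n).
Proof.
move=> hs; have gb := growth_sample bsv; apply: sampledM; first exact: sampled_sv.
have [C C0 bC] := sv_blockwise bsv.
have [D D0 sD] := growth_shift 1 (growth_head_norm gb hs).
exists (C * D + C) => [|u u0]; first by rewrite addr_gt0// mulr_gt0.
have s0 := head_norm_gt0 gb hs.
set N := tnorm_on E _ _.
have up : (N <= (C * s (lg u + 1))%:E)%E.
  rewrite EFinM -hs; apply: tnorm_on_le_snorm => [|k|t t0]; first exact: ltW.
    exact: restr_ge0.
  rewrite /= in_itv/= => /andP[_ tu]; split.
    by rewrite lee_fin ltW//; have [_ + _] := bsv; apply.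
  rewrite /restr ltzD1 lg_mono//; last exact: ltW.
  by rewrite -EFinM lee_fin; case: (bC t t0).
have lo : ((s (lg u))%:E <= C%:E * N)%E.
  rewrite -hs; apply: snorm_le_tnorm_on => // [k|t t0 _|t t0 nt]; first exact: restr_ge0.
    rewrite -EFinM /restr; case: ifP => _; first by rewrite lee_fin; case: (bC t t0).
    by rewrite lee_fin mulr_ge0 ?ltW//; have [_ + _] := bsv; apply.
  rewrite /restr ifN// -leNgt; apply: lg_mono => //; rewrite leNgt; apply/negP => tu.
  by apply: nt; rewrite /= in_itv/= t0.
have Nfin : N \is a fin_num.
  by rewrite ge0_fin_numE ?tnorm_on_ge0//; apply: le_lt_trans up _; rewrite ltry.
rewrite -(fineK Nfin) -EFinM !lee_fin in up lo.
have N0 : 0 < fine N by rewrite -(pmulr_rgt0 _ C0); exact: lt_le_trans lo.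
split => //.
  apply: (le_trans up); rewrite mulrDl -mulrA -[leLHS]addr0.
  rewrite lerD ?mulr_ge0 ?(ltW C0) ?(ltW (s0 _))//.
  by rewrite ler_pM2l.
by apply: (le_trans lo); rewrite ler_pM2r// lerDr mulr_ge0// ltW.
Qed.

Lemma tail_norm_exists :
  (tnorm_on E `]1%R, +oo[ (fun t => (b t)%:E) < +oo)%E ->
  exists s, tail_norm E (sample b) s.
Proof.
move=> fin; have [C C0 bC] := sv_blockwise bsv.
have fin0 : (snorm E (restr (sample b) (fun i => 0 < i)%R) < +oo)%E.
  apply: (@le_lt_trans _ _ (C%:E * tnorm_on E `]1%R, +oo[ (fun t => (b t)%:E))%E).
    apply: snorm_le_tnorm_on => // [k|t t0 _|t t0 nt]; first exact: restr_ge0.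
      rewrite -EFinM /restr; case: ifP => _; first by rewrite lee_fin; case: (bC t t0).
      by rewrite lee_fin mulr_ge0 ?ltW//; have [_ + _] := bsv; apply.
    rewrite /restr ifN// -leNgt; have := @lg_mono R t 1 t0; rewrite ln1 floor0.
    apply; rewrite leNgt; apply/negP => t1.
    by apply: nt; rewrite /= in_itv/= t1.
  by rewrite lte_mul_pinfty// lee_fin ltW.
exists (fun n => fine (snorm E (restr (sample b) (fun i => n < i)%R))) => n.
rewrite fineK// ge0_fin_numE; last by apply: snorm_ge0; exact: restr_ge0.
have [D D0 bD] := growth_shift n (growth_sample bsv).
apply: (@le_lt_trans _ _ (D%:E * snorm E (restr (sample b) (fun i => 0 < i)%R))%E).
  rewrite -(snorm_shift E n) ?restr_shift; last exact: restr_ge0.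
  apply: le_snormZ; [exact: ltW|by apply: restr_ge0..|].
  by apply: le_restr => //; [exact: ltW|move=> k; rewrite ltrDr].
by rewrite lte_mul_pinfty// lee_fin ltW.
Qed.

Lemma sampled_Ahigh s : tail_norm E (sample b) s ->
  sampled (Ahigh a b E) (fun n => sample a n * s n).
Proof.
move=> hs; have gb := growth_sample bsv; apply: sampledM; first exact: sampled_sv.
have [C C0 bC] := sv_blockwise bsv.
have [D D0 sD] := growth_shift (- 1) (growth_tail_norm gb hs).
exists (C * D + C) => [|u u0]; first by rewrite addr_gt0// mulr_gt0.
have s0 := tail_norm_gt0 gb hs.
set N := tnorm_on E _ _.
have up : (N <= (C * s (lg u - 1))%:E)%E.
  rewrite EFinM -hs; apply: tnorm_on_le_snorm => [|k|t t0]; first exact: ltW.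
    exact: restr_ge0.
  rewrite /= in_itv/= andbT => ut; split.
    by rewrite lee_fin ltW//; have [_ + _] := bsv; apply.
  rewrite /restr ltrBlDr ltzD1 lg_mono//; last exact: ltW.
  by rewrite -EFinM lee_fin; case: (bC t t0).
have lo : ((s (lg u))%:E <= C%:E * N)%E.
  rewrite -hs; apply: snorm_le_tnorm_on => // [k|t t0 _|t t0 nt]; first exact: restr_ge0.
    rewrite -EFinM /restr; case: ifP => _; first by rewrite lee_fin; case: (bC t t0).
    by rewrite lee_fin mulr_ge0 ?ltW//; have [_ + _] := bsv; apply.
  rewrite /restr ifN// -leNgt; apply: lg_mono => //; rewrite leNgt; apply/negP => tu.
  by apply: nt; rewrite /= in_itv/= tu.
have Nfin : N \is a fin_num.
  by rewrite ge0_fin_numE ?tnorm_on_ge0//; apply: le_lt_trans up _; rewrite ltry.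
rewrite -(fineK Nfin) -EFinM !lee_fin in up lo.
have N0 : 0 < fine N by rewrite -(pmulr_rgt0 _ C0); exact: lt_le_trans lo.
split => //.
  apply: (le_trans up); rewrite mulrDl -mulrA -[leLHS]addr0.
  rewrite lerD ?mulr_ge0 ?(ltW C0) ?(ltW (s0 _))//.
  by rewrite ler_pM2l.
by apply: (le_trans lo); rewrite ler_pM2r// lerDr mulr_ge0// ltW.
Qed.

End Alow.
End RealBlocks.

(** * The K-functional *)

Section KFunctional.
Context {R : realType} {V : lmodType R}.
Implicit Types (N X : V -> \bar R) (f g : V).

Section Nonneg.
Variables N0 N1 : V -> \bar R.
Hypotheses (N0_ge0 : forall f, (0 <= N0 f)%E) (N1_ge0 : forall f, (0 <= N1 f)%E).

Lemma Kfun_ge0 f t : 0 <= t -> (0 <= Kfun N0 N1 f t)%E.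
Proof.
move=> t0; apply: le_ereal_inf_tmp => _ [f0 [f1 [_ _ _ ->]]].
by rewrite adde_ge0// mule_ge0.
Qed.

Lemma Kfun_le f f0 f1 t : (N0 f0 < +oo)%E -> (N1 f1 < +oo)%E -> f = f0 + f1 ->
  (Kfun N0 N1 f t <= N0 f0 + t%:E * N1 f1)%E.
Proof. by move=> h0 h1 fE; apply: ereal_inf_lbound; exists f0, f1. Qed.

Lemma Kfun_mono f s t : 0 <= s -> s <= t -> (Kfun N0 N1 f s <= Kfun N0 N1 f t)%E.
Proof.
move=> s0 st; apply: le_ereal_inf_tmp => _ [f0 [f1 [h0 h1 fE ->]]].
by apply: (le_trans (Kfun_le _ h0 h1 fE)); rewrite leeD2l// lee_wpmul2r// lee_fin.
Qed.

Lemma Kfun_dilate f s t : 0 < s -> s <= t ->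
  (Kfun N0 N1 f t <= (t / s)%:E * Kfun N0 N1 f s)%E.
Proof.
move=> s0 st; have t0 : 0 < t by exact: lt_le_trans st.
have ts0 : 0 < t / s by rewrite divr_gt0.
rewrite -lee_pdivrMl//; apply: le_ereal_inf_tmp => _ [f0 [f1 [h0 h1 fE ->]]].
rewrite lee_pdivrMl//; apply: (le_trans (Kfun_le _ h0 h1 fE)).
rewrite ge0_muleDr// ?mule_ge0 ?lee_fin ?(ltW s0)//.
rewrite muleA -EFinM divfK ?gt_eqF// leeD2r// -[leLHS]mul1e lee_wpmul2r// lee_fin.
by rewrite ler_pdivlMr// mul1r.
Qed.

Lemma Kfun_lty f t : in_sum N0 N1 f -> (Kfun N0 N1 f t < +oo)%E.
Proof.
move=> [f0 [f1 [h0 h1 fE]]]; apply: (le_lt_trans (Kfun_le t h0 h1 fE)).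
have n0 : N0 f0 \is a fin_num by rewrite ge0_fin_numE.
have n1 : N1 f1 \is a fin_num by rewrite ge0_fin_numE.
by rewrite -(fineK n0) -(fineK n1) -EFinM -EFinD ltry.
Qed.

Definition Kseq f (n : int) : R := fine (Kfun N0 N1 f (expR n%:~R)).

Lemma KseqE f n : in_sum N0 N1 f -> Kfun N0 N1 f (expR n%:~R) = (Kseq f n)%:E.
Proof.
by move=> fs; rewrite /Kseq fineK// ge0_fin_numE ?Kfun_lty ?Kfun_ge0 ?expR_ge0.
Qed.

Lemma Kseq_ge0 f n : 0 <= Kseq f n.
Proof. by rewrite fine_ge0// Kfun_ge0// expR_ge0. Qed.

Lemma Kseq_mono f m n : in_sum N0 N1 f -> m <= n -> Kseq f m <= Kseq f n.
Proof.
move=> fs mn; rewrite -lee_fin -!KseqE//; apply: Kfun_mono; first exact: expR_ge0.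
by rewrite ler_expR ler_int.
Qed.

Lemma Kseq_dilate f m n : in_sum N0 N1 f -> m <= n ->
  expR (m - n)%:~R * Kseq f n <= Kseq f m.
Proof.
move=> fs mn; rewrite -[m - n]opprB rmorphN/= expRN ler_pdivrMl ?expR_gt0//.
rewrite -lee_fin EFinM -!KseqE// rmorphB/= expRD expRN.
by apply: Kfun_dilate; rewrite ?expR_gt0// ler_expR ler_int.
Qed.

Lemma Kfun_blockwise h v : sampled h v ->
  exists2 C : R, 0 < C & forall f, in_sum N0 N1 f ->
    blockwise C (fun t => (h t)%:E * Kfun N0 N1 f t)%E (fun n => v n * Kseq f n).
Proof.
move=> [C C0 hC]; exists (C * expR 1) => [|f fs t t0].
  by rewrite mulr_gt0// expR_gt0.
have [h1 h2 h3] := hC t t0; set n := Num.floor (ln t).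
have v0 : 0 <= v n by rewrite -(pmulr_rge0 _ C0) (le_trans (ltW h1)).
have K0 := Kfun_ge0 f (ltW t0).
have lo : ((Kseq f n)%:E <= Kfun N0 N1 f t)%E.
  by rewrite -KseqE//; apply: Kfun_mono; [exact: expR_ge0|exact: expR_lg_le].
have up : (Kfun N0 N1 f t <= (expR 1 * Kseq f n)%:E)%E.
  rewrite EFinM -KseqE//; apply: le_trans (Kfun_dilate f (expR_gt0 _) (expR_lg_le t0)) _.
  rewrite lee_wpmul2r ?Kfun_ge0 ?expR_ge0// lee_fin ler_pdivrMr ?expR_gt0//.
  exact/ltW/expR_lg_gt.
split.
- by rewrite mule_ge0// lee_fin ltW.
- rewrite -EFinM; have -> : C * expR 1 * (v n * Kseq f n) =
    C * v n * (expR 1 * Kseq f n) by ring.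
  by rewrite EFinM; apply: lee_pmul; rewrite ?lee_fin// ltW.
- rewrite !EFinM muleACA; apply: lee_pmul; rewrite ?lee_fin ?Kseq_ge0//.
  apply: (le_trans lo); rewrite -[leLHS]mul1e lee_wpmul2r// lee_fin.
  by rewrite -expR0 ler_expR.
Qed.

Lemma quasi_const_Kseq (d : R) w : growth d w ->
  exists2 D : R, 0 < D & forall f, in_sum N0 N1 f ->
    quasi_const D (fun n => w n * Kseq f n).
Proof.
move=> gw; have w0 := gw.1; have [A A0 wA] := growth_shift 1 gw.
have [B B0 wB] := growth_shift (- 1) gw.
have e1 : 1 <= expR 1 :> R by rewrite -[leLHS]expR0 ler_expR.
exists (A * expR 1 + B) => [|f fs k]; first by rewrite addr_gt0// mulr_gt0// expR_gt0.
have K0 := Kseq_ge0 f.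
have K1 : Kseq f (k + 1) <= expR 1 * Kseq f k.
  have := @Kseq_dilate f k (k + 1) fs; rewrite lerDl => /(_ isT).
  rewrite opprD addrA subrr add0r expRN mulrC ler_pdivrMr ?expR_gt0// => h.
  by rewrite mulrC.
have K2 : Kseq f k <= Kseq f (k + 1) by apply: Kseq_mono => //; rewrite lerDl.
have nA : 0 <= A * expR 1 by rewrite mulr_ge0 ?expR_ge0// ltW.
have wK n : 0 <= w n * Kseq f n by rewrite mulr_ge0// ltW.
split.
  apply: (@le_trans _ _ (A * expR 1 * (w k * Kseq f k))).
    rewrite -mulrACA; apply: ler_pM => //; exact: ltW.
  by rewrite ler_wpM2r// lerDl ltW.
have := wB (k + 1); rewrite addrK => wBk.
apply: (@le_trans _ _ (B * (w (k + 1) * Kseq f (k + 1)))).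
  by rewrite mulrA; apply: ler_pM => //; exact: ltW.
by rewrite ler_wpM2r// lerDr.
Qed.

End Nonneg.

(** The part of the structure of a quasi-Banach space that the K-functional
    sees. *)
Record quasi_norm X : Prop := {
  qn_ge0 : forall f, (0 <= X f)%E;
  qn_0 : X 0 = 0%E;
  qn_N : forall f, X (- f) = X f;
  qn_D : exists2 C : R, 0 < C &
    forall f g, (X (f + g)%R <= C%:E * (X f + X g))%E }.

Section Couple.
Variables X0 X1 : V -> \bar R.
Hypotheses (q0 : quasi_norm X0) (q1 : quasi_norm X1).
Let X0_ge0 := qn_ge0 q0.
Let X1_ge0 := qn_ge0 q1.

Lemma quasi_norm_addlty X f g : quasi_norm X -> (X f < +oo)%E -> (X g < +oo)%E ->
  (X (f + g)%R < +oo)%E.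
Proof.
move=> q fX gX; have [C C0 XC] := qn_D q; apply: (le_lt_trans (XC f g)).
by rewrite lte_mul_pinfty ?lee_fin ?(ltW C0)// lte_add_pinfty.
Qed.

Lemma in_sumD f g : in_sum X0 X1 f -> in_sum X0 X1 g -> in_sum X0 X1 (f + g).
Proof.
move=> [f0 [f1 [h0 h1 ->]]] [g0 [g1 [k0 k1 ->]]].
exists (f0 + g0), (f1 + g1); split; try exact: quasi_norm_addlty.
by rewrite addrACA.
Qed.

Lemma in_sumN f : in_sum X0 X1 f -> in_sum X0 X1 (- f).
Proof.
move=> [f0 [f1 [h0 h1 ->]]]; exists (- f0), (- f1).
by rewrite (qn_N q0) (qn_N q1) opprD.
Qed.

Lemma in_sum_l f : (X0 f < +oo)%E -> in_sum X0 X1 f.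
Proof. by move=> fX; exists f, 0; rewrite (qn_0 q1) addr0 ltry. Qed.

Lemma in_sum_r f : (X1 f < +oo)%E -> in_sum X0 X1 f.
Proof. by move=> fX; exists 0, f; rewrite (qn_0 q0) add0r ltry. Qed.

Lemma KfunN f t : Kfun X0 X1 (- f) t = Kfun X0 X1 f t.
Proof.
have le g : (Kfun X0 X1 (- g)%R t <= Kfun X0 X1 g t)%E.
  apply: le_ereal_inf_tmp => _ [f0 [f1 [h0 h1 -> ->]]].
  rewrite -(qn_N q0) -(qn_N q1); apply: Kfun_le; rewrite ?qn_N//.
  by rewrite opprD.
by apply/eqP; rewrite eq_le le/= -{1}(opprK f) le.
Qed.

Lemma KfunD : exists2 C : R, 0 < C & forall f g t, 0 < t ->
  in_sum X0 X1 f -> in_sum X0 X1 g ->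
  (Kfun X0 X1 (f + g)%R t <= C%:E * (Kfun X0 X1 f t + Kfun X0 X1 g t))%E.
Proof.
have [C0 C00 XC0] := qn_D q0; have [C1 C10 XC1] := qn_D q1.
pose C := C0 + C1; have C_gt0 : 0 < C by rewrite addr_gt0.
exists C => // f g t t0 fs gs.
have Kfin h : in_sum X0 X1 h -> Kfun X0 X1 h t \is a fin_num.
  by move=> hs; rewrite ge0_fin_numE ?Kfun_lty// Kfun_ge0// ltW.
apply/lee_addgt0Pr => e e0.
have e2 : 0 < e / (2 * C) by rewrite divr_gt0// mulr_gt0.
have near h : in_sum X0 X1 h -> exists h0 h1, [/\ (X0 h0 < +oo)%E, (X1 h1 < +oo)%E,
    h = h0 + h1 & (X0 h0 + t%:E * X1 h1 <= Kfun X0 X1 h t + (e / (2 * C))%:E)%E].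
  move=> hs.
  have : (Kfun X0 X1 h t < Kfun X0 X1 h t + (e / (2 * C))%:E)%E.
    by rewrite lteDl ?Kfin// lte_fin.
  move=> /ereal_inf_lt[_ [h0 [h1 [n0 n1 hE ->]]] lt].
  by exists h0, h1; split => //; exact: ltW.
have [f0 [f1 [n0 n1 fE lf]]] := near f fs; have [g0 [g1 [m0 m1 gE lg]]] := near g gs.
apply: (@le_trans _ _ (X0 (f0 + g0)%R + t%:E * X1 (f1 + g1)%R)%E).
  apply: Kfun_le; [exact: quasi_norm_addlty..|by rewrite fE gE addrACA].
apply: (@le_trans _ _ (C%:E * ((X0 f0 + t%:E * X1 f1) + (X0 g0 + t%:E * X1 g1)))%E).
  have eqt : (t%:E * X1 f1 + t%:E * X1 g1 = t%:E * (X1 f1 + X1 g1))%E.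
    by rewrite ge0_muleDr.
  have s1 : (0 <= t%:E * (X1 f1 + X1 g1))%E.
    by rewrite mule_ge0 ?adde_ge0// lee_fin ltW.
  rewrite addeACA eqt [leRHS]ge0_muleDr ?adde_ge0//.
  apply: leeD.
    apply: (le_trans (XC0 _ _)); rewrite lee_wpmul2r ?adde_ge0// lee_fin lerDl ltW//.
  rewrite muleCA lee_wpmul2l ?lee_fin ?(ltW t0)//.
  by apply: (le_trans (XC1 _ _)); rewrite lee_wpmul2r ?adde_ge0// lee_fin lerDr ltW.
apply: (le_trans (lee_wpmul2l _ (leeD lf lg))); first by rewrite lee_fin ltW.
rewrite -(fineK (Kfin _ fs)) -(fineK (Kfin _ gs)) -!(EFinD, EFinM) lee_fin.
rewrite le_eqVlt; apply/orP; left; apply/eqP; field.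
by rewrite gt_eqF.
Qed.

End Couple.
End KFunctional.

(** * Near-optimal decompositions *)

Section NearOptimal.
Context {R : realType} {V : lmodType R}.
Variables X0 X1 : V -> \bar R.
Hypotheses (q0 : quasi_norm X0) (q1 : quasi_norm X1).
Let X0_ge0 := qn_ge0 q0.
Let X1_ge0 := qn_ge0 q1.
Let K := Kseq X0 X1.
Let K_ge0 f n : 0 <= K f n. Proof. exact: Kseq_ge0. Qed.

Lemma in_sum0 : in_sum X0 X1 0.
Proof. by apply: in_sum_l => //; rewrite (qn_0 q0) ltry. Qed.

Lemma Kseq0 n : K 0 n = 0.
Proof.
apply/eqP; rewrite eq_le K_ge0 andbT -lee_fin -KseqE//; last exact: in_sum0.
apply: (@le_trans _ _ (X0 0 + (expR n%:~R)%:E * X1 0)%E).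
  by apply: Kfun_le; rewrite ?(qn_0 q0) ?(qn_0 q1) ?addr0 ?ltry.
by rewrite (qn_0 q0) (qn_0 q1) mule0 adde0.
Qed.

Lemma Kseq_l f n : (X0 f < +oo)%E -> ((K f n)%:E <= X0 f)%E.
Proof.
move=> fX; rewrite -KseqE//; last exact: in_sum_l.
apply: (@le_trans _ _ (X0 f + (expR n%:~R)%:E * X1 0)%E).
  by apply: Kfun_le => //; rewrite ?(qn_0 q1) ?addr0 ?ltry.
by rewrite (qn_0 q1) mule0 adde0.
Qed.

Lemma Kseq_r f n : (X1 f < +oo)%E -> ((K f n)%:E <= (expR n%:~R)%:E * X1 f)%E.
Proof.
move=> fX; rewrite -KseqE//; last exact: in_sum_r.
apply: (@le_trans _ _ (X0 0 + (expR n%:~R)%:E * X1 f)%E).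
  by apply: Kfun_le => //; rewrite ?(qn_0 q0) ?add0r ?ltry.
by rewrite (qn_0 q0) add0e.
Qed.

Lemma KseqD : exists2 C : R, 0 < C & forall f g n,
  in_sum X0 X1 f -> in_sum X0 X1 g -> K (f + g) n <= C * (K f n + K g n).
Proof.
have [C C0 KC] := KfunD q0 q1; exists C => // f g n fs gs.
rewrite -lee_fin EFinM EFinD -!KseqE//; last exact: in_sumD.
by apply: KC => //; exact: expR_gt0.
Qed.

Lemma KseqN f n : K (- f) n = K f n.
Proof. by rewrite /K /Kseq KfunN. Qed.

(** A decomposition that is optimal at level [n] up to a factor two controls [f0]
    by [2 K f n] and [f1] by its linear bound; the remaining two estimates follow
    from the quasi-triangle inequality for [f0 = f - f1] and [f1 = f - f0]. No
    factor is available when [K f n = 0], but then [K f] vanishes identically and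
    [f + 0] serves. *)
Lemma near_optimal : exists2 D : R, 0 < D & forall f n, in_sum X0 X1 f ->
  exists f0 f1, [/\ in_sum X0 X1 f0, in_sum X0 X1 f1, f = f0 + f1,
    (forall k, k <= n -> K f0 k <= D * K f k /\
       K f1 k <= D * (expR (k - n)%:~R * K f n)) &
    (forall k, n <= k -> K f0 k <= D * K f n /\ K f1 k <= D * K f k)].
Proof.
have [C C0 KC] := KseqD; exists (C * 3 + 2) => [|f n fs].
  by rewrite addr_gt0// mulr_gt0.
have D1 : 0 <= C * 3 + 2 by rewrite addr_ge0// mulr_ge0// ltW.
have D2 (a : R) : 0 <= a -> 2 * a <= (C * 3 + 2) * a.
  by move=> a0; rewrite ler_wpM2r// lerDr mulr_ge0// ltW.
have D3 (a b : R) : 0 <= a -> b <= a -> C * (a + 2 * b) <= (C * 3 + 2) * a.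
  move=> a0 ba; apply: (@le_trans _ _ (C * (3 * a))).
    by rewrite ler_pM2l//; lra.
  by rewrite mulrA ler_wpM2r// lerDl.
have [Kn0|Kn0] := eqVneq (K f n) 0.
  have Kz k : K f k = 0.
    apply/eqP; rewrite eq_le K_ge0 andbT.
    have [kn|/ltW nk] := leP k n; first by rewrite -Kn0; exact: Kseq_mono.
    have := Kseq_dilate X0_ge0 X1_ge0 fs nk.
    by rewrite -/K Kn0 pmulr_rle0 ?expR_gt0.
  exists f, 0; rewrite addr0; split => //; first exact: in_sum0.
    by move=> k _; rewrite Kseq0 Kn0 Kz !mulr0.
  by move=> k _; rewrite Kseq0 Kn0 Kz !mulr0.
have Kn_gt0 : 0 < K f n by rewrite lt_neqAle eq_sym Kn0 K_ge0.
have : (Kfun X0 X1 f (expR n%:~R) < (2 * K f n)%:E)%E.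
  by rewrite KseqE// lte_fin mulr_natl mulr2n ltrDl.
move=> /ereal_inf_lt[_ [f0 [f1 [n0 n1 fE ->]]] /ltW le2].
have s0 := in_sum_l q1 n0; have s1 := in_sum_r q0 n1.
have e0 : (0 <= (expR n%:~R)%:E :> \bar R)%E by rewrite lee_fin expR_ge0.
have b0 k : K f0 k <= 2 * K f n.
  rewrite -lee_fin; apply: (le_trans (Kseq_l k n0)); apply: le_trans le2.
  by rewrite leeDl// mule_ge0.
have b1 k : K f1 k <= expR (k - n)%:~R * (2 * K f n).
  rewrite -lee_fin rmorphB/= expRD expRN EFinM.
  apply: (le_trans (Kseq_r k n1)).
  rewrite EFinM -muleA lee_wpmul2l ?lee_fin ?expR_ge0//.
  rewrite lee_pdivlMl ?expR_gt0//; apply: le_trans le2.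
  by rewrite leeDr.
have c0 k : K f0 k <= C * (K f k + K f1 k).
  have -> : f0 = f + - f1 by rewrite fE addrK.
  rewrite -[K f1 k]KseqN; apply: KC => //; exact: in_sumN.
have c1 k : K f1 k <= C * (K f k + K f0 k).
  have -> : f1 = f + - f0 by rewrite fE addrAC subrr add0r.
  rewrite -[K f0 k]KseqN; apply: KC => //; exact: in_sumN.
exists f0, f1; split => // k kn; split.
- apply: (le_trans (c0 k)); apply: le_trans (D3 _ (expR (k - n)%:~R * K f n) (K_ge0 f k) _).
    by rewrite ler_pM2l// lerD2l [leRHS]mulrCA.
  exact: Kseq_dilate.
- apply: (le_trans (b1 k)); rewrite mulrCA; apply: D2.
  by rewrite mulr_ge0// expR_ge0.
- apply: (le_trans (b0 k)); exact: D2.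
- apply: (le_trans (c1 k)); apply: le_trans (D3 _ (K f n) (K_ge0 f k) _).
    by rewrite ler_pM2l// lerD2l.
  exact: Kseq_mono.
Qed.

End NearOptimal.

(** * Equivalent quasi-norms *)

Section Equivalence.
Context {R : realType} {V : lmodType R}.
Implicit Types N X : V -> \bar R.

Definition equiv_norm N N' := exists2 C : R, 0 < C & forall f,
  (N f <= C%:E * N' f)%E /\ (N' f <= C%:E * N f)%E.

Lemma equiv_norm_same_space N N' : equiv_norm N N' -> same_space N N'.
Proof.
move=> [C C0 NC]; split; last by exists C.
by apply/seteqP; split => f /= fN; [apply: le_lt_trans (NC f).2 _|
  apply: le_lt_trans (NC f).1 _]; rewrite lte_mul_pinfty// lee_fin ltW.
Qed.

Lemma equiv_norm_trans N N' N'' : equiv_norm N N' -> equiv_norm N' N'' ->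
  equiv_norm N N''.
Proof.
move=> [C C0 NC] [D D0 ND]; exists (C * D) => [|f]; first exact: mulr_gt0.
have [h1 h2] := NC f; have [h3 h4] := ND f; split.
  by rewrite EFinM -muleA (le_trans h1)// lee_wpmul2l ?lee_fin// ltW.
by rewrite mulrC EFinM -muleA (le_trans h4)// lee_wpmul2l ?lee_fin// ltW.
Qed.

Lemma equiv_on_sum X0 X1 N N' (C : R) : 0 < C ->
  (forall f, in_sum X0 X1 f -> (N f <= C%:E * N' f)%E /\ (N' f <= C%:E * N f)%E) ->
  equiv_norm (on_sum X0 X1 N) (on_sum X0 X1 N').
Proof.
move=> C0 NN; exists C => // f; rewrite /on_sum; case: ifP => [/asboolP/NN//|_].
by rewrite gt0_muley ?lte_fin.
Qed.

End Equivalence.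

(** * Reiteration *)

Section Reiteration.
Context {R : realType} {V : lmodType R}.
Variables X0 X1 : V -> \bar R.
Hypotheses (q0 : quasi_norm X0) (q1 : quasi_norm X1).
Variables (theta0 theta1 : R).
Hypotheses (h0 : 0 < theta0) (h01 : theta0 < theta1) (h1 : theta1 < 1).
Variables (E E0 E1 F0 F1 : ri_space R) (a0 a1 b b0 b1 : R -> R).
Hypotheses (ha0 : slowly_varying a0) (ha1 : slowly_varying a1).
Hypotheses (hb : slowly_varying b) (hb0 : slowly_varying b0) (hb1 : slowly_varying b1).
Variables (s0 s1 : int -> R).
Hypotheses (hs0 : head_norm E0 (sample b0) s0) (hs1 : tail_norm E1 (sample b1) s1).

Let X0_ge0 := qn_ge0 q0.
Let X1_ge0 := qn_ge0 q1.
Let K := Kseq X0 X1.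
Let K_ge0 f n : 0 <= K f n. Proof. exact: Kseq_ge0. Qed.

Let w0 n := expR (- theta0 * n%:~R) * sample a0 n.
Let w1 n := expR (- theta1 * n%:~R) * sample a1 n.
Let r n := w0 n * s0 n / (w1 n * s1 n).
Let Y0 := interpR X0 X1 theta0 b0 E0 a0 F0.
Let Y1 := interpL X0 X1 theta1 b1 E1 a1 F1.

Let gb0 := growth_sample hb0.
Let gb1 := growth_sample hb1.
Let gw0 : growth (- theta0) w0.
Proof.
by rewrite -[X in growth X _]addr0; apply: growthM (growth_expR _) (growth_sample ha0).
Qed.
Let gw1 : growth (- theta1) w1.
Proof.
by rewrite -[X in growth X _]addr0; apply: growthM (growth_expR _) (growth_sample ha1).
Qed.
Let gr : growth (theta1 - theta0) r := growth_rho gb0 hs0 gb1 hs1 gw0 gw1.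
Let r0 n : 0 < r n := gr.1 n.
Let om00 n : 0 < w0 n * s0 n.
Proof. by rewrite mulr_gt0 ?gw0.1// (head_norm_gt0 gb0 hs0). Qed.
Let om10 n : 0 < w1 n * s1 n.
Proof. by rewrite mulr_gt0 ?gw1.1// (tail_norm_gt0 gb1 hs1). Qed.

Let Rn k := Rwhole E0 F0 (sample b0) w0 k.
Let Ln k := Lwhole E1 F1 (sample b1) w1 k.
Let Rh k n := Rhead E0 F0 (sample b0) w0 k n.
Let Lt k n := Ltail E1 F1 (sample b1) w1 k n.
Let S k n : \bar R := Ksum E0 F0 E1 F1 (sample b0) w0 s0 (sample b1) w1 s1 k n.
Let S_ge0 f n : (0 <= S (K f) n)%E.
Proof. exact: (Ksum_ge0 F0 F1 gb0 hs0 gb1 hs1 gw0 gw1). Qed.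

Lemma on_sum_in N f : in_sum X0 X1 f -> on_sum X0 X1 N f = N f.
Proof. by move=> fs; rewrite /on_sum asboolT. Qed.

Lemma on_sum_lty N f : (on_sum X0 X1 N f < +oo)%E -> in_sum X0 X1 f.
Proof. by rewrite /on_sum; case: asboolP => //; rewrite ltxx. Qed.

Lemma Y0_ge0 f : (0 <= Y0 f)%E.
Proof. by rewrite /Y0 /interpR /on_sum; case: ifP => _; rewrite ?leey ?tnorm_ge0. Qed.

Lemma Y1_ge0 f : (0 <= Y1 f)%E.
Proof. by rewrite /Y1 /interpL /on_sum; case: ifP => _; rewrite ?leey ?tnorm_ge0. Qed.

Lemma wK_blockwise theta (a : R -> R) : slowly_varying a ->
  exists2 C : R, 0 < C & forall f, in_sum X0 X1 f ->
    blockwise C (wK X0 X1 theta a f)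
      (fun n => expR (- theta * n%:~R) * sample a n * K f n).
Proof.
move=> asv; have := sampledM (sampled_power (- theta)) (sampled_sv asv).
by move=> /(Kfun_blockwise X0_ge0 X1_ge0).
Qed.

Let wK_ge0 w f k : (forall k, 0 < w k) -> 0 <= w k * K f k.
Proof. by move=> w_gt0; rewrite mulr_ge0// ltW. Qed.

Lemma Y0_bridge : exists2 A : R, 0 < A & forall f, in_sum X0 X1 f ->
  (Y0 f <= A%:E * Rn (K f))%E /\ (Rn (K f) <= A%:E * Y0 f)%E.
Proof.
have [C C0 HC] := wK_blockwise theta0 ha0.
have [D D0 HD] := quasi_const_Kseq X0_ge0 X1_ge0 gw0.
have [A A0 HA] := Rwhole_bridge E0 F0 hb0 C0 D0.
exists A => // f fs; rewrite /Y0 /interpR on_sum_in//.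
by apply: HA; [move=> k; apply: wK_ge0; exact: gw0.1|exact: HC|exact: HD].
Qed.

Lemma Y1_bridge : exists2 A : R, 0 < A & forall f, in_sum X0 X1 f ->
  (Y1 f <= A%:E * Ln (K f))%E /\ (Ln (K f) <= A%:E * Y1 f)%E.
Proof.
have [C C0 HC] := wK_blockwise theta1 ha1.
have [D D0 HD] := quasi_const_Kseq X0_ge0 X1_ge0 gw1.
have [A A0 HA] := Lwhole_bridge E1 F1 hb1 C0 D0.
exists A => // f fs; rewrite /Y1 /interpL on_sum_in//.
by apply: HA; [move=> k; apply: wK_ge0; exact: gw1.1|exact: HC|exact: HD].
Qed.

(** Besides the upper bound of the K-functional this shows that [f] belongs to the
    sum of the endpoint spaces as soon as the discrete expression is finite at one
    level. *)
Lemma Holmstedt_decomposition : exists2 C : R, 0 < C & forall f n, in_sum X0 X1 f ->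
  (S (K f) n < +oo)%E -> exists f0 f1, [/\ (Y0 f0 < +oo)%E, (Y1 f1 < +oo)%E,
    f = f0 + f1 & (Y0 f0 + (r n)%:E * Y1 f1 <= C%:E * S (K f) n)%E].
Proof.
have [D D0 HD] := near_optimal q0 q1.
have [C C0 HC] := Ksum_ge_norms F0 F1 h0 h1 gb0 hs0 gb1 hs1 gw0 gw1.
have [A A0 HA] := Y0_bridge; have [B B0 HB] := Y1_bridge.
have CD0 : 0 < C * D by rewrite mulr_gt0.
exists (A * (C * D) + B * (C * D)) => [|f n fs Sfin].
  by rewrite addr_gt0// mulr_gt0.
have [f0 [f1 [f0s f1s fE Hl Hr]]] := HD f n fs.
have [] := HC (K f) (K f0) (K f1) D n (K_ge0 f) (K_ge0 f0) (K_ge0 f1) (ltW D0) Hl Hr.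
rewrite -/(S _ _) -/(Rn _) -/(Ln _) -/(r n) => H0 H1.
have Y0le : (Y0 f0 <= (A * (C * D))%:E * S (K f) n)%E.
  apply: (le_trans (HA f0 f0s).1); rewrite EFinM -muleA.
  by rewrite lee_wpmul2l ?lee_fin// ltW.
have Y1le : ((r n)%:E * Y1 f1 <= (B * (C * D))%:E * S (K f) n)%E.
  apply: (@le_trans _ _ (B%:E * ((r n)%:E * Ln (K f1)))%E).
    rewrite muleCA lee_wpmul2l ?lee_fin ?(ltW (r0 n))//; exact: (HB f1 f1s).1.
  by rewrite (EFinM B) -muleA lee_wpmul2l ?lee_fin// ltW.
exists f0, f1; split => //.
- apply: (le_lt_trans Y0le); rewrite lte_mul_pinfty ?lee_fin//.
  by rewrite mulr_ge0// ltW.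
- rewrite -(@lte_pmul2l _ (r n)%:E)// ?lte_fin// gt0_muley ?lte_fin//.
  by apply: (le_lt_trans Y1le); rewrite lte_mul_pinfty ?lee_fin ?mulr_ge0// ltW.
rewrite EFinD ge0_muleDl ?lee_fin; [exact: leeD| |]; by rewrite mulr_ge0// ltW.
Qed.

Lemma Holmstedt_upper : exists2 C : R, 0 < C & forall f n, in_sum X0 X1 f ->
  (Kfun Y0 Y1 f (r n) <= C%:E * S (K f) n)%E.
Proof.
have [C C0 HC] := Holmstedt_decomposition; exists C => // f n fs.
have [Sfin|] := ltP (S (K f) n) +oo%E; last first.
  by rewrite leye_eq => /eqP ->; rewrite gt0_muley ?lte_fin// leey.
have [f0 [f1 [h0' h1' fE le]]] := HC f n fs Sfin.
by apply: le_trans le; exact: Kfun_le.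
Qed.

Lemma Holmstedt_lower : exists2 C : R, 0 < C & forall f n, in_sum X0 X1 f ->
  (S (K f) n <= C%:E * Kfun Y0 Y1 f (r n))%E.
Proof.
have [D D0 HD] := KseqD q0 q1.
have [C C0 HC] := Ksum_le_norms F0 F1 h01 gb0 hs0 gb1 hs1 gw0 gw1.
have [A A0 HA] := Y0_bridge; have [B B0 HB] := Y1_bridge.
have CD0 : 0 < C * D by rewrite mulr_gt0.
have AB0 : 0 < A + B by rewrite addr_gt0.
have CDAB : 0 < C * D * (A + B) by rewrite mulr_gt0.
exists (C * D * (A + B)) => // f n fs.
rewrite -lee_pdivrMl//; apply: le_ereal_inf_tmp => _ [f0 [f1 [n0 n1 fE ->]]].
rewrite lee_pdivrMl//.
have f0s := on_sum_lty n0; have f1s := on_sum_lty n1.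
have [_ R0] := HA f0 f0s; have [_ L1] := HB f1 f1s.
have Rfin : Rn (K f0) \is a fin_num.
  rewrite ge0_fin_numE; last exact: (Rwhole_ge0 E0 F0 gb0 gw0).
  by apply: (le_lt_trans R0); rewrite lte_mul_pinfty// lee_fin ltW.
have Lfin : Ln (K f1) \is a fin_num.
  rewrite ge0_fin_numE; last exact: (Lwhole_ge0 E1 F1 gb1 gw1).
  by apply: (le_lt_trans L1); rewrite lte_mul_pinfty// lee_fin ltW.
have Kf k : K f k <= D * (K f0 k + K f1 k) by rewrite fE; exact: HD.
apply: (le_trans (HC (K f) (K f0) (K f1) D (fine (Rn (K f0))) (fine (Ln (K f1))) n
  (K_ge0 f) (K_ge0 f0) (K_ge0 f1) (ltW D0) Kf _ _)); rewrite ?fineK//.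
rewrite -/(r n) (EFinM (C * D)) EFinD (EFinM (r n)) !fineK// (EFinM (C * D)) -muleA.
rewrite lee_wpmul2l ?lee_fin ?(ltW CD0)//.
have rY0 : (0 <= (r n)%:E * Y1 f1)%E by rewrite mule_ge0 ?Y1_ge0// lee_fin ltW.
rewrite ge0_muleDr ?Y0_ge0//; apply: leeD.
  apply: (le_trans R0); rewrite lee_wpmul2r ?Y0_ge0// lee_fin lerDl ltW//.
rewrite muleCA lee_wpmul2l ?lee_fin ?(ltW (r0 n))//.
by apply: (le_trans L1); rewrite lee_wpmul2r ?Y1_ge0// lee_fin lerDr ltW.
Qed.

(** The weight [t^(-theta) b(t)] at [t = rho], with [b] evaluated at the lower end of
    the block of [rho]. *)
Definition reweight theta (n : int) : R :=
  (r n `^ theta)^-1 * sample b (level r n).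

Let W theta n := reweight theta n.

Lemma growth_reweight theta : 0 <= theta ->
  growth (- (theta * (theta1 - theta0))) (reweight theta).
Proof.
move=> t0; rewrite -[X in growth X _]addr0.
exact: growthM (growthV (growth_powR t0 gr)) (growth_comp hb gr).
Qed.

Let v theta m := expR (- theta * m%:~R) * sample b m.

Lemma v_reweight theta n : 0 <= theta ->
  W theta n <= v theta (level r n) /\ v theta (level r n) <= expR theta * W theta n.
Proof.
move=> t0; have b_gt0 m : 0 < sample b m := (growth_sample hb).1 m.
have /andP[l1 l2] := floor_itv (ln (r n)); rewrite -/(level r n) intrD in l1 l2.
rewrite /W /reweight /v powR_expR_ln// -expRN mulrA -expRD.
split; rewrite ler_wpM2r ?(ltW (b_gt0 _))// ler_expR mulNr.
  by rewrite lerN2 ler_wpM2l.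
by have := ler_wpM2l t0 (ltW l2); rewrite mulrDr mulr1; lra.
Qed.

Let MK theta f : \bar R := snorm E (fun n => (W theta n)%:E * S (K f) n)%E.

(** The norm is first sampled in the variable [t], where the sequence [G] varies by
    bounded factors over bounded distances; then [t] is replaced by [rho], of which
    the levels cover the integers coarsely and with bounded multiplicity; finally
    the K-functional at [rho] is replaced by the discrete expression. Outside the
    sum of the endpoint spaces both sides are infinite. *)
Lemma interp_equiv theta : 0 <= theta ->
  equiv_norm (interp Y0 Y1 theta b E) (on_sum X0 X1 (MK theta)).
Proof.
move=> t0.
have gv : growth (- theta) (v theta).
  by rewrite -[X in growth X _]addr0; apply: growthM (growth_expR _) (growth_sample hb).
have v0 := gv.1.
have W_gt0 n : 0 < W theta n := (growth_reweight t0).1 n.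
have [C1 C10 HC1] := Kfun_blockwise Y0_ge0 Y1_ge0
  (sampledM (sampled_power (- theta)) (sampled_sv hb)).
have d0 : 0 < theta1 - theta0 by rewrite subr_gt0.
have [M HM] := level_inj d0 gr; have [A HA] := level_surj d0 gr.
have [CU CU0 HU] := Holmstedt_upper; have [CL CL0 HL] := Holmstedt_lower.
(* quasi-constancy of the sampled weight over distances up to [A] *)
have [Cq Cq0 Hq] : exists2 C : R, 0 < C & forall k l, (`|k - l| <= A)%N ->
    v theta k <= C * v theta l.
  have [C C0 vC] := gv.2 _ ltr01.
  exists (C * expR (`|theta| * A%:R + A%:R)) => [|k l kl].
    by rewrite mulr_gt0// expR_gt0.
  apply: (le_trans (vC k l)); rewrite ler_pM2r// ler_pM2l// ler_expR mul1r.
  have klA : `|(k - l)%:~R| <= A%:R :> R.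
    by rewrite -intr_norm -abszE -pmulrn ler_nat.
  apply: lerD => //; apply: le_trans (ler_norm _) _.
  by rewrite normrM normrN ler_wpM2l.
pose KY := Kseq Y0 Y1.
pose G f m : \bar R := (v theta m * KY f m)%:E.
have KY0 f m : 0 <= KY f m by apply: Kseq_ge0; [exact: Y0_ge0|exact: Y1_ge0].
have G0 f m : (0 <= G f m)%E by rewrite lee_fin mulr_ge0// ltW.
pose D1 := Cq * expR A%:R.
have D10 : 0 < D1 by rewrite mulr_gt0// expR_gt0.
have HG f k l : in_sum Y0 Y1 f -> (`|k - l| <= A)%N -> (G f k <= D1%:E * G f l)%E.
  move=> fs kl; rewrite -EFinM lee_fin -mulrACA; apply: ler_pM => //; [exact: ltW|exact: Hq|].
  have [lk|/ltW kl'] := leP k l.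
    apply: (le_trans (Kseq_mono Y0_ge0 Y1_ge0 fs lk)).
    by rewrite ler_peMl// -[leLHS]expR0 ler_expR.
  have := Kseq_dilate Y0_ge0 Y1_ge0 fs kl'; rewrite -opprB rmorphN/= expRN ler_pdivrMl ?expR_gt0//.
  move=> /le_trans; apply; rewrite ler_wpM2r// ler_expR.
  by move: kl; rewrite -(ler_nat R) natr_absz ger0_norm// subr_ge0.
have up f : in_sum Y0 Y1 f -> in_sum X0 X1 f ->
    (snorm E (fun n => G f (level r n)) <= (expR theta * CU)%:E * MK theta f)%E.
  move=> fY fX; apply: le_snormZ => // [|n|n].
  - by rewrite mulr_ge0 ?expR_ge0// ltW.
  - by rewrite mule_ge0 ?S_ge0// lee_fin ltW.
  rewrite (EFinM (expR theta)) muleACA /G (EFinM (v theta _)); apply: lee_pmul.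
  - by rewrite lee_fin ltW.
  - by rewrite lee_fin.
  - by rewrite -EFinM lee_fin; exact: (v_reweight n t0).2.
  rewrite -KseqE//; [|exact: Y0_ge0|exact: Y1_ge0].
  apply: le_trans (HU f n fX); apply: Kfun_mono; [exact: Y1_ge0|exact: expR_ge0|].
  exact: expR_lg_le.
have lo f : in_sum Y0 Y1 f -> in_sum X0 X1 f ->
    (MK theta f <= (CL * expR 1)%:E * snorm E (fun n => G f (level r n)))%E.
  move=> fY fX; apply: le_snormZ => // [|n|n].
  - by rewrite mulr_ge0 ?expR_ge0// ltW.
  - by rewrite mule_ge0 ?S_ge0// lee_fin ltW.
  rewrite /G (EFinM (v theta _)) muleCA; apply: lee_pmul.
  - by rewrite lee_fin ltW.
  - exact: S_ge0.
  - by rewrite lee_fin; exact: (v_reweight n t0).1.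
  apply: (le_trans (HL f n fX)); rewrite EFinM -muleA lee_wpmul2l ?lee_fin ?(ltW CL0)//.
  rewrite -KseqE//; [|exact: Y0_ge0|exact: Y1_ge0].
  apply: le_trans (Kfun_dilate Y0_ge0 Y1_ge0 f (expR_gt0 _) (expR_lg_le (r0 n))) _.
  rewrite lee_wpmul2r ?lee_fin//.
    by apply: Kfun_ge0; [exact: Y0_ge0|exact: Y1_ge0|exact: expR_ge0].
  by rewrite ler_pdivrMr ?expR_gt0//; exact/ltW/expR_lg_gt.
have sub f : in_sum Y0 Y1 f -> in_sum X0 X1 f.
  move=> [f0 [f1 [/on_sum_lty f0s /on_sum_lty f1s ->]]]; exact: in_sumD.
pose B1 := C1 * (D1 * (A + A).+1%:R) * (expR theta * CU).
pose B2 := CL * expR 1 * M.+1%:R * C1.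
have B10 : 0 < B1 by rewrite !mulr_gt0// ?expR_gt0// ltr0n.
have B20 : 0 < B2 by rewrite !mulr_gt0// ?expR_gt0// ltr0n.
exists (B1 + B2) => [|f]; first exact: addr_gt0.
have [fY|nfY] := pselect (in_sum Y0 Y1 f); last first.
  have -> : interp Y0 Y1 theta b E f = +oo%E by rewrite /interp /on_sum asboolF.
  rewrite gt0_muley ?lte_fin ?addr_gt0// leey; split => //.
  suff -> : on_sum X0 X1 (MK theta) f = +oo%E.
    by rewrite gt0_muley ?lte_fin ?addr_gt0// leey.
  rewrite /on_sum; case: asboolP => // fX; apply/eqP; rewrite -leye_eq leNgt.
  apply/negP => Mfin; apply: nfY.
  have : ((W theta 0)%:E * S (K f) 0 < +oo)%E.
    by apply: snorm_lty Mfin => k; rewrite mule_ge0 ?S_ge0// lee_fin ltW.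
  rewrite -[X in (_ < X)%E -> _](@gt0_muley _ (W theta 0)%:E) ?lte_fin//.
  rewrite lte_pmul2l ?lte_fin// => Sfin.
  have [C _ HC] := Holmstedt_decomposition.
  by have [f0 [f1 [? ? ? _]]] := HC f 0 fX Sfin; exists f0, f1.
have fX := sub f fY.
rewrite on_sum_in// /interp /on_sum asboolT//.
have T0 := tnorm_ge0 E (wK Y0 Y1 theta b f).
have MK0 : (0 <= MK theta f)%E.
  by apply: snorm_ge0 => k; rewrite mule_ge0 ?S_ge0// lee_fin ltW.
have bw := HC1 f fY.
have B1p : 0 <= B1 by exact: ltW. have B2p : 0 <= B2 by exact: ltW.
split.
  apply: (@le_trans _ _ (B1%:E * MK theta f)%E); last first.
    by rewrite lee_wpmul2r// lee_fin lerDl.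
  apply: (@le_trans _ _ (C1%:E * snorm E (G f))%E).
    by apply: tnorm_le_snorm => // [|t /bw[? ? _] //]; exact: ltW.
  rewrite /B1 -mulrA EFinM -muleA lee_wpmul2l ?lee_fin ?(ltW C10)//.
  apply: le_trans (snorm_le_comp (p := level r) (A := A) (D := D1) E (G0 f) _ _ _) _ => //.
  - exact: ltW.
  - by move=> k l; exact: HG.
  rewrite (EFinM (D1 * (A + A).+1%:R)) -muleA lee_wpmul2l ?up//.
  by rewrite lee_fin mulr_ge0//; exact: ltW.
apply: (@le_trans _ _ (B2%:E * tnorm E (wK Y0 Y1 theta b f))%E); last first.
  by rewrite lee_wpmul2r// lee_fin lerDr.
apply: (le_trans (lo f fY fX)).
rewrite /B2 -mulrA (EFinM (CL * expR 1)) -muleA.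
rewrite lee_wpmul2l ?lee_fin ?mulr_ge0 ?expR_ge0 ?(ltW CL0)//.
apply: le_trans (snorm_comp E (G0 f) HM) _.
rewrite EFinM -muleA lee_wpmul2l ?lee_fin//.
by apply: snorm_le_tnorm => // t /bw[].
Qed.

Let rho u := u `^ (theta1 - theta0) * (Alow a0 b0 E0 u / Ahigh a1 b1 E1 u).

Let rE n : r n = expR ((theta1 - theta0) * n%:~R) *
  (sample a0 n * s0 n / (sample a1 n * s1 n)).
Proof.
rewrite /r /w0 /w1 mulrBl expRD !mulNr !expRN.
have a1n : sample a1 n != 0 by rewrite gt_eqF// (growth_sample ha1).1.
have s1n : s1 n != 0 by rewrite gt_eqF// (tail_norm_gt0 gb1 hs1).
have e0 := expR_gt0 (theta0 * n%:~R); have e1 := expR_gt0 (theta1 * n%:~R).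
by field; rewrite a1n s1n !gt_eqF.
Qed.

Lemma sampled_rho : sampled rho r.
Proof.
have -> : r = (fun n => expR ((theta1 - theta0) * n%:~R) *
    (sample a0 n * s0 n / (sample a1 n * s1 n))) by apply/funext => n; exact: rE.
exact: sampledM (sampled_power (theta1 - theta0))
  (sampledM (sampled_Alow ha0 hb0 hs0) (sampledV (sampled_Ahigh ha1 hb1 hs1))).
Qed.

Lemma interior_equiv theta : 0 < theta -> theta < 1 ->
  equiv_norm (on_sum X0 X1 (MK theta))
    (interp X0 X1 ((1 - theta) * theta0 + theta * theta1)
      (fun u => Alow a0 b0 E0 u `^ (1 - theta) *
                Ahigh a1 b1 E1 u `^ theta * b (rho u)) E).
Proof.
move=> t0 t1; set tt := (1 - theta) * theta0 + theta * theta1.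
have t0' := ltW t0; have t1' : 0 <= 1 - theta by rewrite subr_ge0 ltW.
have gW := growth_reweight t0'.
have [C C0 HC] := WKsum_interior F0 F1 h01 gb0 hs0 gb1 hs1 gw0 gw1 E t0 t1 gW.
have sh := sampledM (sampled_power (- tt))
  (sampledM (sampledM (sampled_powR t1' (sampled_Alow ha0 hb0 hs0))
    (sampled_powR t0' (sampled_Ahigh ha1 hb1 hs1)))
  (sampled_comp hb sampled_rho)).
have [D D0 HD] := Kfun_blockwise X0_ge0 X1_ge0 sh.
(* collecting powers: the middle term carries the weight of the right-hand side *)
have vE f n : W theta n * (w0 n * s0 n * K f n) =
  expR (- tt * n%:~R) * ((sample a0 n * s0 n) `^ (1 - theta) *
    (sample a1 n * s1 n) `^ theta * sample b (level r n)) * K f n.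
  have al0 : 0 < sample a0 n * s0 n.
    by rewrite mulr_gt0 ?(growth_sample ha0).1// (head_norm_gt0 gb0 hs0).
  have al1 : 0 < sample a1 n * s1 n.
    by rewrite mulr_gt0 ?(growth_sample ha1).1// (tail_norm_gt0 gb1 hs1).
  rewrite /W /reweight.
  have -> : w0 n * s0 n = expR (- theta0 * n%:~R + ln (sample a0 n * s0 n)).
    by rewrite expRD lnK// /w0 mulrA.
  have -> : r n = expR ((theta1 - theta0) * n%:~R + ln (sample a0 n * s0 n) -
      ln (sample a1 n * s1 n)).
    by rewrite rE -addrA expRD expRD expRN !lnK.
  rewrite !powR_expR_ln ?expR_gt0// expRK -expRN.
  set p := ln _; set q := ln _; set bn := sample b _.
  set e1 := expR _; set e2 := expR _; set e3 := expR _; set e4 := expR _.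
  set e5 := expR _.
  have ee : e1 * e2 = e3 * (e4 * e5).
    by rewrite -!expRD /tt; congr expR; ring.
  have -> : e1 * bn * (e2 * K f n) = (e1 * e2) * (bn * K f n) by ring.
  by rewrite ee; ring.
have W_gt0 n : 0 < W theta n := gW.1 n.
pose Z f n : \bar R := (W theta n * (w0 n * s0 n * K f n))%:E.
have Z0 f n : (0 <= Z f n)%E.
  rewrite lee_fin; apply: mulr_ge0; first exact: ltW.
  by apply: mulr_ge0 => //; exact: ltW.
apply: (equiv_norm_trans (N' := on_sum X0 X1 (fun f => snorm E (Z f)))).
  apply: (@equiv_on_sum _ _ _ _ _ _ (C + 1)) => [|f fs]; first by rewrite addr_gt0.
  have [H1 H2] := HC (K f) (K_ge0 f).
  have snZ : (0 <= snorm E (Z f))%E by exact: snorm_ge0.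
  have MK0 : (0 <= MK theta f)%E by apply: le_trans H2.
  split; first by apply: (le_trans H1); rewrite lee_wpmul2r// lee_fin lerDl.
  apply: (le_trans H2); rewrite -[leLHS]mul1e lee_wpmul2r//.
  by rewrite lee_fin lerDr ltW.
apply: (equiv_on_sum D0) => f fs; split.
  apply: snorm_le_tnorm => // t t0''; have [_ _] := HD f fs t t0''.
  by rewrite /Z vE.
apply: tnorm_le_snorm => // [|t t0'']; first exact: ltW.
have [h2 h3 _] := HD f fs t t0''; split; first exact: h2.
by rewrite /Z vE; exact: h3.
Qed.

Lemma endpoint0_equiv :
  equiv_norm (on_sum X0 X1 (MK 0))
    (interpRL X0 X1 theta0 (b \o rho) E b0 E0 a0 F0).
Proof.
have gW : growth 0 (W 0) by have := growth_reweight (lexx 0); rewrite mul0r oppr0.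
have [C C0 HC] := WKsum_zero F0 F1 h01 gb0 hs0 gb1 hs1 gw0 gw1 E gW.
have W_gt0 n : 0 < W 0 n := gW.1 n.
have WE n : W 0 n = sample b (level r n) by rewrite /W /reweight powRr0 invr1 mul1r.
pose Z f n : \bar R := ((W 0 n)%:E * Rh (K f) n)%E.
have Rh0 f n : (0 <= Rh (K f) n)%E by exact: (Rhead_ge0 E0 F0 gb0 gw0).
have Z0 f n : (0 <= Z f n)%E by rewrite mule_ge0// lee_fin ltW.
apply: (equiv_norm_trans (N' := on_sum X0 X1 (fun f => snorm E (Z f)))).
  have Ce : 0 < 1 + C * expR 1 by rewrite addr_gt0// mulr_gt0// expR_gt0.
  apply: (equiv_on_sum Ce) => f fs.
  have [|H1 H2] := HC (K f) (expR 1) (K_ge0 f) (expR_ge0 _).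
    move=> k; have := Kseq_dilate X0_ge0 X1_ge0 fs (m := k) (n := k + 1).
    rewrite lerDl opprD addrA subrr add0r expRN => /(_ isT).
    by rewrite ler_pdivrMl ?expR_gt0.
  have snZ : (0 <= snorm E (Z f))%E by exact: snorm_ge0.
  split => //; apply: (le_trans H2); rewrite -[leLHS]mul1e lee_wpmul2r//.
    exact: le_trans snZ H2.
  by rewrite lee_fin lerDl mulr_ge0 ?expR_ge0// ltW.
have [A A0 HA] := wK_blockwise theta0 ha0.
have [D D0 HD] := quasi_const_Kseq X0_ge0 X1_ge0 gw0.
have [B B0 HB] := Rhead_bridge E0 F0 hb0 A0 D0.
have [c c0 Hc] := sampled_comp hb sampled_rho.
have cB0 : 0 < c * B by rewrite mulr_gt0.
apply: (equiv_on_sum cB0) => f fs.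
have wK_0 k : 0 <= w0 k * K f k by apply: wK_ge0; exact: gw0.1.
have bd u u0 := HB _ _ u wK_0 (HA f fs) (HD f fs) u0.
split.
  apply: snorm_le_tnorm => // u u0; have [H1 H2] := bd u u0.
  have [c1 c2 c3] := Hc u u0.
  rewrite EFinM muleACA /Z; apply: lee_pmul => //; first by rewrite lee_fin ltW.
  by rewrite WE -EFinM lee_fin.
apply: tnorm_le_snorm => // [|u u0]; first exact: ltW.
have [H1 H2] := bd u u0; have [c1 c2 c3] := Hc u u0.
split; first by rewrite mule_ge0 ?tnorm_on_ge0// lee_fin ltW.
rewrite EFinM muleACA /Z; apply: lee_pmul => //; rewrite ?tnorm_on_ge0//.
  by rewrite lee_fin ltW.
by rewrite WE -EFinM lee_fin.
Qed.

Lemma endpoint1_equiv :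
  equiv_norm (on_sum X0 X1 (MK 1))
    (interpLR X0 X1 theta1 (b \o rho) E b1 E1 a1 F1).
Proof.
have gW : growth (- (theta1 - theta0)) (W 1).
  by have := growth_reweight ler01; rewrite mul1r.
have [C C0 HC] := WKsum_one F0 F1 h01 gb0 hs0 gb1 hs1 gw0 gw1 E gW.
have W_gt0 n : 0 < W 1 n := gW.1 n.
have WE n : W 1 n * r n = sample b (level r n).
  by rewrite /W /reweight powRr1 ?(ltW (r0 n))// mulrAC mulVf ?mul1r// gt_eqF.
pose Z f n : \bar R := ((W 1 n * r n)%:E * Lt (K f) n)%E.
have Lt0 f n : (0 <= Lt (K f) n)%E by exact: (Ltail_ge0 E1 F1 gb1 gw1).
have Z0 f n : (0 <= Z f n)%E by rewrite mule_ge0// lee_fin mulr_ge0// ltW.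
apply: (equiv_norm_trans (N' := on_sum X0 X1 (fun f => snorm E (Z f)))).
  have Ce : 0 < C + 1 by rewrite addr_gt0.
  apply: (equiv_on_sum Ce) => f fs.
  have [|H1 H2] := HC (K f) (K_ge0 f).
    by move=> k; apply: Kseq_mono => //; rewrite lerDl.
  have snZ : (0 <= snorm E (Z f))%E by exact: snorm_ge0.
  split; first by apply: (le_trans H1); rewrite lee_wpmul2r// lee_fin lerDl.
  apply: (le_trans H2); rewrite -[leLHS]mul1e lee_wpmul2r//.
    exact: le_trans snZ H2.
  by rewrite lee_fin lerDr ltW.
have [A A0 HA] := wK_blockwise theta1 ha1.
have [D D0 HD] := quasi_const_Kseq X0_ge0 X1_ge0 gw1.
have [B B0 HB] := Ltail_bridge E1 F1 hb1 A0 D0.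
have [c c0 Hc] := sampled_comp hb sampled_rho.
have cB0 : 0 < c * B by rewrite mulr_gt0.
apply: (equiv_on_sum cB0) => f fs.
have wK_0 k : 0 <= w1 k * K f k by apply: wK_ge0; exact: gw1.1.
have bd u u0 := HB _ _ u wK_0 (HA f fs) (HD f fs) u0.
split.
  apply: snorm_le_tnorm => // u u0; have [H1 H2] := bd u u0.
  have [c1 c2 c3] := Hc u u0.
  rewrite (EFinM c) muleACA /Z; apply: lee_pmul => //.
    by rewrite lee_fin mulr_ge0// ltW.
  by rewrite WE -EFinM lee_fin.
apply: tnorm_le_snorm => // [|u u0]; first exact: ltW.
have [H1 H2] := bd u u0; have [c1 c2 c3] := Hc u u0.
split; first by rewrite mule_ge0 ?tnorm_on_ge0// lee_fin ltW.
rewrite (EFinM c) muleACA /Z; apply: lee_pmul => //; rewrite ?tnorm_on_ge0//.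
  by rewrite lee_fin ltW.
by rewrite WE -EFinM lee_fin.
Qed.

End Reiteration.

Lemma quasi_banach_norm (R : realType) (V : topologicalLmodType R) (X : V -> \bar R) :
  quasi_banach_in X -> quasi_norm X.
Proof.
move=> q; split.
- exact: qb_ge0 q.
- exact/(qb_eq0 q).
- by move=> f; rewrite -scaleN1r (qb_homo q) normrN normr1 mul1e.
- exact: qb_triangle q.
Qed.

Theorem theorem4p5 (R : realType) (V : topologicalLmodType R)
    (X0 X1 : V -> \bar R) (hX : compatible_couple X0 X1)
    (theta0 theta1 : R)
    (h0 : 0 < theta0) (h01 : theta0 < theta1) (h1 : theta1 < 1)
    (E E0 E1 F0 F1 : ri_space R) (a0 a1 b b0 b1 : R -> R)
    (ha0 : slowly_varying a0) (ha1 : slowly_varying a1)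
    (hb : slowly_varying b) (hb0 : slowly_varying b0)
    (hb1 : slowly_varying b1)
    (hb0E : (tnorm_on E0 `]0%R, 1%R[ (fun t => (b0 t)%:E) < +oo)%E)
    (hb1E : (tnorm_on E1 `]1%R, +oo[ (fun t => (b1 t)%:E) < +oo)%E) :
  let rho := fun u : R =>
    u `^ (theta1 - theta0) * (Alow a0 b0 E0 u / Ahigh a1 b1 E1 u) in
  let Y0 := interpR X0 X1 theta0 b0 E0 a0 F0 in
  let Y1 := interpL X0 X1 theta1 b1 E1 a1 F1 in
  [/\ forall theta : R, 0 < theta -> theta < 1 ->
        same_space
          (interp Y0 Y1 theta b E)
          (interp X0 X1 ((1 - theta) * theta0 + theta * theta1)
             (fun u => Alow a0 b0 E0 u `^ (1 - theta) *
                       Ahigh a1 b1 E1 u `^ theta * b (rho u)) E),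
      (tnorm_on E `]1%R, +oo[ (fun t => (b t)%:E) < +oo)%E ->
        same_space
          (interp Y0 Y1 0 b E)
          (interpRL X0 X1 theta0 (b \o rho) E b0 E0 a0 F0) &
      (tnorm_on E `]0%R, 1%R[ (fun t => (b t)%:E) < +oo)%E ->
        same_space
          (interp Y0 Y1 1 b E)
          (interpLR X0 X1 theta1 (b \o rho) E b1 E1 a1 F1)].
Proof.
have [_ /quasi_banach_norm q0 /quasi_banach_norm q1] := hX.
have [s0 hs0] := head_norm_exists hb0 hb0E.
have [s1 hs1] := tail_norm_exists hb1 hb1E.
move=> rho Y0 Y1.
have lhs theta := @interp_equiv R V X0 X1 q0 q1 theta0 theta1 h0 h01 h1 E E0 E1 F0 F1
  a0 a1 b b0 b1 ha0 ha1 hb hb0 hb1 s0 s1 hs0 hs1 theta.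
split=> [theta t0 t1|_|_]; apply: equiv_norm_same_space.
- by apply: (equiv_norm_trans (lhs theta (ltW t0))); exact: interior_equiv.
- by apply: (equiv_norm_trans (lhs 0 (lexx 0))); exact: endpoint0_equiv.
- by apply: (equiv_norm_trans (lhs 1 ler01)); exact: endpoint1_equiv.
Qed.
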